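(* There is a polynomial $p$ such that the following holds. Let $n,k,d$ be positive integers with $k\le n$ and $d\le n$, let $\sigma>0$, let $\mu_1,\ldots,\mu_n\in[0,1]^d$ be arbitrary, and let $\mathcal{X}=\{x_1,\ldots,x_n\}\subseteq\mathbb{R}^d$, where $x_i=\mu_i+g_i$ and $g_1,\ldots,g_n$ are independent $d$-dimensional Gaussian random vectors with mean $0$ whose coordinates are independent with standard deviation $\sigma$. Then for every choice of initial centers, the expected number of iterations of the $k$-means method on $\mathcal{X}$ is at most $p\bigl(n^{\sqrt{k}},1/\sigma\bigr)$.
   Context: The $k$-means method on a finite point set $\mathcal{X}\subseteq\mathbb{R}^d$ with $k$ clusters: (1) select initial cluster centers $c_1,\ldots,c_k\in\mathbb{R}^d$; (2) assign every $x\in\mathcal{X}$ to the cluster $C_i$ whose center $c_i$ is closest to $x$; (3) set $c_i=\frac{1}{|C_i|}\sum_{x\in C_i}x$ for every $i$; (4) if the clusters or the centers have changed, go to (2), otherwise terminate. An iteration is one execution of steps (2)–(3); the running time is the number of iterations. The paper's standing assumptions are $k\le n$ and $d\le n$. *)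

(* Defs.v *)
From HB Require Import structures.
From mathcomp Require Import all_boot all_order all_algebra.
From mathcomp Require Import all_classical all_reals all_analysis.
Set Implicit Arguments. Unset Strict Implicit. Unset Printing Implicit Defensive.
Import Order.TTheory GRing.Theory Num.Theory.
Local Open Scope classical_set_scope.
Local Open Scope ring_scope.

Section KMeans.
Variables (R : realType) (n k d : nat).
Local Notation point := 'rV[R]_d.

Definition sqdist (x y : point) : R := \sum_(j < d) (x ord0 j - y ord0 j) ^+ 2.

(* step (2): index of a closest center (ties broken deterministically by
   Order.arg_min; i0 : 'I_k is only a starting element, needed since k > 0) *)
Definition assign (i0 : 'I_k) (c : {ffun 'I_k -> point}) (x : point) : 'I_k :=
  [arg min_(i < i0) sqdist x (c i)]%O.

Definition kmeans_step (i0 : 'I_k) (X : 'I_n -> point) (c : {ffun 'I_k -> point})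
  : {ffun 'I_n -> 'I_k} * {ffun 'I_k -> point} :=
  let a := [ffun j => assign i0 c (X j)] in
  (a, [ffun i => let C := [set j | a j == i] in
                 if #|C| == 0%N then c i
                 else (#|C|%:R)^-1 *: \sum_(j in C) X j]).

Fixpoint kmeans_state (i0 : 'I_k) (X : 'I_n -> point) (c0 : {ffun 'I_k -> point})
  (t : nat) : option {ffun 'I_n -> 'I_k} * {ffun 'I_k -> point} :=
  match t with
  | 0 => (None, c0)
  | t'.+1 => let: (_, c) := kmeans_state i0 X c0 t' in
             let: (a, c') := kmeans_step i0 X c in (Some a, c')
  end.

Definition kmeans_stops_at (i0 : 'I_k) (X : 'I_n -> point)
  (c0 : {ffun 'I_k -> point}) (m : nat) : Prop :=
  (0 < m)%N /\ kmeans_state i0 X c0 m = kmeans_state i0 X c0 m.-1.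

(* running time = number of iterations until termination (+oo if it never
   terminates) *)
Definition kmeans_iterations (i0 : 'I_k) (X : 'I_n -> point)
  (c0 : {ffun 'I_k -> point}) : \bar R :=
  ereal_inf [set (m%:R)%:E | m in kmeans_stops_at i0 X c0].
End KMeans.

Section Gauss.
Variables (R : realType) (I : eqType).
(* iterated integration of f over independent N(0, sigma^2) coordinates g_i,
   i ranging over s; g0 supplies the coordinates not (yet) integrated *)
Fixpoint gauss_iter (sigma : R) (s : seq I) (f : (I -> R) -> \bar R)
  (g0 : I -> R) : \bar R :=
  match s with
  | [::] => f g0
  | i :: s' => (\int[normal_prob 0 sigma]_t
                  gauss_iter sigma s' f (fun j => if j == i then t else g0 j))%E
  end.
End Gauss.

(* expectation of a nonnegative extended-real function of a family
   (g_i)_{i in I} (I finite) of independent centered Gaussians with standard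
   deviation sigma *)
Definition gauss_expect (R : realType) (I : finType) (sigma : R)
  (f : (I -> R) -> \bar R) : \bar R :=
  gauss_iter sigma (enum I) f (fun _ => 0).

(* Main.v *)
(* The potential of a clustering, the sum of the squared distances of the points
   to the means of their clusters, decreases at every iteration.  Hence a run of
   more than 2^l iterations contains a window of two (if d = 1, of k + 1)
   consecutive steps in which the potential drops by at most eta^2, where eta^2
   is proportional to 2^-l, and it suffices to show that such a window has
   probability at most M (eta / sigma)^2 with M polynomial in n^(sqrt k) and
   1 / sigma: since a run never exceeds k^n + 2 iterations, summing 2^l P(T > 2^l)
   over l <= n^2 + 2 then bounds the expectation.

   In a tiny step the mean of every cluster moves by O(eta), and every reassigned
   point lies near the bisector of its old and new centers.  Let d >= 2 and
   q ~ sqrt k.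
   - A close pair of centers confines its two clusters to a thin slab, so these
     clusters have O(d) points.  Rounding all centers then shows that O(k d)
     points move.
   - If a label has O(q d) moves and its size changes, its center is determined
     up to O(n eta) by the points moving in and out.  If its size does not
     change, these points satisfy an integer relation up to O(n eta), which is
     unlikely.
   - Fewer than q / 10 labels can have more than 400 q d moves, so such a label i
     makes most of its moves with labels of the previous kind.  Given all moves,
     only the center of i has to be rounded, and the moves at i are of the order
     of q d independent events of probability O(sqrt eta).  The union bound over
     the n^(O(k d)) sets of moves is affordable since k d <= q (q d).
   - So all labels have O(q d) moves in both steps.  Some label has three
     distinct clusters around the two steps; eliminating its center from the two
     mean equations leaves an integer relation between O(q d) points, up to
     O(n^2 eta) in each of the d >= 2 coordinates.

   In dimension one a tiny step increases the number of nonempty clusters unless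
   three points are within O(n^4 eta) of each other. *)
Require Import Defs.
From HB Require Import structures.
From mathcomp Require Import all_boot all_order all_algebra.
From mathcomp Require Import all_classical all_reals all_analysis.
From mathcomp Require Import measurable_realfun zify ring lra.
Set Implicit Arguments. Unset Strict Implicit. Unset Printing Implicit Defensive.
Import Order.TTheory GRing.Theory Num.Theory.
Import numFieldNormedType.Exports.
Local Open Scope ring_scope.
Local Open Scope classical_set_scope.

(** * Independent Gaussian coordinates *)

(** In the dyadic sum the factor 2^l cancels against eta^2, so all scales contribute equally and a
    window must have probability of order eta^2. Every bad event of positive probability is
    therefore bounded by the fourth power of a quantity [z] proportional to sqrt eta. The root comes
    from the threshold [theta], with [theta ^+ 2 = R0 * eta], between close and far pairs of
    centers. Up to powers of n, the slab around a close pair has thickness theta, and at a far pair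
    an uncertainty R0 eta of the difference of squared distances, divided by the slope theta, is
    again theta.

    The obstacle to a plain union bound is that a center determined by the moving points depends on
    these very points, so the bisector tests at different points are not independent. Independence
    is restored by shifting two points with the same move against each other, or by using points
    with distinct partner labels.

    Ties and coinciding centers are handled combinatorially, through a fixed choice among labels
    with equal centers. Events and running time enter only through measurable supersets. *)

Section CoordinateSpace.
Context (R : realType) (I : eqType).

Definition coord_cylinders : set (set (I -> R)) :=
  [set A | exists i (B : set R), measurable B /\ A = [set g | B (g i)]].

(** The product sigma-algebra, put on an alias of the function type so that Tonelli applies to
    functions of all coordinates. *)
Definition coordT := g_sigma_algebraType coord_cylinders.
HB.instance Definition _ := Measurable.on coordT.

Definition upd (g : I -> R) (i : I) (t : R) : I -> R :=
  fun j => if j == i then t else g j.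

Lemma measurable_coord (i : I) : measurable_fun setT (fun g : coordT => g i).
Proof.
move=> _ B mB; rewrite setTI; apply: sub_sigma_algebra.
by exists i, B.
Qed.

Lemma measurable_into_coord d (T : measurableType d) (h : T -> coordT) :
  (forall i, measurable_fun setT (fun x => h x i)) -> measurable_fun setT h.
Proof.
move=> mh; apply: (@measurability _ _ T coordT setT h coord_cylinders) => //.
move=> _ [_ [i [B [mB ->]]] <-].
exact: mh.
Qed.

Lemma measurable_upd (i : I) :
  measurable_fun setT (fun p : coordT * R => upd p.1 i p.2 : coordT).
Proof.
apply: measurable_into_coord => j; rewrite /upd.
case: (j == i); first exact: measurable_snd.
exact: (measurableT_comp (measurable_coord j) measurable_fst).
Qed.

Lemma measurable_upd2 (i j : I) (g : I -> R) :
  measurable_fun setT (fun p : R * R => upd (upd g i p.1) j p.2 : coordT).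
Proof.
apply: measurable_into_coord => k; rewrite /upd.
case: (k == j); first exact: measurable_snd.
case: (k == i); first exact: measurable_fst.
exact: measurable_cst.
Qed.

Lemma measurable_upd1 (i : I) (g : I -> R) :
  measurable_fun setT (fun t : R => upd g i t : coordT).
Proof.
apply: measurable_into_coord => k; rewrite /upd.
case: (k == i); first exact: measurable_id.
exact: measurable_cst.
Qed.

Lemma updC (g : I -> R) (i j : I) (s t : R) :
  i != j -> upd (upd g i s) j t = upd (upd g j t) i s.
Proof.
move=> ij; apply/funext => k; rewrite /upd.
case: (k =P j) => [->|//]; by rewrite eq_sym (negbTE ij).
Qed.

End CoordinateSpace.
Arguments upd {R I} g i t.

(** The integral of a nonnegative function is a supremum over the simple functions below it, so
    monotonicity holds for arbitrary functions. This allows the running time to be bounded directly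
    by a measurable majorant. *)
Lemma le_integral_nonneg d (T : measurableType d) (R : realType)
  (mu : {measure set T -> \bar R}) (f g : T -> \bar R) :
  (forall x, 0 <= f x)%E -> (forall x, f x <= g x)%E ->
  (\int[mu]_x f x <= \int[mu]_x g x)%E.
Proof.
move=> f0 fg; rewrite !ge0_integralTE//; last first.
  by move=> x; apply: le_trans (fg x).
apply: le_ereal_sup => _ [h hf <-]; exists h => //= x.
exact: le_trans (hf x) (fg x).
Qed.

Section GaussIter.
Context (R : realType) (I : eqType) (sigma : R).
Local Open Scope ereal_scope.
Implicit Types (f : (I -> R) -> \bar R) (s : seq I).
Local Notation mu := (normal_prob (0 : R) sigma).

Lemma gauss_iter_ge0 s f g : (forall g, 0 <= f g) -> 0 <= gauss_iter sigma s f g.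
Proof.
by elim: s g => [//|i s IH] g f0 /=; apply: integral_ge0 => t _; exact: IH.
Qed.

Lemma gauss_iter_le s f f' g : (forall g, 0 <= f g) -> (forall g, f g <= f' g) ->
  gauss_iter sigma s f g <= gauss_iter sigma s f' g.
Proof.
move=> f0 ff'; elim: s g => [//|i s IH] g /=.
apply: le_integral_nonneg => t; first exact: gauss_iter_ge0.
exact: IH.
Qed.

Lemma measurable_gauss_iter s f :
  measurable_fun setT (f : coordT R I -> \bar R) -> (forall g, 0 <= f g) ->
  measurable_fun setT (gauss_iter sigma s f : coordT R I -> \bar R).
Proof.
move=> mf f0; elim: s => [//|i s IH] /=.
have := @measurable_fun_fubini_tonelli_F _ _ (coordT R I) _ R mu
  (fun p : coordT R I * R => gauss_iter sigma s f (upd p.1 i p.2)).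
apply.
  exact: (measurableT_comp IH (@measurable_upd R I i)).
by move=> x; exact: gauss_iter_ge0.
Qed.

Lemma gauss_iter_swap i j s f g :
  measurable_fun setT (f : coordT R I -> \bar R) -> (forall g, 0 <= f g) ->
  gauss_iter sigma (i :: j :: s) f g = gauss_iter sigma (j :: i :: s) f g.
Proof.
move=> mf f0; have [->//|ij] := eqVneq i j.
pose F (p : R * R) := gauss_iter sigma s f (upd (upd g i p.1) j p.2).
have mF : measurable_fun setT F.
  apply: (measurableT_comp (measurable_gauss_iter s mf f0)).
  exact: measurable_upd2.
have F0 p : 0 <= F p by exact: gauss_iter_ge0.
have H := @fubini_tonelli _ _ _ _ R mu mu F mF F0.
apply: (@eq_trans _ _ (\int[mu]_x \int[mu]_y F (x, y))); first exact: erefl.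
apply: (eq_trans H); apply: eq_integral => y _; apply: eq_integral => x _.
by rewrite /F updC.
Qed.

Lemma gauss_iter_rot i s s' f g :
  measurable_fun setT (f : coordT R I -> \bar R) -> (forall g, 0 <= f g) ->
  gauss_iter sigma (s ++ i :: s') f g = gauss_iter sigma (i :: s ++ s') f g.
Proof.
move=> mf f0; elim: s g => [//|j s IH] g.
rewrite [RHS](gauss_iter_swap i j (s ++ s') g mf f0).
by apply: eq_integral => t _; exact: IH.
Qed.

(** Tonelli allows any order of integration. It serves to move the coordinate, or the two
    coordinates, to be resampled to the innermost place. *)
Lemma gauss_iter_perm s s' f g :
  measurable_fun setT (f : coordT R I -> \bar R) -> (forall g, 0 <= f g) ->
  perm_eq s s' -> gauss_iter sigma s f g = gauss_iter sigma s' f g.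
Proof.
move=> mf f0; elim: s s' g => [|i s IH] s' g.
  by move=> /perm_size /esym /size0nil ->.
move=> ps.
have is' : i \in s' by rewrite -(perm_mem ps) mem_head.
move: ps; case/splitPr: is' => s1 s2 ps.
rewrite gauss_iter_rot//=; apply: eq_integral => t _; apply: IH.
rewrite -(perm_cons i); apply: perm_trans ps _.
by rewrite -cat1s perm_catCA.
Qed.

Lemma gauss_iter_cat s s' f g :
  gauss_iter sigma (s ++ s') f g = gauss_iter sigma s (gauss_iter sigma s' f) g.
Proof. by elim: s g => [//|i s IH] g /=; apply: eq_integral => t _; exact: IH. Qed.

Lemma gauss_iterD s f f' g :
  measurable_fun setT (f : coordT R I -> \bar R) -> (forall g, 0 <= f g) ->
  measurable_fun setT (f' : coordT R I -> \bar R) -> (forall g, 0 <= f' g) ->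
  gauss_iter sigma s (fun g => f g + f' g) g =
  gauss_iter sigma s f g + gauss_iter sigma s f' g.
Proof.
move=> mf f0 mf' f'0; elim: s g => [//|i s IH] g /=.
under eq_integral do rewrite IH.
rewrite ge0_integralD//.
- by move=> t _; exact: gauss_iter_ge0.
- apply: (measurableT_comp (measurable_gauss_iter s mf f0)).
  exact: measurable_upd1.
- by move=> t _; exact: gauss_iter_ge0.
- apply: (measurableT_comp (measurable_gauss_iter s mf' f'0)).
  exact: measurable_upd1.
Qed.

Lemma gauss_iterZ s (r : R) f g : (0 <= r)%R ->
  measurable_fun setT (f : coordT R I -> \bar R) -> (forall g, 0 <= f g) ->
  gauss_iter sigma s (fun g => r%:E * f g) g = r%:E * gauss_iter sigma s f g.
Proof.
move=> r0 mf f0; elim: s g => [//|i s IH] g /=.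
under eq_integral do rewrite IH.
rewrite ge0_integralZl_EFin//.
- by move=> t _; exact: gauss_iter_ge0.
- apply: (measurableT_comp (measurable_gauss_iter s mf f0)).
  exact: measurable_upd1.
Qed.

Lemma gauss_iter_cst s (r : R) g : gauss_iter sigma s (fun=> r%:E) g = r%:E.
Proof.
elim: s g => [//|i s IH] g /=.
under eq_integral do rewrite IH.
rewrite integral_cst// [X in _ * X](_ : _ = 1) ?mule1//.
exact: (@probability_setT _ _ _ (normal_prob (0 : R) sigma)).
Qed.

End GaussIter.

(** * The normal law through its density *)

Section NormalLaw.
Context (R : realType).
Local Open Scope ereal_scope.
Local Notation leb := (@lebesgue_measure R).

(** Uniqueness of Lebesgue measure: the shifted measure has the right value on half-open
    intervals. *)
Lemma lebesgue_measure_shift (c : R) (A : set R) : measurable A ->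
  pushforward leb (+%R c : _ -> measurableTypeR R) A = leb A.
Proof.
have mc : measurable_fun setT (+%R c : measurableTypeR R -> measurableTypeR R).
  exact: measurable_funD.
move=> mA; apply/esym/lebesgue_measure_unique => //= _ [[a b]] _ <-.
rewrite /pushforward.
have -> : +%R c @^-1` `]a, b]%classic = `](a - c)%R, (b - c)%R]%classic.
  by apply/seteqP; split=> x /=; rewrite !in_itv/= ltrBlDl lerBrDl.
rewrite !lebesgue_measure_itv/= !lte_fin ltrD2r.
by case: ifP => // _; rewrite -!EFinB; congr (_%:E); ring.
Qed.

Lemma integral_lebesgue_shift (c : R) (f : R -> \bar R) :
  measurable_fun setT f -> (forall x, 0 <= f x) ->
  \int[leb]_x f (c + x)%R = \int[leb]_x f x.
Proof.
have mc : measurable_fun setT (+%R c : measurableTypeR R -> measurableTypeR R).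
  exact: measurable_funD.
move=> mf f0.
have H := @ge0_integral_pushforward _ _ _ _ R _ mc leb setT f measurableT mf.
rewrite preimage_setT in H; rewrite -H//.
by apply: eq_measure_integral => //= A mA _; exact: lebesgue_measure_shift.
Qed.

Section Density.
Variables (m s : R).
Local Notation N := (normal_prob m s).
Local Notation pdf := (normal_pdf m s).

Let integral_normal_indic E : measurable E ->
  \int[N]_x (\1_E x)%:E = \int[leb]_x ((\1_E x)%:E * (pdf x)%:E).
Proof.
move=> mE; rewrite integral_indic//= setIT /normal_prob.
rewrite [LHS]integral_mkcond/=; apply: eq_integral => x _.
by rewrite patchE indicE; case: ifPn => _; rewrite ?mul1e ?mul0e.
Qed.

Import HBNNSimple.

Let mpdf : measurable_fun setT (EFin \o pdf).
Proof. by apply/measurable_EFinP; exact: measurable_normal_pdf. Qed.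

Let integral_normal_nnsfun (f : {nnsfun (measurableTypeR R) >-> R}) :
  \int[N]_x (f x)%:E = \int[leb]_x ((f x)%:E * (pdf x)%:E).
Proof.
under [LHS]eq_integral do rewrite fimfunE -fsumEFin//.
rewrite [LHS]ge0_integral_fsum//; last 2 first.
  - by move=> r; exact/measurable_EFinP/measurableT_comp.
  - by move=> n x _; rewrite EFinM nnfun_muleindic_ge0.
under [RHS]eq_integral.
  move=> x xD; rewrite fimfunE -fsumEFin// ge0_mule_fsuml; last first.
    by move=> r; rewrite EFinM nnfun_muleindic_ge0.
  over.
rewrite [RHS]ge0_integral_fsum//; last 2 first.
  - move=> r; apply: emeasurable_funM => //.
    by apply/measurable_EFinP; exact/measurableT_comp.
  - move=> n x _; rewrite EFinM mule_ge0//; first by rewrite nnfun_muleindic_ge0.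
    by rewrite lee_fin normal_pdf_ge0.
apply: eq_fsbigr => r _.
have [r0|r0] := leP 0%R r.
  rewrite integralZl_indic_nnsfun//= integral_normal_indic//.
  under [RHS]eq_integral do rewrite EFinM -muleA.
  rewrite ge0_integralZl//.
  - apply: emeasurable_funM => //; exact/measurable_EFinP/measurable_indic.
  - by move=> x _; rewrite mule_ge0// lee_fin// normal_pdf_ge0.
rewrite preimage_nnfun0// indic0.
by rewrite [LHS]integral0_eq ?[RHS]integral0_eq// => x _; rewrite mulr0 ?mul0e.
Qed.

(** From indicators to simple functions, then by monotone convergence. *)
Lemma integral_normal_prob (f : R -> \bar R) :
  measurable_fun setT f -> (forall x, 0 <= f x) ->
  \int[N]_x f x = \int[leb]_x (f x * (pdf x)%:E).
Proof.
move=> mf f0.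
have mf' : measurable_fun (setT : set (measurableTypeR R)) f := mf.
pose f_ := nnsfun_approx measurableT mf'.
have nf_ a b x : (a <= b)%N -> (f_ a x <= f_ b x)%R.
  by move=> ab; have /lefP := nd_nnsfun_approx measurableT mf' ab; exact.
have cf_ (x : R) : (f_ n x)%:E @[n --> \oo] --> f x.
  by apply: (cvg_nnsfun_approx measurableT mf') => //.
have mf_ n : measurable_fun setT (fun x => (f_ n x)%:E).
  by apply/measurable_EFinP; exact: measurable_funP.
transitivity (lim (\int[N]_x (f_ n x)%:E @[n --> \oo])).
  rewrite -monotone_convergence//=.
  - apply: eq_integral => ? /[!inE] xD; apply/esym/cvg_lim => //=.
  - by move=> n ? _; rewrite lee_fin.
  - by move=> ? _ ? ? mn; rewrite lee_fin nf_.
rewrite [RHS](_ : _ = lim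
    (\int[leb]_x ((f_ n x)%:E * (pdf x)%:E) @[n --> \oo])); last first.
  rewrite -monotone_convergence//=.
  - apply: eq_integral => x /[!inE] xD; apply/esym/cvg_lim => //.
    apply: cvgeZr => //.
  - by move=> n; apply: emeasurable_funM => //; exact: mf_.
  - by move=> n ? _; rewrite mule_ge0// lee_fin// normal_pdf_ge0.
  - move=> ? _ ? ? ?; rewrite lee_wpmul2r ?lee_fin ?normal_pdf_ge0//.
    exact: nf_.
by apply: congr_lim; apply/funext => n /=; exact: integral_normal_nnsfun.
Qed.

End Density.

Lemma normal_prob_le (m s : R) (A B : set R) :
  A `<=` B -> normal_prob m s A <= normal_prob m s B.
Proof.
move=> AB; rewrite /normal_prob [leLHS]integral_mkcond [leRHS]integral_mkcond.
apply: le_integral_nonneg => x.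
  by rewrite patchE; case: ifPn => // _; rewrite lee_fin normal_pdf_ge0.
rewrite !patchE; case: ifPn => [|_].
  by rewrite inE => /AB => Bx; rewrite mem_set.
by case: ifPn => // _; rewrite lee_fin normal_pdf_ge0.
Qed.

(** The peak is 1 / (s sqrt (2 pi)), and 2 pi >= 4. *)
Lemma normal_peak_le (s : R) : (0 < s -> normal_peak s <= (2 * s)^-1)%R.
Proof.
move=> s0.
have p0 : (0 < s ^+ 2 * pi *+ 2)%R.
  by rewrite pmulrn_lgt0// mulr_gt0 ?pi_gt0// exprn_gt0.
have e2s : (Num.sqrt ((2 * s) ^+ 2) = 2 * s)%R.
  by rewrite sqrtr_sqr ger0_norm// mulr_ge0 ?ltW.
rewrite /normal_peak lef_pV2 ?posrE ?sqrtr_gt0// ?mulr_gt0//.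
rewrite -e2s ler_wsqrtr// exprMn -mulr_natl.
by have := pi_ge2 R; have := exprn_gt0 2 s0; nra.
Qed.

Lemma normal_prob_itv (s a b : R) (A : set R) : (0 < s)%R -> (a <= b)%R ->
  A `<=` `[a, b]%classic ->
  normal_prob 0 s A <= ((b - a) / (2 * s))%:E.
Proof.
move=> s0 ab /(normal_prob_le 0 s) /le_trans; apply.
rewrite /normal_prob.
apply: (@le_trans _ _ (\int[leb]_(x in `[a, b]) ((2 * s)^-1)%:E)).
  apply: ge0_le_integral => //=.
  - by move=> x _; rewrite lee_fin normal_pdf_ge0.
  - by apply/measurable_EFinP/measurable_funTS; exact: measurable_normal_pdf.
  - move=> x _; rewrite lee_fin.
    by rewrite (le_trans (normal_pdf_ub _ _ _))// ?gt_eqF// normal_peak_le.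
rewrite integral_cst// [X in _ * X](_ : _ = lebesgue_measure `[a, b]%classic)// lebesgue_measure_itv/= lte_fin.
rewrite lt_neqAle ab andbT; case: eqVneq => [->|_] /=.
  by rewrite mule0 subrr mul0r.
by rewrite -EFinB -EFinM mulrC.
Qed.

End NormalLaw.

(** * Conditioning on all but one coordinate, or on the sum of two *)

Section GaussProb.
Context (R : realType) (I : finType) (sigma : R).
Hypothesis sigma0 : 0 < sigma.
Local Open Scope ereal_scope.
Local Notation leb := (@lebesgue_measure R).
Local Notation pdf := (normal_pdf (0 : R) sigma).
Local Notation N := (normal_prob (0 : R) sigma).
Implicit Types (A B E F : set (coordT R I)) (f : coordT R I -> \bar R).

Definition gprob (A : set (coordT R I)) : \bar R :=
  gauss_expect sigma (fun g => (\1_A g)%:E).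

Lemma measurable_indicE A : measurable A ->
  measurable_fun setT (fun g : coordT R I => (\1_A g)%:E : \bar R).
Proof. by move=> mA; apply/measurable_EFinP; exact: measurable_indic. Qed.

Lemma indicE_ge0 A g : 0 <= (\1_A g)%:E :> \bar R.
Proof. by rewrite lee_fin. Qed.
Hint Resolve indicE_ge0 : core.

Lemma gprob_le1 A : gprob A <= 1.
Proof.
rewrite -(gauss_iter_cst sigma (enum I) 1 (fun=> 0%R)).
by apply: gauss_iter_le => // g; rewrite lee_fin indicE lern1 leq_b1.
Qed.

Lemma gprobU A B : measurable A -> measurable B ->
  gprob (A `|` B) <= gprob A + gprob B.
Proof.
move=> mA mB; rewrite /gprob /gauss_expect -gauss_iterD//; try exact: measurable_indicE.
apply: gauss_iter_le => // g; rewrite -EFinD lee_fin !indicE -natrD ler_nat in_setU.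
by case: (g \in A); case: (g \in B).
Qed.

Lemma gprob_set0 : gprob set0 = 0.
Proof.
rewrite -[RHS](gauss_iter_cst sigma (enum I) 0 (fun=> 0%R)).
by rewrite /gprob; congr (gauss_expect _ _); apply/funext => g; rewrite indicE in_set0.
Qed.

(** Conditioning on all coordinates except [i]: with [i] innermost, [F] is constant along the line
    and [E] contributes at most [p]. In applications [F] is the intersection of the remaining
    events, so iteration yields a product. *)
Lemma gprob_line i (p : R) E F : (0 <= p)%R -> measurable E -> measurable F ->
  (forall g, N [set t | E (upd g i t)] <= p%:E) ->
  (forall g t, F (upd g i t) <-> F g) ->
  gprob (E `&` F) <= p%:E * gprob F.
Proof.
move=> p0 mE mF Ep Fi.
have pe : perm_eq (enum I) (rem i (enum I) ++ [:: i]).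
  by rewrite perm_sym cats1 perm_rcons perm_sym perm_to_rem// mem_enum.
have mEF : measurable (E `&` F) by exact: measurableI.
rewrite /gprob /gauss_expect.
rewrite !(@gauss_iter_perm _ _ _ _ _ _ _ _ _ pe)//; try exact: measurable_indicE.
rewrite !gauss_iter_cat -gauss_iterZ//; last 2 first.
- exact: (@measurable_gauss_iter _ _ _ [:: i] _ (measurable_indicE mF)).
- by move=> g; exact: gauss_iter_ge0.
apply: gauss_iter_le => g; first exact: gauss_iter_ge0.
have FE t : (\1_F (upd g i t) = \1_F g :> R)%R.
  rewrite !indicE; congr ((nat_of_bool _)%:R).
  by apply/idP/idP => /set_mem/Fi/mem_set.
rewrite [leRHS](_ : _ = p%:E * (\1_F g)%:E); last first.
  congr (_ * _); rewrite /=.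
  under eq_integral do rewrite -/(upd g i _) FE.
  rewrite integral_cst// [X in _ * X](_ : _ = 1) ?mule1//.
  exact: (@probability_setT _ _ _ N).
rewrite /=; under eq_integral do rewrite -/(upd g i _).
have [Fg|Fg] := boolP (g \in F); last first.
  rewrite [X in _ <= _ * X](_ : _ = 0) ?mule0; last by rewrite indicE (negbTE Fg).
  rewrite integral0_eq// => t _; rewrite indicE in_setI.
  have := FE t; rewrite !indicE (negbTE Fg).
  by case: (_ \in F) => [/eqP|]; rewrite ?oner_eq0// andbF.
rewrite [X in _ <= _ * X](_ : _ = 1) ?mule1; last by rewrite indicE Fg.
apply: le_trans (Ep g).
rewrite -[leRHS]mul1e -integral_cst.
  rewrite [leRHS]integral_mkcond; apply: le_integral_nonneg => t//.
  rewrite patchE; case: ifPn; rewrite indicE in_setI.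
    by move=> _; rewrite lee_fin lern1 leq_b1.
  rewrite notin_setE /= => nE; rewrite (_ : _ \in E = false)//.
  by apply/negP => /set_mem.
have := measurable_upd1 i g measurableT mE; rewrite setTI.
exact.
Qed.

(** The joint density of one Gaussian [t] and of its sum [u] with a second, independent one. *)
Let P2 (t u : R) : \bar R := (pdf (u - t))%:E * (pdf t)%:E.

Let P2_ge0 t u : 0 <= P2 t u.
Proof. by rewrite mule_ge0// lee_fin normal_pdf_ge0. Qed.

Let sumupd i j g (t u : R) : coordT R I := upd (upd g i t) j (u - t)%R.

Let measurable_sumupd i j g : measurable_fun setT
  (fun p : measurableTypeR R * measurableTypeR R => sumupd i j g p.1 p.2).
Proof.
apply: measurable_into_coord => k; rewrite /sumupd /upd.
case: (k == j); first exact: measurable_funB.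
by case: (k == i); [exact: measurable_fst|exact: measurable_cst].
Qed.

Let measurable_P2 : measurable_fun setT
  (fun p : measurableTypeR R * measurableTypeR R => P2 p.1 p.2).
Proof.
apply: emeasurable_funM; apply/measurable_EFinP.
- apply: (measurableT_comp (@measurable_normal_pdf R 0 sigma)).
  exact: measurable_funB.
- exact: (measurableT_comp (@measurable_normal_pdf R 0 sigma)).
Qed.

(** The substitution v = u - t in the inner integral, followed by Tonelli, makes the sum the outer
    variable. *)
Let gauss_iter2 i j f g : measurable_fun setT f -> (forall g, 0 <= f g) ->
  gauss_iter sigma [:: i; j] f g =
  \int[leb]_u \int[leb]_t (f (sumupd i j g t u) * P2 t u).
Proof.
move=> mf f0.
have mF : measurable_fun setT (fun p : measurableTypeR R * measurableTypeR R =>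
    f (sumupd i j g p.1 p.2) * P2 p.1 p.2).
  apply: emeasurable_funM => //.
  exact: (measurableT_comp mf (measurable_sumupd i j g)).
have mF1 : measurable_fun setT (fun p : measurableTypeR R * measurableTypeR R =>
    f (sumupd i j g p.1 p.2) * (pdf (p.2 - p.1))%:E).
  apply: emeasurable_funM; first exact: (measurableT_comp mf (measurable_sumupd i j g)).
  apply/measurable_EFinP; apply: (measurableT_comp (@measurable_normal_pdf R 0 sigma)).
  exact: measurable_funB.
have mF1t (t : R) : measurable_fun setT (fun u => f (sumupd i j g t u) * (pdf (u - t))%:E).
  apply: (measurableT_comp mF1 (g := fun u : measurableTypeR R => (t : measurableTypeR R, u))).
  exact: measurable_fun_pair.
have ge1 t u : 0 <= f (sumupd i j g t u) * (pdf (u - t))%:E.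
  by rewrite mule_ge0// lee_fin normal_pdf_ge0.
have step1 t : \int[N]_v f (upd (upd g i t) j v) =
    \int[leb]_u (f (sumupd i j g t u) * (pdf (u - t))%:E).
  have m1 : measurable_fun setT (fun v => f (upd (upd g i t) j v)).
    exact: (measurableT_comp mf (measurable_upd1 j (upd g i t))).
  apply: etrans (@integral_normal_prob R 0 sigma _ m1 (fun v => f0 _)) _.
  apply: etrans _ (@integral_lebesgue_shift R t _ (mF1t t) (ge1 t)).
  by apply: eq_integral => v _; rewrite /sumupd addrAC subrr add0r.
transitivity (\int[N]_t \int[leb]_u (f (sumupd i j g t u) * (pdf (u - t))%:E)).
  by rewrite /=; apply: eq_integral => t _; exact: step1.
have m2 := @measurable_fun_fubini_tonelli_F _ _ _ _ R leb _ mF1.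
apply: etrans (@integral_normal_prob R 0 sigma _ (m2 (fun p => ge1 p.1 p.2)) _) _.
  by move=> t; apply: integral_ge0 => u _; exact: ge1.
rewrite -(@fubini_tonelli _ _ _ _ R leb leb _ mF)/=; last by move=> ?; exact: mule_ge0.
apply: eq_integral => t _.
rewrite -ge0_integralZr//.
- by apply: eq_integral => u _; rewrite /P2 muleA.
- exact: (mF1t t).
- by rewrite lee_fin normal_pdf_ge0.
Qed.

Let tau := (sigma / Num.sqrt 2)%R.
Let tau0 : (0 < tau)%R. Proof. by rewrite divr_gt0// sqrtr_gt0. Qed.
Let tau2 : (tau ^+ 2 = sigma ^+ 2 / 2)%R.
Proof. by rewrite exprMn exprVn sqr_sqrtr. Qed.

(** The density of the sum, which is Gaussian of variance 2 sigma^2. Given the sum [u], the first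
    summand is normal with mean u / 2 and deviation [tau]; this factorization is [P2E]. *)
Let K (u : R) : R := (normal_peak sigma ^+ 2 / normal_peak tau *
  expR (- (u ^+ 2 / (4 * sigma ^+ 2))))%R.

Let K_ge0 u : (0 <= K u)%R.
Proof. by rewrite mulr_ge0// ?expR_ge0// divr_ge0 ?sqr_ge0 ?normal_peak_ge0. Qed.

Let P2E t u : P2 t u = (K u)%:E * (normal_pdf (u / 2) tau t)%:E.
Proof.
rewrite /P2 -!EFinM !normal_pdfE ?gt_eqF//; congr (_%:E); rewrite /K /normal_fun.
have pt : normal_peak tau != 0%R by rewrite gt_eqF// normal_peak_gt0// gt_eqF.
rewrite mulrACA -expRD mulrACA -expRD.
rewrite -expr2 divfK//; congr (_ * expR _)%R.
rewrite -(mulr_natr (tau ^+ 2)) tau2 -(mulr_natr (sigma ^+ 2)).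
by field; rewrite gt_eqF.
Qed.

Let peak_tau : (normal_peak tau <= sigma^-1)%R.
Proof.
rewrite /normal_peak tau2 lef_pV2 ?posrE ?sqrtr_gt0//.
  have es : (Num.sqrt (sigma ^+ 2) = sigma)%R by rewrite sqrtr_sqr ger0_norm// ltW.
  rewrite -[leLHS]es ler_wsqrtr// -mulr_natl.
  by have := pi_ge2 R; have := exprn_gt0 2 sigma0; nra.
by rewrite pmulrn_lgt0// mulr_gt0 ?pi_gt0// divr_gt0 ?exprn_gt0.
Qed.

(** Conditioning on the other coordinates and on the sum of coordinates [i] and [j]: the conditional
    density is at most 1 / sigma, [F] is constant along the antidiagonal, and [E] confines [t] to an
    interval of length at most [w]. *)
Lemma gprob_diag i j (w : R) E F : i != j -> (0 <= w)%R ->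
  measurable E -> measurable F ->
  (forall g u, exists a b, [/\ (a <= b)%R, (b - a <= w)%R & forall t,
     E (upd (upd g i t) j (u - t)%R) -> (a <= t <= b)%R]) ->
  (forall g u t t', F (upd (upd g i t) j (u - t)%R) ->
     F (upd (upd g i t') j (u - t')%R)) ->
  gprob (E `&` F) <= (w / sigma)%:E * gprob F.
Proof.
move=> ij w0 mE mF Ew Fi.
have pe : perm_eq (enum I) (rem j (rem i (enum I)) ++ [:: i; j]).
  have jr : j \in rem i (enum I).
    by rewrite mem_rem_uniq ?enum_uniq// !inE eq_sym ij mem_enum.
  have ie : i \in enum I by rewrite mem_enum.
  apply: perm_trans (perm_to_rem ie) _.
  rewrite perm_sym perm_catC /= perm_cons perm_sym.
  exact: perm_to_rem.
have mEF : measurable (E `&` F) by exact: measurableI.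
rewrite /gprob /gauss_expect.
rewrite !(@gauss_iter_perm _ _ _ _ _ _ _ _ _ pe)//; try exact: measurable_indicE.
have ws0 : (0 <= w / sigma)%R by rewrite divr_ge0// ltW.
rewrite !gauss_iter_cat -gauss_iterZ//; last 2 first.
- exact: (@measurable_gauss_iter _ _ _ [:: i; j] _ (measurable_indicE mF)).
- by move=> g; exact: gauss_iter_ge0.
apply: gauss_iter_le => g; first exact: gauss_iter_ge0.
rewrite !gauss_iter2//; try exact: measurable_indicE.
rewrite -ge0_integralZl//=; last 2 first.
- apply: (@measurable_fun_fubini_tonelli_G _ _ _ _ R leb (fun p =>
    (\1_F (sumupd i j g p.1 p.2))%:E * P2 p.1 p.2)).
    apply: emeasurable_funM => //.
    exact: (measurableT_comp (measurable_indicE mF) (measurable_sumupd i j g)).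
  by move=> p; rewrite mule_ge0.
- by move=> u _; apply: integral_ge0 => t _; rewrite mule_ge0.
apply: le_integral_nonneg => u; first by apply: integral_ge0 => t _; rewrite mule_ge0.
have [Fu|Fu] := pselect (F (sumupd i j g 0 u)); last first.
  rewrite integral0_eq ?mule_ge0//.
    by apply: integral_ge0 => t _; rewrite mule_ge0.
  move=> t _; rewrite indicE memNset ?mul0e// => -[_ Ft].
  by apply: Fu; exact: Fi Ft.
have FE t : (\1_F (sumupd i j g t u))%:E = 1 :> \bar R.
  by rewrite indicE mem_set//; exact: Fi Fu.
under [X in _ <= _ * X]eq_integral do rewrite FE mul1e P2E.
rewrite ge0_integralZl//=; last 3 first.
- by apply/measurable_EFinP; exact: measurable_normal_pdf.
- by move=> t _; rewrite lee_fin normal_pdf_ge0.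
- by rewrite lee_fin.
rewrite integral_normal_pdf mule1.
have [a [b [ab bw Eab]]] := Ew g u.
apply: (@le_trans _ _ (\int[leb]_(t in `[a, b]) ((K u * sigma^-1)%:E))).
  rewrite [leRHS]integral_mkcond; apply: le_integral_nonneg => t.
    by rewrite mule_ge0.
  rewrite patchE; case: ifPn.
    move=> _; rewrite P2E indicE -!EFinM lee_fin.
    case: (_ \in _); last by rewrite mul0r mulr_ge0// invr_ge0 ltW.
    rewrite mul1r ler_wpM2l//.
    by rewrite (le_trans (normal_pdf_ub _ _ _))// gt_eqF.
  rewrite notin_setE/= in_itv/= => nab.
  by rewrite indicE memNset ?mul0e// => -[/Eab].
rewrite integral_cst// [X in _ * X](_ : _ = lebesgue_measure `[a, b]%classic)//.
rewrite lebesgue_measure_itv/= lte_fin.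
have Kw : (0 <= K u * sigma^-1)%R by rewrite mulr_ge0// invr_ge0 ltW.
case: ifPn => [_|_]; last by rewrite mule0 -EFinM lee_fin mulr_ge0.
rewrite -EFinB -!EFinM lee_fin mulrC mulrA.
rewrite (_ : w / sigma * K u = w * (K u * sigma^-1))%R; last by ring.
by rewrite -mulrA ler_wpM2r.
Qed.

End GaussProb.

Section NormalSections.
Context (R : realType) (sigma : R).
Hypothesis sigma0 : 0 < sigma.
Local Notation N := (normal_prob (0 : R) sigma).

Lemma normal_prob_slab (a b w : R) : a != 0 -> 0 <= w ->
  (N [set t | (`|a * t + b| <= w)%R] <= (w / (sigma * `|a|))%:E)%E.
Proof.
move=> a0 w0; have na0 : 0 < `|a| by rewrite normr_gt0.
apply: le_trans (@normal_prob_itv R sigma (- b / a - w / `|a|) (- b / a + w / `|a|) _ sigma0 _ _) _.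
- by rewrite lerD2l (@le_trans _ _ 0)// ?oppr_le0 divr_ge0// ltW.
- move=> t /= H; rewrite in_itv/= -ler_distl.
  rewrite -(ler_pM2l na0) -normrM mulrCA divff ?gt_eqF// mulr1.
  by rewrite (_ : a * _ = a * t + b)//; field.
- rewrite lee_fin [leLHS](_ : _ = w / (sigma * `|a|))//; field.
  by rewrite a0 !gt_eqF.
Qed.

(** Completing the square leaves two intervals symmetric about - b / (2 a), each of length at most
    sqrt (2 w / |a|) whatever [b] and [c] are. Both are bounded by length / (2 sigma). *)
Lemma normal_prob_quad (a b c w : R) : a != 0 -> 0 <= w ->
  (N [set t | (`|a * t ^+ 2 + b * t + c| <= w)%R]
   <= (Num.sqrt (2 * w / `|a|) / sigma)%:E)%E.
Proof.
move=> a0 w0; have na0 : 0 < `|a| by rewrite normr_gt0.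
pose v := w / `|a|; pose e := b / (2 * a); pose u := e ^+ 2 - c / a.
have v0 : 0 <= v by rewrite divr_ge0// ltW.
pose hi := Num.sqrt (u + v); pose lo := Num.sqrt (u - v).
have lohi : lo <= hi by rewrite ler_wsqrtr// lerD2l (le_trans _ v0)// oppr_le0.
have lo0 : 0 <= lo by exact: sqrtr_ge0.
have hi0 : 0 <= hi by exact: sqrtr_ge0.
have sub : [set t | `|a * t ^+ 2 + b * t + c| <= w] `<=`
  `[- e + lo, - e + hi]%classic `|` `[- e - hi, - e - lo]%classic.
  move=> t /= H.
  have : `|(t + e) ^+ 2 - u| <= v.
    rewrite -(ler_pM2l na0) -normrM [leRHS]mulrCA divff ?gt_eqF// mulr1.
    by rewrite (_ : a * _ = a * t ^+ 2 + b * t + c)// /u /e; field.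
  rewrite ler_distl => /andP[H1 H2].
  have h1 : lo <= `|t + e| by rewrite -sqrtr_sqr ler_wsqrtr.
  have h2 : `|t + e| <= hi by rewrite -sqrtr_sqr ler_wsqrtr.
  have [te|te] := leP 0 (t + e).
    left; rewrite /= in_itv/=; move: h1 h2; rewrite ger0_norm// => *; apply/andP; split; lra.
  right; rewrite /= in_itv/=; move: h1 h2; rewrite ltr0_norm// => *; apply/andP; split; lra.
have d1 : hi - lo <= Num.sqrt (2 * w / `|a|).
  rewrite -[leLHS]ger0_norm ?subr_ge0// -sqrtr_sqr ler_wsqrtr//.
  (* [Num.sqrt] vanishes on negative numbers, so [u - v] and [u + v] are split by sign and only an
     inequality remains. *)
  have uv : hi ^+ 2 <= lo ^+ 2 + 2 * v.
    have [uv|uv] := leP 0 (u - v).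
      rewrite !sqr_sqrtr//; [lra|]; lra.
    rewrite /lo (ler0_sqrtr (ltW uv)) expr0n/= add0r.
    have [uv'|uv'] := leP 0 (u + v); first by rewrite sqr_sqrtr//; lra.
    by rewrite /hi (ler0_sqrtr (ltW uv')) expr0n/=; lra.
  rewrite -mulrA -/v.
  have -> : (hi - lo) ^+ 2 = hi ^+ 2 - lo ^+ 2 - 2 * lo * (hi - lo) by ring.
  have : 0 <= 2 * lo * (hi - lo) by rewrite !mulr_ge0// subr_ge0.
  lra.
apply: le_trans (normal_prob_le 0 sigma sub) _.
have mi (x y : R) : measurable `[x, y]%classic by exact: measurable_itv.
apply: le_trans (@measureU2 _ _ _ N _ _ (mi _ _) (mi _ _)) _.
apply: le_trans (leeD (@normal_prob_itv R sigma (- e + lo) (- e + hi) _ sigma0 _ _)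
   (@normal_prob_itv R sigma (- e - hi) (- e - lo) _ sigma0 _ _)) _ => //.
- by rewrite lerD2l.
- by rewrite lerD2l lerN2.
rewrite -EFinD lee_fin.
rewrite (_ : _ + _ = (hi - lo) / sigma); last by field; rewrite gt_eqF.
by rewrite ler_wpM2r// invr_ge0 ltW.
Qed.

(** Where a sigma < |t|, the density is at most sqrt 2 exp (- a^2 / 4) times the density of variance
    2 sigma^2, and the latter integrates to one. *)
Lemma normal_prob_tail (a : R) : 0 <= a ->
  (N [set t | (a * sigma < `|t|)%R] <= (2 * expR (- (a ^+ 2 / 4)))%:E)%E.
Proof.
move=> a0; pose s2 := Num.sqrt 2 * sigma.
have s20 : 0 < s2 by rewrite mulr_gt0// sqrtr_gt0.
have s2E : s2 ^+ 2 = 2 * sigma ^+ 2 by rewrite exprMn sqr_sqrtr.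
have mP : measurable_fun setT (EFin \o normal_pdf 0 s2).
  by apply/measurable_EFinP; exact: measurable_normal_pdf.
rewrite -[leRHS]mule1 -(integral_normal_pdf 0 s2).
rewrite -ge0_integralZl//; last by move=> t _; rewrite lee_fin normal_pdf_ge0.
rewrite /normal_prob [leLHS]integral_mkcond; apply: le_integral_nonneg => t.
  by rewrite patchE; case: ifPn => // _; rewrite lee_fin normal_pdf_ge0.
rewrite patchE; case: ifPn => [|_]; last first.
  by rewrite -EFinM lee_fin !mulr_ge0// ?expR_ge0// normal_pdf_ge0.
rewrite inE/= => Ht; rewrite -EFinM lee_fin !normal_pdfE ?gt_eqF//.
have -> : normal_peak sigma = Num.sqrt 2 * normal_peak s2.
  rewrite /normal_peak s2E (_ : 2 * sigma ^+ 2 * pi *+ 2 = 2 * (sigma ^+ 2 * pi *+ 2)).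
    by rewrite sqrtrM// invfM mulrA divff ?mul1r// gt_eqF// sqrtr_gt0.
  by rewrite !mulr2n; ring.
have np := normal_peak_ge0 s2.
rewrite (_ : 2 * _ * _ = 2 * normal_peak s2 * (expR (- (a ^+ 2 / 4)) * normal_fun 0 s2 t)); last by ring.
apply: ler_pM => //.
- by rewrite mulr_ge0// sqrtr_ge0.
- by rewrite expR_ge0.
- rewrite ler_wpM2r//.
  have : Num.sqrt 2 <= Num.sqrt (2 ^+ 2) :> R by rewrite ler_wsqrtr//; lra.
  by rewrite sqrtr_sqr ger0_norm.
- rewrite /normal_fun -expRD ler_expR !subr0 s2E !mulr2n.
  have ht : a ^+ 2 * sigma ^+ 2 <= t ^+ 2.
    by rewrite -exprMn -(real_normK (num_real t)) ler_pXn2r ?nnegrE ?mulr_ge0// ltW.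
  have s2p := exprn_gt0 2 sigma0.
  rewrite !mulNr -opprD lerN2 -subr_ge0.
  rewrite (_ : _ - _ = (t ^+ 2 - a ^+ 2 * sigma ^+ 2) / (4 * sigma ^+ 2)).
    by rewrite divr_ge0 ?subr_ge0// mulr_ge0// ltW.
  by field; apply/and3P; split; rewrite gt_eqF//; lra.
Qed.

End NormalSections.

(** * Outer bounds, unions and chains of independent events *)

Section Covers.
Context (R : realType) (I : finType) (sigma : R).
Hypothesis sigma0 : 0 < sigma.
Implicit Types (A B E F : set (coordT R I)).

(* An outer-measure bound: the bad events are not obviously measurable. *)
Definition pcover (S : set (I -> R)) (p : R) :=
  exists U : set (coordT R I), [/\ measurable U, S `<=` U & (gprob sigma U <= p%:E)%E].

Lemma pcover_sub S S' p : S `<=` S' -> pcover S' p -> pcover S p.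
Proof. by move=> SS' [U [mU SU pU]]; exists U; split => //; exact: subset_trans SU. Qed.

Lemma pcover_le S p p' : p <= p' -> pcover S p -> pcover S p'.
Proof.
by move=> pp' [U [mU SU pU]]; exists U; split => //; rewrite (le_trans pU)// lee_fin.
Qed.

Lemma pcover_gprob A p : measurable A -> (gprob sigma A <= p%:E)%E -> pcover A p.
Proof. by move=> mA pA; exists A; split. Qed.

Lemma pcover0 p : 0 <= p -> pcover set0 p.
Proof.
move=> p0; exists set0; split => //; rewrite gprob_set0 lee_fin//.
Qed.

Lemma pcover1 S p : 1 <= p -> pcover S p.
Proof.
move=> p1; exists setT; split => //.
by rewrite (le_trans (gprob_le1 _ _))// lee_fin.
Qed.

Lemma pcoverU S S' p p' : pcover S p -> pcover S' p' -> pcover (S `|` S') (p + p').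
Proof.
move=> [U [mU SU pU]] [U' [mU' SU' pU']]; exists (U `|` U'); split.
- exact: measurableU.
- exact: setUSS.
- by rewrite (le_trans (gprobU _ _ _))// EFinD leeD.
Qed.

Lemma pcover_bigU (J : finType) (S : J -> set (I -> R)) p : 0 <= p ->
  (forall j, pcover (S j) p) ->
  pcover [set g | exists j, S j g] (#|J|%:R * p).
Proof.
move=> p0 Sp.
suff H (s : seq J) : pcover [set g | exists2 j, j \in s & S j g] ((size s)%:R * p).
  rewrite cardE; apply: pcover_sub (H (enum J)) => g [j Sj].
  by exists j => //; rewrite mem_enum.
elim: s => [|j s IH].
  by apply: pcover_sub (pcover0 _); [move=> g [] | rewrite mul0r].
apply: (@pcover_sub _ (S j `|` [set g | exists2 j, j \in s & S j g])).
  move=> g [i]; rewrite inE => /predU1P[->|is_ Si]; first by left.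
  by right; exists i.
by rewrite /= -add1n natrD mulrDl mul1r; exact: pcoverU.
Qed.

(** Peels off one event at a time. [inv l F] stands for the invariance of [F] under the resampling
    used for [l]; it is kept abstract so that the same induction serves lines and antidiagonals. *)
Lemma gprob_chain (L : eqType) (s : seq L) (E : L -> set (coordT R I))
    (inv : L -> set (coordT R I) -> Prop) (p : R) : 0 <= p -> uniq s ->
  (forall l, l \in s -> measurable (E l)) ->
  (forall l F, l \in s -> measurable F -> inv l F ->
     (gprob sigma (E l `&` F) <= p%:E * gprob sigma F)%E) ->
  (forall l (F : L -> set (coordT R I)) (s' : seq L), (forall l', l' \in s' -> inv l (F l')) ->
     inv l [set g | forall l', l' \in s' -> F l' g]) ->
  {in s &, forall l l', l != l' -> inv l (E l')} ->
  (gprob sigma [set g | forall l, l \in s -> E l g] <= (p ^+ size s)%:E)%E.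
Proof.
move=> p0; elim: s => [|l s IH]; first by move=> *; rewrite expr0 gprob_le1.
rewrite cons_uniq => /andP[ls us] mE red invI invE.
pose F := [set g : coordT R I | forall l', l' \in s -> E l' g].
have mF (s' : seq L) : {subset s' <= s} ->
    measurable [set g : coordT R I | forall l', l' \in s' -> E l' g].
  elim: s' => [|a s' IHs] ss.
    by rewrite [X in measurable X](_ : _ = setT)//; apply/seteqP; split.
  rewrite [X in measurable X](_ : _ =
      E a `&` [set g | forall l', l' \in s' -> E l' g]).
    apply: measurableI.
      by apply: mE; rewrite inE ss ?orbT// mem_head.
    by apply: IHs => x xs; apply: ss; rewrite inE xs orbT.
  apply/seteqP; split => g /=.
    by move=> H; split; [apply: H; rewrite mem_head|move=> x xs; apply: H; rewrite inE xs orbT].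
  by move=> [Ea H] x; rewrite inE => /predU1P[->//|]; exact: H.
have -> : [set g | forall l', l' \in l :: s -> E l' g] = E l `&` F.
  apply/seteqP; split => g /=.
    by move=> H; split; [apply: H; rewrite mem_head|move=> x xs; apply: H; rewrite inE xs orbT].
  by move=> [Ea H] x; rewrite inE => /predU1P[->//|]; exact: H.
apply: le_trans (red l F _ _ _) _.
- exact: mem_head.
- exact: mF.
- apply: invI => l' l's; apply: invE; rewrite ?mem_head ?inE ?l's ?orbT//.
  by apply: contraNneq ls => ->.
rewrite exprS EFinM; apply: lee_wpmul2l; first by rewrite lee_fin.
apply: IH => //.
- by move=> x xs; apply: mE; rewrite inE xs orbT.
- by move=> x F' xs; apply: red; rewrite inE xs orbT.
- by move=> x y xs ys; apply: invE; rewrite inE ?xs ?ys orbT.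
Qed.

Lemma gprob_chain_line (L : eqType) (s : seq L) (v : L -> I)
    (E : L -> set (coordT R I)) (p : R) : 0 <= p -> uniq s ->
  (forall l, l \in s -> measurable (E l)) ->
  (forall l g, l \in s ->
     (normal_prob 0 sigma [set t | E l (upd g (v l) t)] <= p%:E)%E) ->
  {in s &, forall l l', l != l' -> forall g t, E l' (upd g (v l) t) <-> E l' g} ->
  (gprob sigma [set g | forall l, l \in s -> E l g] <= (p ^+ size s)%:E)%E.
Proof.
move=> p0 us mE Ep Einv.
apply: (@gprob_chain _ _ _ (fun l F => forall g t, F (upd g (v l) t) <-> F g)) => //.
- by move=> l F ls mF Fi; apply: gprob_line => //; [exact: mE|move=> g; exact: Ep].
- move=> l F s' H g t; split=> H' l' l's; have := H' l' l's; by move/(H l' l's).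
Qed.

Lemma gprob_chain_diag (L : eqType) (s : seq L) (v v' : L -> I)
    (E : L -> set (coordT R I)) (w : R) : 0 <= w -> uniq s ->
  (forall l, l \in s -> measurable (E l)) ->
  (forall l, l \in s -> v l != v' l) ->
  (forall l g u, l \in s -> exists a b, [/\ a <= b, b - a <= w & forall t,
     E l (upd (upd g (v l) t) (v' l) (u - t)) -> a <= t <= b]) ->
  {in s &, forall l l', l != l' -> forall g u t t',
     E l' (upd (upd g (v l) t) (v' l) (u - t)) ->
     E l' (upd (upd g (v l) t') (v' l) (u - t'))} ->
  (gprob sigma [set g | forall l, l \in s -> E l g] <= ((w / sigma) ^+ size s)%:E)%E.
Proof.
move=> w0 us mE vv' Ep Einv.
apply: (@gprob_chain _ _ _ (fun l F => forall g u t t',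
     F (upd (upd g (v l) t) (v' l) (u - t)) ->
     F (upd (upd g (v l) t') (v' l) (u - t')))) => //.
- by rewrite divr_ge0// ltW.
- move=> l F ls mF Fi; apply: (gprob_diag sigma0 (vv' l ls)) => //; first exact: mE.
  by move=> g u; exact: Ep.
- by move=> l F s' H g u t t' H' l' l's; apply: H (H' l' l's).
Qed.

(** A number m <= 2^M is at most 1 plus the sum of all 2^l < m with l < M. Hence [f] lies below a
    combination of indicators of the covers, which is measurable and can be integrated term by
    term. *)
Lemma gauss_expect_dyadic (f : (I -> R) -> \bar R) (m : (I -> R) -> nat)
    (M : nat) (p : nat -> R) :
  (forall g, 0 <= f g)%E -> (forall g, f g <= (m g)%:R%:E)%E ->
  (forall g, (m g <= 2 ^ M)%N) ->
  (forall l, (l < M)%N -> pcover [set g | (2 ^ l < m g)%N] (p l)) ->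
  (gauss_expect sigma f <= (1 + \sum_(l < M) 2 ^+ l * p l)%:E)%E.
Proof.
move=> f0 fm mM cov.
have /choice[U HU] : forall l : 'I_M, exists U : set (coordT R I),
  [/\ measurable U, [set g | (2 ^ l < m g)%N] `<=` U & (gprob sigma U <= (p l)%:E)%E].
  by move=> l; exact: cov.
have mU (l : 'I_M) : measurable (U l) by have [] := HU l.
pose h (r : seq 'I_M) g : \bar R := (1 + \sum_(l <- r) (2 ^+ l)%:E * (\1_(U l) g)%:E)%E.
have hE : forall r : seq 'I_M, [/\ measurable_fun setT (h r : coordT R I -> \bar R),
    (forall g, 0 <= h r g)%E &
    gauss_expect sigma (h r) = (1 + \sum_(l <- r) (2 ^+ l)%:E * gprob sigma (U l))%E].
  have t0 (l : 'I_M) g : (0 <= (2 ^+ l)%:E * (\1_(U l) g)%:E :> \bar R)%E.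
    by rewrite -EFinM lee_fin mulr_ge0// exprn_ge0.
  have tm (l : 'I_M) : measurable_fun setT
      (fun g : coordT R I => (2 ^+ l)%:E * (\1_(U l) g)%:E : \bar R)%E.
    apply: emeasurable_funM; first exact: measurable_cst.
    by apply: measurable_indicE; exact: mU.
  elim=> [|l r [IHm IH0 IHe]].
    have -> : h [::] = fun=> 1%E by apply/funext => g; rewrite /h big_nil adde0.
    by split => //; rewrite /gauss_expect gauss_iter_cst big_nil adde0.
  have E1 : h (l :: r) = fun g => ((2 ^+ l)%:E * (\1_(U l) g)%:E + h r g)%E.
    by apply/funext => g; rewrite /h big_cons addeCA.
  rewrite E1; split.
  - exact: emeasurable_funD.
  - by move=> g; rewrite adde_ge0.
  - have eZ : gauss_expect sigma (fun g => (2 ^+ l)%:E * (\1_(U l) g)%:E)%E =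
        ((2 ^+ l)%:E * gprob sigma (U l))%E.
      apply: gauss_iterZ; first exact: exprn_ge0.
        by apply: measurable_indicE; exact: mU.
      by move=> g; rewrite lee_fin.
    rewrite big_cons addeCA -IHe -eZ.
    by apply: gauss_iterD => //; exact: tm.
have [_ _ He] := hE (index_enum _).
apply: (@le_trans _ _ (gauss_expect sigma (h (index_enum _)))).
  apply: gauss_iter_le => // g; apply: (le_trans (fm g)).
  rewrite /h (_ : \sum_(l <- _) _ = (\sum_(l < M) 2 ^+ l * (\1_(U l) g))%:E)%E; last first.
    by rewrite -sumEFin; apply: eq_bigr => l _.
  rewrite -EFinD lee_fin.
  have aux a : (m g <= 2 ^ a)%N -> (m g <= 1 + \sum_(l < a | (2 ^ l < m g)) 2 ^ l)%N.
    elim: a => [|a IH] Ha; first by rewrite big_ord0.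
    rewrite big_mkcond big_ord_recr -big_mkcond/=.
    case: ltnP => [lt|ge]; last by rewrite addn0; exact: IH.
    apply: (leq_trans Ha); rewrite expnS mul2n -addnn addnA leq_add2r.
    rewrite (eq_bigl xpredT).
      have : forall b, (2 ^ b <= 1 + \sum_(l < b) 2 ^ l)%N.
        elim=> [|b IHb]; first by rewrite big_ord0.
        by rewrite big_ord_recr/= expnS mul2n -addnn addnA leq_add2r.
      exact.
    move=> l; rewrite (leq_ltn_trans _ lt)// leq_exp2l// ltnW//.
  apply: (@le_trans _ _ (1 + \sum_(l < M | (2 ^ l < m g)%N) 2 ^ l)%N%:R).
    by rewrite ler_nat aux.
  rewrite natrD lerD2l natr_sum big_mkcond; apply: ler_sum => l _.
  case: ifP => [lt|_]; last by rewrite mulr_ge0// exprn_ge0.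
  have [_ /(_ g lt) Ug _] := HU l.
  by rewrite indicE mem_set// mulr1 natrX.
rewrite He EFinD leeD2l// -sumEFin; apply: lee_sum => l _.
rewrite EFinM; apply: lee_wpmul2l; first by rewrite lee_fin exprn_ge0.
by have [] := HU l.
Qed.

End Covers.

Local Close Scope classical_set_scope.

(** * The potential and single iterations *)

Lemma sum_cst (R : pzRingType) (T : finType) (C : {set T}) (a : R) :
  \sum_(j in C) a = #|C|%:R * a.
Proof. by rewrite sumr_const mulr_natl. Qed.

(** The parallel axis identity in one coordinate. *)
Lemma sum_sq_mean (R : numFieldType) (T : finType) (C : {set T}) (F : T -> R) (p : R) :
  let m := (#|C|%:R)^-1 * \sum_(j in C) F j in
  \sum_(j in C) (F j - p) ^+ 2 =
  \sum_(j in C) (F j - m) ^+ 2 + #|C|%:R * (m - p) ^+ 2.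
Proof.
move=> m; have [C0|C0] := eqVneq (#|C|%:R : R) 0.
  move/eqP: C0; rewrite pnatr_eq0 cards_eq0 => /eqP C0.
  by rewrite {1 2}C0 !big_set0 C0 cards0 mul0r addr0.
have Em : \sum_(j in C) F j = #|C|%:R * m by rewrite /m mulrA divff// mul1r.
apply/eqP; rewrite addrC -subr_eq -sumrB; apply/eqP.
rewrite (eq_bigr (fun j => (m - p) * 2 * F j - (m - p) * (m + p))); last by move=> j _; ring.
by rewrite sumrB -mulr_sumr sum_cst Em; ring.
Qed.

Section SqDist.
Context (R : realType) (d : nat).
Local Notation point := 'rV[R]_d.
Implicit Types (x y z : point).

Lemma sqdist_ge0 x y : 0 <= sqdist x y.
Proof. by apply: sumr_ge0 => j _; exact: sqr_ge0. Qed.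

Lemma sqdistC x y : sqdist x y = sqdist y x.
Proof. by apply: eq_bigr => j _; rewrite -sqrrN opprB. Qed.

Lemma sqdist_coord x y o : (x ord0 o - y ord0 o) ^+ 2 <= sqdist x y.
Proof.
by rewrite /sqdist (bigD1 o)//= lerDl; apply: sumr_ge0 => j _; exact: sqr_ge0.
Qed.

Lemma sqdist_eq0 x y : sqdist x y <= 0 -> x = y.
Proof.
move=> H; apply/rowP => o.
have := le_trans (sqdist_coord x y o) H.
by rewrite real_exprn_even_le0 ?num_real//= subr_eq0 => /eqP.
Qed.

Lemma sqdistxx x : sqdist x x = 0.
Proof. by rewrite /sqdist big1// => j _; rewrite subrr expr0n. Qed.

Lemma sqdist_le x y (M : R) : (forall o, `|x ord0 o - y ord0 o| <= M) ->
  sqdist x y <= d%:R * M ^+ 2.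
Proof.
move=> H; rewrite -[X in X%:R]card_ord mulr_natl -sumr_const; apply: ler_sum => o _.
by rewrite -real_normK ?num_real// lerXn2r ?nnegrE// (le_trans _ (H o)).
Qed.

End SqDist.

(** * The drop of the potential in one and in two steps *)

Section Potential.
Context (R : realType) (n k d : nat) (X : 'I_n -> 'rV[R]_d).
Local Notation point := 'rV[R]_d.
Implicit Types (f g h : 'I_n -> 'I_k) (c : 'I_k -> point).

Definition cell f i : {set 'I_n} := [set x | f x == i].

Definition mean (C : {set 'I_n}) : point := (#|C|%:R)^-1 *: \sum_(x in C) X x.

Definition cost (C : {set 'I_n}) (p : point) : R := \sum_(x in C) sqdist (X x) p.

(** Summed over points, so that it visibly depends on the partition only and labels can be renamed
    freely. *)
Definition Psi f : R := \sum_x sqdist (X x) (mean (cell f (f x))).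

Lemma mean_coord C o : mean C ord0 o = (#|C|%:R)^-1 * \sum_(x in C) X x ord0 o.
Proof. by rewrite mxE summxE. Qed.

Lemma cost_mean C p : cost C p = cost C (mean C) + #|C|%:R * sqdist (mean C) p.
Proof.
rewrite /cost /sqdist exchange_big/= [X in _ = X + _]exchange_big/= mulr_sumr -big_split/=.
apply: eq_bigr => o _; rewrite mean_coord.
exact: (sum_sq_mean C (fun x => X x ord0 o)).
Qed.

Lemma sum_cells f (F : 'I_n -> 'I_k -> R) :
  \sum_x F x (f x) = \sum_i \sum_(x in cell f i) F x i.
Proof.
rewrite (partition_big f xpredT)//=; apply: eq_bigr => i _.
rewrite [RHS](eq_bigl (fun x => f x == i)); last by move=> x; rewrite inE.
by apply: eq_bigr => x /eqP ->.
Qed.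

Lemma mem_cell f x : x \in cell f (f x).
Proof. by rewrite inE. Qed.

Lemma Psi_ge0 f : 0 <= Psi f.
Proof. by apply: sumr_ge0 => x _; exact: sqdist_ge0. Qed.

Lemma Psi_le f c : Psi f <= \sum_x sqdist (X x) (c (f x)).
Proof.
rewrite /Psi (sum_cells f (fun x i => sqdist (X x) (mean (cell f i)))).
rewrite (sum_cells f (fun x i => sqdist (X x) (c i))).
apply: ler_sum => i _; rewrite -/(cost _ _) -/(cost _ (c i)) [leRHS]cost_mean lerDl.
by rewrite mulr_ge0// sqdist_ge0.
Qed.

Lemma eq_Psi f g : (forall x y, (f x == f y) = (g x == g y)) -> Psi f = Psi g.
Proof.
move=> fg; apply: eq_bigr => x _; congr (sqdist _ (mean _)).
by apply/setP => y; rewrite !inE fg.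
Qed.

(* One iteration seen from its centers: [f] is the clustering whose means are
   the centers, [g] the clustering obtained from them by reassignment, with
   labels chosen so that equal centers carry equal labels. *)
Definition kstep c f g : Prop :=
  [/\ forall x, c (f x) = mean (cell f (f x)),
      forall x j, sqdist (X x) (c (g x)) <= sqdist (X x) (c j),
      forall x y, c (f x) = c (f y) -> f x = f y,
      forall x y, c (g x) = c (g y) -> g x = g y &
      forall x y, c (f x) = c (g y) -> f x = g y].

Lemma kstep_Psi c f g : kstep c f g -> Psi f = \sum_x sqdist (X x) (c (f x)).
Proof. by case=> H _ _ _ _; apply: eq_bigr => x _; rewrite H. Qed.

(** The first sum is the gain of reassignment at fixed centers, the second the gain of moving the
    centers, by the parallel axis identity. All terms are nonnegative, so a small drop bounds the
    gain of every point and the shift of every center separately. *)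
Lemma kstep_drop c f g : kstep c f g ->
  Psi f - Psi g = \sum_x (sqdist (X x) (c (f x)) - sqdist (X x) (c (g x))) +
    \sum_i #|cell g i|%:R * sqdist (mean (cell g i)) (c i).
Proof.
move=> st; rewrite (kstep_Psi st) sumrB -addrA; congr (_ + _).
rewrite (sum_cells g (fun x i => sqdist (X x) (c i))) /Psi.
rewrite (sum_cells g (fun x i => sqdist (X x) (mean (cell g i)))).
rewrite -!sumrN -big_split/=; apply: eq_bigr => i _.
by rewrite -/(cost _ _) -/(cost _ (c i)) [cost _ (c i)]cost_mean; ring.
Qed.

Lemma kstep_gain_ge0 c f g x : kstep c f g ->
  0 <= sqdist (X x) (c (f x)) - sqdist (X x) (c (g x)).
Proof. by case=> _ H _ _ _; rewrite subr_ge0. Qed.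

Lemma kstep_gain c f g x del : kstep c f g -> Psi f - Psi g <= del ->
  sqdist (X x) (c (f x)) - sqdist (X x) (c (g x)) <= del.
Proof.
move=> st; rewrite (kstep_drop st) => H; apply: le_trans H.
rewrite (bigD1 x)//= -addrA lerDl addr_ge0//.
  by apply: sumr_ge0 => y _; exact: kstep_gain_ge0 st.
by apply: sumr_ge0 => i _; rewrite mulr_ge0// sqdist_ge0.
Qed.

Lemma kstep_shift c f g i del : kstep c f g -> Psi f - Psi g <= del ->
  #|cell g i|%:R * sqdist (mean (cell g i)) (c i) <= del.
Proof.
move=> st; rewrite (kstep_drop st) => H; apply: le_trans H.
rewrite [X in _ + X](bigD1 i)//= addrCA lerDl addr_ge0//.
  by apply: sumr_ge0 => y _; exact: kstep_gain_ge0 st.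
by apply: sumr_ge0 => j _; rewrite mulr_ge0// sqdist_ge0.
Qed.

Section TwoSteps.
Variables (c c' : 'I_k -> point) (f g h : 'I_n -> 'I_k).
Hypothesis fmean : forall x, c (f x) = mean (cell f (f x)).
Hypothesis gmin : forall x j, sqdist (X x) (c (g x)) <= sqdist (X x) (c j).
Hypothesis hmin : forall x j, sqdist (X x) (c' (h x)) <= sqdist (X x) (c' j).
Hypothesis c'E : forall i, c' i = if cell g i == finset.set0 then c i else mean (cell g i).

(* Compares, at the centers [c i] and [c' i], the change of the cost of each
   cluster in the second step: a cluster returning to its previous
   composition can only lose, while the second step must gain. *)
Lemma two_steps :
  (forall i, [|| cell g i == cell f i, cell h i == cell g i | cell h i == cell f i]) ->
  forall y, h y != g y ->
  [/\ c' (g y) = c (g y), c' (h y) = c (h y) &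
      sqdist (X y) (c' (g y)) = sqdist (X y) (c' (h y))].
Proof.
move=> tog.
pose G i p := cost (cell h i) p - cost (cell g i) p.
have fm i : cell f i != finset.set0 -> c i = mean (cell f i).
  by case/finset.set0Pn => x; rewrite inE => /eqP <-; exact: fmean.
have cost0 p : cost finset.set0 p = 0 by rewrite /cost big_set0.
have costf i p : cost (cell f i) p = cost (cell f i) (c i) + #|cell f i|%:R * sqdist (c i) p.
  have [e|ne] := eqVneq (cell f i) finset.set0; first by rewrite e !cost0 cards0 mul0r addr0.
  by rewrite (fm _ ne) -cost_mean.
have costg i p : cost (cell g i) p = cost (cell g i) (c' i) + #|cell g i|%:R * sqdist (c' i) p.
  have [e|ne] := eqVneq (cell g i) finset.set0; first by rewrite e !cost0 cards0 mul0r addr0.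
  by rewrite c'E (negbTE ne) -cost_mean.
(* Only a cluster that changes and then changes back is of interest: there the increase of [G i] is
   the squared shift of the center times the sum of both cluster sizes, so equality forces an
   unmoved center. *)
have Gi i : G i (c i) <= G i (c' i) /\
    (G i (c i) = G i (c' i) -> cell h i != cell g i -> c' i = c i).
  have [hg|hg] := eqVneq (cell h i) (cell g i); first by rewrite /G hg !subrr; split.
  have [gf|gf] := eqVneq (cell g i) (cell f i).
    suff -> : c' i = c i by split.
    by rewrite c'E gf; case: ifP => // /negbT /fm ->.
  have := tog i; rewrite (negbTE hg) (negbTE gf) /= => /eqP hf.
  have E : G i (c' i) - G i (c i) =
      (#|cell f i| + #|cell g i|)%:R * sqdist (c i) (c' i).
    by rewrite /G hf (costf i (c' i)) (costg i (c i)) (sqdistC (c' i)) natrD; ring.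
  split; first by rewrite -subr_ge0 E mulr_ge0// sqdist_ge0.
  move=> eqG _; apply/esym/sqdist_eq0.
  move: E; rewrite eqG subrr => /esym/eqP; rewrite mulf_eq0 => /orP[|/eqP->//].
  rewrite pnatr_eq0 addn_eq0 !cards_eq0 => /andP[/eqP ef /eqP eg].
  by rewrite ef eg eqxx in gf.
have sumG (e : 'I_k -> point) :
    \sum_i G i (e i) = \sum_x (sqdist (X x) (e (h x)) - sqdist (X x) (e (g x))).
  rewrite !sumrB; congr (_ - _); apply/esym;
  exact: (sum_cells _ (fun x i => sqdist (X x) (e i))).
have ge0 x : 0 <= sqdist (X x) (c (h x)) - sqdist (X x) (c (g x)) by rewrite subr_ge0.
have le0 x : 0 <= sqdist (X x) (c' (g x)) - sqdist (X x) (c' (h x)) by rewrite subr_ge0.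
(* [g] is optimal for [c] and [h] is optimal for [c'], which gives the two sums opposite signs; the
   termwise comparison squeezes both to zero. *)
have S1 : 0 <= \sum_i G i (c i) by rewrite sumG; apply: sumr_ge0.
have S2 : \sum_i G i (c' i) <= 0.
  by rewrite sumG -oppr_ge0 -sumrN; apply: sumr_ge0 => x _; rewrite opprB.
have S3 : \sum_i G i (c i) <= \sum_i G i (c' i) by apply: ler_sum => i _; have [] := Gi i.
have eqG i : G i (c i) = G i (c' i).
  apply/esym/eqP; rewrite -subr_eq0.
  have H : \sum_i (G i (c' i) - G i (c i)) = 0.
    by rewrite sumrB; apply/eqP; rewrite eq_le subr_le0 subr_ge0 S3 (le_trans S2).
  apply/eqP; move: H => /eqP; rewrite psumr_eq0; last first.
    by move=> j _; rewrite subr_ge0; have [] := Gi j.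
  by move=> /allP/(_ i (mem_index_enum _))/eqP.
have tie x : sqdist (X x) (c' (g x)) = sqdist (X x) (c' (h x)).
  apply/eqP; rewrite -subr_eq0.
  have /eqP : \sum_x (sqdist (X x) (c' (g x)) - sqdist (X x) (c' (h x))) = 0.
    apply/eqP; rewrite eq_le sumr_ge0// andbT -oppr_ge0 -sumrN.
    by under eq_bigr do rewrite opprB; rewrite -sumG (le_trans S1).
  by rewrite psumr_eq0// => /allP/(_ x (mem_index_enum _)).
move=> y hgy; split => //.
- apply: (Gi (g y)).2 => //; apply/eqP => /setP/(_ y).
  by rewrite !inE eqxx (negbTE hgy).
- apply: (Gi (h y)).2 => //; apply/eqP => /setP/(_ y).
  by rewrite !inE eqxx eq_sym (negbTE hgy).
Qed.

End TwoSteps.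
End Potential.

(** [pick] returns the first element in a fixed order. This consistency between iterations is what
    excludes moves between equally near centers. *)
Lemma pick_first (T : finType) (P Q : pred T) a b :
  pick P = Some a -> pick Q = Some b -> P b -> Q a -> a = b.
Proof.
rewrite /pick /enum_mem; elim: (Finite.enum T) => [//|x s IH] /=.
rewrite -!topredE /=; case: ifP => Px; case: ifP => Qx //=.
- by move=> [->] [->].
- by move=> [<-] _ _; rewrite Qx.
- by move=> _ [<-]; rewrite Px.
Qed.

(** * Coinciding centers, tie-breaking and termination *)

Section Relabel.
Context (R : realType) (n k d : nat) (X : 'I_n -> 'rV[R]_d).
Local Notation point := 'rV[R]_d.
Variables (c : 'I_k -> point) (a f : 'I_n -> 'I_k).
Hypothesis amean : forall x, c (a x) = mean X (cell a (a x)).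
Hypothesis cf : forall x, c (f x) = c (a x).
Hypothesis finj : forall x y, c (f x) = c (f y) -> f x = f y.

(** A cluster of [f] is a union of clusters of [a] with a common mean, which is then the mean of the
    union. *)
Lemma relabel_mean x : c (f x) = mean X (cell f (f x)).
Proof.
suff H : \sum_(y in cell f (f x)) X y = #|cell f (f x)|%:R *: c (f x).
  rewrite /mean H scalerA mulVf ?scale1r// pnatr_eq0 cards_eq0.
  by apply/finset.set0Pn; exists x; rewrite inE.
have cellE (V : nmodType) (F : 'I_n -> V) : \sum_(y in cell f (f x)) F y =
    \sum_l \sum_(y | (y \in cell f (f x)) && (a y == l)) F y.
  exact: (partition_big a xpredT).
rewrite cellE -sum1_card cellE natr_sum scaler_suml; apply: eq_bigr => l _.
rewrite sum1_card.
have [[y0 /andP[y0f /eqP y0a]]|no] := pselect (exists y, (y \in cell f (f x)) && (a y == l)); last first.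
  rewrite big_pred0 ?eq_card0 ?scale0r// => y; apply/negbTE/negP => H; apply: no; exists y;
  by rewrite // -[_ && _]/(y \in (fun y => _)).
move: y0f; rewrite inE => /eqP y0f.
have E : (fun y => (y \in cell f (f x)) && (a y == l)) =1 mem (cell a l).
  move=> y; rewrite !inE/=; case: (a y =P l) => [al|]; last by rewrite andbF.
  by rewrite andbT -y0f; apply/eqP; apply: finj; rewrite !cf al y0a.
rewrite (eq_bigl _ _ E) (eq_card E).
have cl : c (f x) = mean X (cell a l) by rewrite -y0f cf -y0a amean.
rewrite cl /mean scalerA divff ?scale1r// pnatr_eq0 cards_eq0.
by apply/finset.set0Pn; exists y0; rewrite inE y0a.
Qed.

Lemma relabel_Psi : Psi X f = Psi X a.
Proof. by apply: eq_bigr => x _; rewrite -relabel_mean cf amean. Qed.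

End Relabel.

Section Trajectory.
Context (R : realType) (n k d : nat) (i0 : 'I_k) (X : 'I_n -> 'rV[R]_d).
Variable c0 : {ffun 'I_k -> 'rV[R]_d}.
Local Notation point := 'rV[R]_d.

Definition ctr t : 'I_k -> point := (kmeans_state i0 X c0 t).2.
(** Indices: [asg t] is computed from [ctr t], and its means are [ctr t.+1], where empty labels keep
    their centers. *)
Definition asg t : 'I_n -> 'I_k := fun x => assign i0 (kmeans_state i0 X c0 t).2 (X x).

Definition nearest (c : 'I_k -> point) (x : point) : pred 'I_k :=
  fun i => [forall j, sqdist x (c i) <= sqdist x (c j)].

Lemma assign_pick (c : {ffun 'I_k -> point}) x :
  pick (nearest c x) = Some (assign i0 c x).
Proof.
rewrite /assign /Order.arg_min /extremum.
rewrite (@eq_pick _ _ (nearest c x)); last first.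
  move=> i; rewrite /nearest /=; apply: eq_forallb => j.
  by [].
case: pickP => [//|no]; have := @arg_minP _ _ _ i0 xpredT (fun i => sqdist x (c i)) isT.
case=> i _ Hi; have /negP[] := no i; apply/forallP => j; exact: Hi.
Qed.

Lemma asg_pick t x : pick (nearest (ctr t) (X x)) = Some (asg t x).
Proof. exact: assign_pick. Qed.

Lemma asg_min t x j : sqdist (X x) (ctr t (asg t x)) <= sqdist (X x) (ctr t j).
Proof.
have := asg_pick t x; case: pickP => [i Hi [<-]|//].
by have /forallP := Hi; exact.
Qed.

Lemma stateS t : kmeans_state i0 X c0 t.+1 =
  (Some [ffun x => asg t x], (kmeans_step i0 X (kmeans_state i0 X c0 t).2).2).
Proof. by rewrite /= /asg; case: (kmeans_state i0 X c0 t). Qed.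

Lemma ctrS t i : ctr t.+1 i =
  if cell (asg t) i == finset.set0 then ctr t i else mean X (cell (asg t) i).
Proof.
rewrite /ctr stateS /kmeans_step /= ffunE.
set C := (X in #|X|).
have CE : C =i cell (asg t) i.
  by move=> x; rewrite /C inE; apply/asboolP/idP; rewrite /= ffunE.
rewrite (eq_card CE) cards_eq0; case: ifP => // _.
by rewrite /mean; congr (_ *: _); apply: eq_bigl => x; rewrite -CE.
Qed.

Lemma ctr_mean t x : ctr t.+1 (asg t x) = mean X (cell (asg t) (asg t x)).
Proof.
rewrite ctrS ifF//; apply/negP => /eqP/setP/(_ x).
by rewrite !inE eqxx.
Qed.

(** The first label with the same center. Labels may share a center, through the initial choice or
    because two clusters have equal means, while [kstep] wants such labels identified. *)
Definition rep (c : 'I_k -> point) i : 'I_k := odflt i (pick (fun j => c j == c i)).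

Lemma repE c i : c (rep c i) = c i.
Proof. by rewrite /rep; case: pickP => [j /eqP|]. Qed.

Lemma rep_eq c i j : c i = c j -> rep c i = rep c j.
Proof. by move=> e; rewrite /rep e; case: pickP => // /(_ j)/=; rewrite eqxx. Qed.

(** The assignment picks the first of the nearest labels, in particular the first one at its center.
    Hence only the old clustering of a step has to be relabelled. *)
Lemma rep_asg t x : rep (ctr t) (asg t x) = asg t x.
Proof.
have := asg_pick t x; case E : (pick (fun j => ctr t j == ctr t (asg t x))) => [b|].
  move=> H; have e : ctr t b = ctr t (asg t x).
    by move: E; case: pickP => // j /eqP Hj [<-].
  rewrite /rep E /=; apply/esym/(pick_first H E).
    apply/forallP => j; rewrite e; exact: asg_min.
  by rewrite /= eqxx.
by rewrite /rep E.
Qed.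

Lemma asg_inj t x y : ctr t (asg t x) = ctr t (asg t y) -> asg t x = asg t y.
Proof. by move=> e; rewrite -rep_asg -[RHS]rep_asg; exact: rep_eq. Qed.

Definition asg_rep t x := rep (ctr t.+1) (asg t x).

Lemma ctr_asg_rep t x : ctr t.+1 (asg_rep t x) = ctr t.+1 (asg t x).
Proof. exact: repE. Qed.

Lemma asg_rep_inj t x y :
  ctr t.+1 (asg_rep t x) = ctr t.+1 (asg_rep t y) -> asg_rep t x = asg_rep t y.
Proof. by rewrite !repE => e; exact: rep_eq. Qed.

Lemma kstep_asg_rep t : kstep X (ctr t.+1) (asg_rep t) (asg t.+1).
Proof.
split.
- move=> x; apply: (@relabel_mean _ _ _ _ _ (ctr t.+1) (asg t)).
  + exact: ctr_mean.
  + exact: ctr_asg_rep.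
  + exact: asg_rep_inj.
- move=> x j; exact: asg_min.
- exact: asg_rep_inj.
- exact: asg_inj.
- by move=> x y; rewrite -[asg t.+1 y]rep_asg !repE => e; exact: rep_eq.
Qed.

Lemma Psi_asg_rep t : Psi X (asg_rep t) = Psi X (asg t).
Proof.
by apply: (@relabel_Psi _ _ _ _ _ (ctr t.+1));
  [exact: ctr_mean|exact: ctr_asg_rep|exact: asg_rep_inj].
Qed.

Lemma Psi_asg_le t : Psi X (asg t.+1) <= Psi X (asg t).
Proof.
rewrite -(Psi_asg_rep t) -subr_ge0 (kstep_drop (kstep_asg_rep t)) addr_ge0//.
  by apply: sumr_ge0 => x _; exact: kstep_gain_ge0 (kstep_asg_rep t).
by apply: sumr_ge0 => i _; rewrite mulr_ge0// sqdist_ge0.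
Qed.

(** With no drop, no center of a nonempty cluster shifts, so the next assignment repeats. A state
    stores the assignment beside the centers, so equality of states appears one iteration later. *)
Lemma Psi_asg_eq t : Psi X (asg t.+1) = Psi X (asg t) ->
  kmeans_state i0 X c0 t.+3 = kmeans_state i0 X c0 t.+2.
Proof.
move=> e.
have c2 : (kmeans_state i0 X c0 t.+2).2 = (kmeans_state i0 X c0 t.+1).2.
  apply/ffunP => i; rewrite -!/(ctr _ i) ctrS; case: ifP => // /negbT ne.
  apply: sqdist_eq0.
  have H : Psi X (asg_rep t) - Psi X (asg t.+1) <= 0 by rewrite Psi_asg_rep e subrr.
  have := kstep_shift i (kstep_asg_rep t) H.
  by rewrite pmulr_rle0// ltr0n lt0n cards_eq0.
have a2 : asg t.+2 = asg t.+1 by rewrite /asg c2.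
by rewrite (stateS t.+2) c2 (stateS t.+1) a2.
Qed.

Lemma no_stop_decr t : ~ kmeans_stops_at i0 X c0 t.+3 ->
  Psi X (asg t.+1) < Psi X (asg t).
Proof.
move=> ns; rewrite lt_neqAle Psi_asg_le andbT; apply/eqP => /Psi_asg_eq e.
by apply: ns; split.
Qed.

(** Without a stop up to k^n + 2, the strictly decreasing potential would make the first k^n + 1
    clusterings distinct, but there are only k^n. *)
Lemma stops_exists : exists m, (m <= k ^ n + 2)%N /\ kmeans_stops_at i0 X c0 m.
Proof.
apply: contrapT => no.
have decr t : (t.+3 <= k ^ n + 2)%N -> Psi X (asg t.+1) < Psi X (asg t).
  by move=> tm; apply: no_stop_decr => st; apply: no; exists t.+3.
have decr2 s t : (s < t)%N -> (t.+2 <= k ^ n + 2)%N -> Psi X (asg t) < Psi X (asg s).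
  elim: t => // t IH; rewrite ltnS leq_eqVlt => /predU1P[<-|st] tm.
    exact: decr.
  by apply: lt_trans (IH st _); [exact: decr|exact: ltnW].
pose F (t : 'I_(k ^ n).+1) : {ffun 'I_n -> 'I_k} := [ffun x => asg t x].
have Finj : injective F.
  move=> s t /ffunP e.
  have e' : Psi X (asg s) = Psi X (asg t).
    apply: eq_Psi => x y; have := e x; have := e y; have := e x; rewrite !ffunE.
    by move=> -> -> _.
  have aux (K u : nat) : (u < K.+1 -> u.+2 <= K + 2)%N by lia.
  have bd (u : 'I_(k ^ n).+1) : (u.+2 <= k ^ n + 2)%N.
    by apply: aux; exact: ltn_ord.
  apply/val_inj/eqP; rewrite eqn_leq; apply/andP; split; rewrite leqNgt; apply/negP => lt.
    by have := decr2 _ _ lt (bd _); rewrite e' ltxx.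
  by have := decr2 _ _ lt (bd _); rewrite e' ltxx.
have := leq_card F Finj; rewrite card_ord card_ffun !card_ord.
by rewrite ltnn.
Qed.

Lemma kmeans_iterations_ge0 : (0 <= kmeans_iterations i0 X c0)%E.
Proof. by apply: le_ereal_inf_tmp => _ [m _ <-]; rewrite lee_fin. Qed.

Lemma kmeans_iterations_le m : kmeans_stops_at i0 X c0 m ->
  (kmeans_iterations i0 X c0 <= m%:R%:E)%E.
Proof. by move=> st; apply: ereal_inf_lbound; exists m. Qed.

Section SecondStep.
Variable t : nat.
Hypothesis means_inj : forall x y,
  ctr t.+1 (asg t x) = ctr t.+1 (asg t y) -> asg t x = asg t y.

(* A cluster moving as a whole onto an empty label with the same center is
   regarded as staying put. *)
Definition asg_lazy x : 'I_k :=
  if [pick z | ctr t.+1 (asg t z) == ctr t.+1 (asg t.+1 x)] is Some z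
  then asg t z else asg t.+1 x.

Lemma ctr_asg_lazy x : ctr t.+1 (asg_lazy x) = ctr t.+1 (asg t.+1 x).
Proof. by rewrite /asg_lazy; case: pickP => [z /eqP|]. Qed.

Lemma asg_lazy_inj x y :
  ctr t.+1 (asg_lazy x) = ctr t.+1 (asg_lazy y) -> asg_lazy x = asg_lazy y.
Proof.
rewrite !ctr_asg_lazy => e; rewrite /asg_lazy e; case: pickP => // _.
exact: asg_inj.
Qed.

Lemma asg_asg_lazy x y : ctr t.+1 (asg t x) = ctr t.+1 (asg_lazy y) -> asg t x = asg_lazy y.
Proof.
rewrite ctr_asg_lazy => e; rewrite /asg_lazy; case: pickP => [z /eqP ez|/(_ x)].
  by apply: means_inj; rewrite e.
by rewrite e eqxx.
Qed.

Lemma kstep_asg_lazy : kstep X (ctr t.+1) (asg t) asg_lazy.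
Proof.
split.
- exact: ctr_mean.
- by move=> x j; rewrite ctr_asg_lazy; exact: asg_min.
- exact: means_inj.
- exact: asg_lazy_inj.
- exact: asg_asg_lazy.
Qed.

Lemma Psi_asg_lazy : Psi X asg_lazy = Psi X (asg t.+1).
Proof.
apply: eq_Psi => x y; apply/eqP/eqP => [e|e].
  by apply: asg_inj; rewrite -!ctr_asg_lazy e.
by apply: asg_lazy_inj; rewrite !ctr_asg_lazy e.
Qed.

End SecondStep.

(** If every label had at most two compositions, [two_steps] would leave only moves between unmoved,
    equally near centers. Tie-breaking in a fixed order forbids these, so the second step would
    change nothing. *)
Lemma three_configurations t :
  (forall x y, ctr t.+2 (asg t.+1 x) = ctr t.+2 (asg t.+1 y) -> asg t.+1 x = asg t.+1 y) ->
  Psi X (asg t.+2) < Psi X (asg t.+1) ->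
  exists i, [/\ cell (asg t.+1) i != cell (asg_rep t) i,
     cell (asg_lazy t.+1) i != cell (asg t.+1) i &
     cell (asg_lazy t.+1) i != cell (asg_rep t) i].
Proof.
move=> minj dec; apply: contrapT => no.
have tog i : [|| cell (asg t.+1) i == cell (asg_rep t) i,
    cell (asg_lazy t.+1) i == cell (asg t.+1) i |
    cell (asg_lazy t.+1) i == cell (asg_rep t) i].
  apply: contrapT => /negP; rewrite !negb_or => /and3P[h1 h2 h3].
  by apply: no; exists i.
have [smean smin _ _ _] := kstep_asg_rep t.
have [_ hmin _ _ _] := kstep_asg_lazy minj.
have T := two_steps smean smin hmin (ctrS t.+1) tog.
have [y yh] : exists y, asg_lazy t.+1 y != asg t.+1 y.
  apply: contrapT => ny; move: dec; rewrite -(Psi_asg_lazy t.+1).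
  rewrite (@eq_Psi _ _ _ _ _ (asg_lazy t.+1) (asg t.+1)) ?ltxx// => x z.
  have e w : asg_lazy t.+1 w = asg t.+1 w.
    by have [//|nw] := eqVneq (asg_lazy t.+1 w) (asg t.+1 w); case: ny; exists w.
  by rewrite !e.
have [ci cj tie] := T y yh.
have Q' := asg_pick t.+2 y; have P' := asg_pick t.+1 y.
(* If the chosen label was empty, its center is kept by definition; otherwise the lazy label is the
   chosen one and its center is already known to be unmoved. *)
have cj' : ctr t.+1 (asg t.+2 y) = ctr t.+2 (asg t.+2 y).
  rewrite (ctrS t.+1); case: ifPn => // /finset.set0Pn[z]; rewrite inE => /eqP gz.
  suff e : asg_lazy t.+1 y = asg t.+2 y.
    by rewrite -{1}e -cj e (ctrS t.+1) ifF// -gz; apply/negP => /eqP/setP/(_ z); rewrite !inE eqxx.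
  rewrite -gz; apply/esym; apply: (asg_asg_lazy minj).
  by rewrite ctr_asg_lazy gz.
have ij : asg t.+1 y = asg t.+2 y.
  apply: (pick_first P' Q').
    apply/forallP => j; rewrite cj' -ctr_asg_lazy -tie ci.
    exact: asg_min.
  apply/forallP => j; rewrite tie ctr_asg_lazy; exact: asg_min.
move/eqP: yh; apply; apply/esym/(asg_asg_lazy minj).
by rewrite ctr_asg_lazy ij.
Qed.

End Trajectory.

(** * Tiny steps in dimension one *)

Ltac order_lra := repeat match goal with
  | H : is_true (_ \in _) |- _ => clear H
  | H : is_true (~~ _) |- _ => clear H
  | H : forall _, _ |- _ => clear H
  | H : @eq (ordinal _) _ _ |- _ => clear H
  end; lra.

(** When no term exceeds [r], one very negative term could not be compensated. A cluster on one side
    of a bisector with a nearly stationary mean is thereby confined to a short interval. *)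
Lemma onesided_le (R : realFieldType) (n : nat) (S : {set 'I_n}) (h : 'I_n -> R) (r B : R) z :
  0 <= r -> (forall y, y \in S -> h y <= r) -> - B <= \sum_(y in S) h y ->
  z \in S -> - (B + n%:R * r) <= h z.
Proof.
move=> r0 hr hB zS; move: hB; rewrite (bigD1 z)//= => hB.
have : \sum_(y in S | y != z) h y <= n%:R * r.
  apply: (@le_trans _ _ (\sum_(y in S | y != z) r)).
    by apply: ler_sum => y /andP[yS _]; exact: hr.
  by rewrite sumr_const -[leLHS]mulr_natl ler_wpM2r// ler_nat -[leqRHS]card_ord max_card.
lra.
Qed.

Lemma onesided_ge (R : realFieldType) (n : nat) (S : {set 'I_n}) (h : 'I_n -> R) (r B : R) z :
  0 <= r -> (forall y, y \in S -> - r <= h y) -> \sum_(y in S) h y <= B ->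
  z \in S -> h z <= B + n%:R * r.
Proof.
move=> r0 hr hB zS; rewrite -lerN2.
apply: (@onesided_le _ _ S (fun y => - h y) r B z) => //.
  by move=> y yS; rewrite lerNl; exact: hr.
by rewrite sumrN lerN2.
Qed.

Lemma nearer_left (R : realFieldType) (x a b : R) : a < b ->
  (x - a) ^+ 2 <= (x - b) ^+ 2 -> 2 * x <= a + b.
Proof. nra. Qed.

Lemma nearer_right (R : realFieldType) (x a b : R) : a < b ->
  (x - b) ^+ 2 <= (x - a) ^+ 2 -> a + b <= 2 * x.
Proof. nra. Qed.

Lemma gain_close_right (R : realFieldType) (x ci cj B eta : R) :
  0 <= eta -> eta <= B -> cj <= x -> x - cj <= B ->
  (x - ci) ^+ 2 <= (x - cj) ^+ 2 + eta ^+ 2 -> ci - x <= 2 * B.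
Proof.
move=> e0 eB cx xB gx; rewrite leNgt; apply/negP => H.
have B0 : 0 <= B by lra.
have h1 : 0 < (ci - x - 2 * B) * (ci - x + 2 * B) by apply: mulr_gt0; lra.
have h2 : 0 <= (B - (x - cj)) * (B + (x - cj)) by apply: mulr_ge0; lra.
have h3 : 0 <= (B - eta) * (B + eta) by apply: mulr_ge0; lra.
have h4 := mulr_ge0 B0 B0.
lra.
Qed.

Lemma gain_close_left (R : realFieldType) (x ci cj B eta : R) :
  0 <= eta -> eta <= B -> x <= cj ->
  (x - ci) ^+ 2 <= (x - cj) ^+ 2 + eta ^+ 2 -> ci - cj <= B.
Proof.
move=> e0 eB cx gx; rewrite leNgt; apply/negP => H.
have B0 : 0 <= B by lra.
have h1 : 0 < (ci - cj - B) * (ci - cj + B) by apply: mulr_gt0; lra.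
have h2 : 0 <= (ci - cj) * (cj - x) by apply: mulr_ge0; lra.
have h3 : 0 <= (B - eta) * (B + eta) by apply: mulr_ge0; lra.
have h4 := mulr_ge0 B0 B0.
lra.
Qed.

Section LineStep.
Context (R : realFieldType) (n k : nat).
Variables (p : 'I_n -> R) (c : 'I_k -> R) (f g : 'I_n -> 'I_k) (B eta : R).
Local Notation N := (n%:R : R).
Hypothesis eta0 : 0 <= eta.
Hypothesis etaB : eta <= B.
Hypothesis fsum : forall i, \sum_(y in cell f i) (p y - c i) = 0.
Hypothesis gmin : forall x j, (p x - c (g x)) ^+ 2 <= (p x - c j) ^+ 2.
Hypothesis finj : forall x y, c (f x) = c (f y) -> f x = f y.
Hypothesis ginj : forall x y, c (g x) = c (g y) -> g x = g y.
Hypothesis fginj : forall x y, c (f x) = c (g y) -> f x = g y.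
Hypothesis gsum : forall i, - B <= \sum_(y in cell g i) (p y - c i) <= B.
Hypothesis gain : forall x, (p x - c (f x)) ^+ 2 <= (p x - c (g x)) ^+ 2 + eta ^+ 2.
Hypothesis order : forall x y, c (f x) < c (f y) -> p x <= p y.
Hypothesis gfun : forall x y, p x = p y -> g x = g y.
(** [eps0] bounds the distance within a splitting pair, and [eps] the spread of every triple met in
    the case analysis. *)
Local Notation eps0 := (14 * (N * (N * B))).
Local Notation eps := (100 * (N * (N * (N * B)))).
Hypothesis no3 : forall a b e, a != b -> a != e -> b != e ->
  - eps <= p b - p a <= eps -> - eps <= p e - p a <= eps -> False.

(** The old cluster of [x] is a close pair which breaks into two singletons, and neither of these
    takes over another label that was in use. *)
Definition splits x := exists w, [/\ w != x,
  forall z, f z = f x -> z = w \/ z = x,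
  f w = f x /\ (forall z, g z = g x -> z = x),
  (forall z, g z = g w -> z = w) /\ - eps0 <= p x - p w <= eps0 &
  (forall z, f z = g x -> g x = f x) /\ (forall z, f z = g w -> g w = f x)].

Let B0 : 0 <= B. Proof. exact: le_trans etaB. Qed.

Let scale (x : 'I_n) : [/\ 1 <= N, B <= N * B, N * B <= N * (N * B) &
  N * (N * B) <= N * (N * (N * B))].
Proof.
have N1 : 1 <= N by rewrite ler1n; exact: leq_ltn_trans (ltn_ord x).
have H (b : R) : 0 <= b -> b <= N * b by move=> b0; rewrite ler_peMl.
have N0 : 0 <= N by exact: ler0n.
by split => //; apply: H; rewrite ?mulr_ge0.
Qed.

Let sep1 l l' r y : c l != c l' -> - r <= c l - c l' <= r -> g y = l ->
  - (B + N * r) <= p y - c l <= B + N * r.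
Proof.
move=> cll' /andP[r1 r2] gy.
have r0 : 0 <= r by lra.
have [N1 _ _ _] := scale y.
have Nr : r <= N * r by rewrite ler_peMl.
have yl : y \in cell g l by rewrite inE gy.
have /andP[s1 s2] := gsum l.
have nr z : z \in cell g l -> (p z - c l) ^+ 2 <= (p z - c l') ^+ 2.
  by rewrite inE => /eqP <-; exact: gmin.
case: (ltgtP (c l) (c l')) cll' => // lt _.
- have up z : z \in cell g l -> p z - c l <= r.
    by move=> /nr /(nearer_left lt); lra.
  by have := onesided_le r0 up s1 yl; have := up _ yl; have := B0; lra.
- have lo z : z \in cell g l -> - r <= p z - c l.
    by move=> /nr /(nearer_right lt); lra.
  by have := onesided_ge r0 lo s2 yl; have := lo _ yl; have := B0; lra.
Qed.

Let splits_sym x : splits x -> exists2 w, w != x & splits w /\ f w = f x.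
Proof.
move=> [w [wx Pf [fw gx] [gw d] [e1 e2]]]; exists w => //; split=> //; exists x; split.
- by rewrite eq_sym.
- by move=> z; rewrite fw => /Pf[]; [right|left].
- by [].
- by split => //; lra.
- by rewrite fw; split.
Qed.

(** Considers the leftmost mover that does not split, so that all movers further left do. The bounds
    on sums and gains bring a cluster within [eps] of [x], where [no3] leaves room for a single
    further point. *)
Lemma movers_split x : g x != f x -> splits x.
Proof.
move=> mx; apply: contrapT => nsx.
pose bad y := (g y != f y) && ~~ `[< splits y >].
have badx : bad x by rewrite /bad mx; apply/asboolPn.
case: (@Order.TotalTheory.arg_minP _ _ _ x bad p badx) => {badx mx nsx}x /andP[mx /asboolPn nsx] xmin.
have early y : g y != f y -> p y < p x -> splits y.
  move=> my yx; apply: contrapT => ns; have : bad y by rewrite /bad my; apply/asboolPn.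
  by move=> /xmin; rewrite leNgt yx.
have [N1 n1 n2 n3] := scale x; have BB := B0.
set i := f x; set j := g x.
have fij : c i != c j by apply: contraNneq mx => /fginj; rewrite /i => ->.
have ij : i != j by apply: contraNneq fij => ->.
have gi := gmin x i; rewrite -/j in gi.
(* Such a point left of [x] would split, with [x] as its partner, and then [x] would split as
   well. *)
have FN y : f y = i -> g y != i -> p x <= p y.
  move=> fy gy; rewrite leNgt; apply/negP => yx.
  have sy : splits y by apply: early => //; rewrite fy.
  have [w [wy Pf [fw _] _ _]] := sy; have [v vy [sv fv]] := splits_sym sy.
  case: (Pf x) => [|xw|xy]; first by rewrite fy.
    have [Pv|Pv] := Pf v fv; last by rewrite Pv eqxx in vy.
    by apply: nsx; rewrite xw -Pv.
  by rewrite xy ltxx in yx.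
(* Such a point left of [x] would split and end up alone in [j], which also receives [x]. *)
have FQ y : g y = j -> f y != j -> p x <= p y.
  move=> gy fy; rewrite leNgt; apply/negP => yx.
  have : splits y by apply: early => //; rewrite gy eq_sym.
  case=> w [_ _ [_ gyx] _ _].
  by have e : x = y by [apply: gyx; rewrite gy]; rewrite e ltxx in yx.
have near3 a : - eps <= p a - p x <= eps -> forall w, w != x ->
    - eps <= p w - p x <= eps -> a = w \/ a = x.
  move=> ha w wx hw; have [->|aw] := eqVneq a w; first by left.
  have [->|ax] := eqVneq a x; first by right.
  by case: (@no3 x a w) => //; rewrite eq_sym.
case: (ltgtP (c i) (c j)) fij => // lt _.
(* [x] moves right. No point enters [i], and all points leaving it lie right of its center, so the
   small deviation of what remains bounds the distance of [x] from [c i]. *)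
- have xm := nearer_right lt gi.
  have Qi y : g y = i -> f y = i.
    move=> gy; have [//|fy] := eqVneq (f y) i.
    have := gmin y j; rewrite gy => /(nearer_left lt) ym.
    have [e|ne] := eqVneq (p y) (p x).
      by move: (gfun e) ij; rewrite gy -/j => ->; rewrite eqxx.
    have yx : p y < p x by rewrite lt_neqAle ne; order_lra.
    have : splits y by apply: early => //; rewrite gy eq_sym.
    by case=> w [_ _ _ _ [/(_ x) e _]]; move: fy; rewrite -e ?gy ?eqxx.
  have subQP : cell g i \subset cell f i by apply/fintype.subsetP => y; rewrite !inE => /eqP/Qi ->.
  have sumP : \sum_(y in cell g i) (p y - c i) +
      \sum_(y in cell f i :\: cell g i) (p y - c i) = 0.
    apply: etrans _ (fsum i); rewrite [RHS](big_setID (cell g i))/=.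
    by rewrite (elimT finset.setIidPr subQP).
  have xPQ : x \in cell f i :\: cell g i by rewrite !inE eqxx andbT eq_sym.
  have PQ y : y \in cell f i :\: cell g i -> p x <= p y.
    by rewrite !inE => /andP[gy /eqP fy]; exact: FN.
  have /andP[s1 s2] := gsum i.
  have PQB y : y \in cell f i :\: cell g i -> p y - c i <= B.
    move=> yPQ; have : \sum_(z in cell f i :\: cell g i) (p z - c i) <= B by order_lra.
    rewrite (bigD1 y)//=; apply: le_trans; rewrite lerDl.
    by apply: sumr_ge0 => z /andP[/PQ zx _]; order_lra.
  have xi := PQB _ xPQ.
  have xj : - B <= p x - c j <= B.
    by move: gi xi xm lt => gi xi xm lt; apply/andP; split; nra.
  have sQi y : g y = i -> - (B + N * (2 * B)) <= p y - c i <= B + N * (2 * B).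
    by apply: (@sep1 i j); [rewrite lt_eqF|order_lra].
  have sQj y : g y = j -> - (B + N * (2 * B)) <= p y - c j <= B + N * (2 * B).
    by apply: (@sep1 j i); [rewrite gt_eqF|order_lra].
  have [w gw] : exists w, g w = i.
    apply: contrapT => no; have Q0 : cell g i = finset.set0.
      by apply/setP => y; rewrite !inE; apply/negbTE/eqP => gy; apply: no; exists y.
    move: sumP; rewrite Q0 big_set0 add0r finset.setD0 => sumP.
    have : 0 < \sum_(y in cell f i) (p y - c i).
      rewrite (bigD1 x) ?inE//= ltr_pwDl//; first order_lra.
      apply: sumr_ge0 => y /andP[yf _].
      have /PQ : y \in cell f i :\: cell g i by rewrite Q0 finset.setD0.
      order_lra.
    by rewrite sumP ltxx.
  have fw := Qi _ gw.
  have wx : w != x by apply: contraNneq ij => e; rewrite -gw e.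
  have hw : - eps0 <= p w - p x <= eps0 by have := sQi w gw; order_lra.
  have hwe : - eps <= p w - p x <= eps by order_lra.
  apply: nsx; exists w; split => //.
  + move=> z fz; apply: near3 wx hwe.
    have [gz|gz] := eqVneq (g z) i; first by have := sQi z gz; order_lra.
    have zPQ : z \in cell f i :\: cell g i by rewrite !inE gz fz eqxx.
    by have := PQB z zPQ; have := PQ z zPQ; order_lra.
  + split => // z gz; have [zw|//] : z = w \/ z = x.
      by apply: near3 wx hwe; have := sQj z gz; order_lra.
    by move: ij; rewrite -gw -zw gz eqxx.
  + split; last order_lra.
    move=> z; rewrite gw => gz; have [//|zx] : z = w \/ z = x.
      by apply: near3 wx hwe; have := sQi z gz; order_lra.
    by move: ij; rewrite -gz zx eqxx.
  + split=> [z fz|z _]; last by rewrite gw.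
    have Pj y : y \in cell f j -> - B <= p y - c j.
      rewrite inE => /eqP fy; have : p x <= p y by apply: order; rewrite -/i fy.
      order_lra.
    have zj : z \in cell f j by rewrite inE fz.
    have le0B : \sum_(y in cell f j) (p y - c j) <= B by rewrite fsum.
    have := onesided_ge BB Pj le0B zj; have := Pj z zj => z1 z2.
    have [zw|zx] : z = w \/ z = x by apply: near3 wx hwe; order_lra.
      by rewrite -fz zw fw.
    by rewrite -fz zx.
(* [x] moves left, so it lies left of [c i] and is the leftmost point of its old cluster, which
   cannot consist of [x] alone. *)
- have xm := nearer_left lt gi.
  have Pi y : f y = i -> p x <= p y.
    move=> fy; have [gy|gy] := eqVneq (g y) i; last exact: FN.
    have := gmin y j; rewrite gy => /(nearer_right lt); order_lra.
  have PiS y (r : R) : 0 <= r -> c i - p x <= r -> f y = i ->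
      p y - c i <= N * r.
    move=> r0 hr fy.
    have lo z : z \in cell f i -> - r <= p z - c i.
      by rewrite inE => /eqP /Pi; order_lra.
    have le00 : \sum_(y in cell f i) (p y - c i) <= 0 by rewrite fsum.
    have yi : y \in cell f i by rewrite inE fy.
    by have := onesided_ge r0 lo le00 yi; rewrite add0r.
  have notsingle : ~ (forall z, f z = i -> z = x).
    move=> H; have := fsum i; rewrite (bigD1 x) ?inE//= big1 ?addr0; last first.
      by move=> z /andP[]; rewrite inE => /eqP /H ->; rewrite eqxx.
    order_lra.
  have [[z0 fz0]|noP] := pselect (exists z, f z = j).
  + have Pjx z : f z = j -> p z <= p x by move=> fz; apply: order; rewrite fz.
    have PjQ z : f z = j -> g z = j.
      move=> fz; have [//|gz] := eqVneq (g z) j; exfalso.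
      have zx : p z < p x.
        rewrite lt_neqAle Pjx// andbT; apply: contraNneq gz => e.
        by rewrite (gfun e).
      have [w [wz Pf [fw _] [_ dw] _]] : splits z by apply: early => //; rewrite fz.
      have := fsum j; rewrite (bigD1 z) ?inE ?fz//= (bigD1 w) ?inE ?fw ?fz ?eqxx//=.
      rewrite big1 ?addr0; last first.
        move=> y /andP[/andP[]]; rewrite inE => /eqP fy yz yw.
        by case: (Pf y) => [|e|e]; [rewrite fy|rewrite e eqxx in yw|rewrite e eqxx in yz].
      move=> sm.
      have zc := gmin z j.
      have r1 : - eps0 <= p z - c j <= eps0 by order_lra.
      have r2 : - eps0 <= p z - c (g z) <= eps0 by apply/andP; split; nra.
      have cc : c j != c (g z).
        by apply: contraNneq gz => e; rewrite -fz; apply/eqP/esym/fginj; rewrite fz.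
      have := @sep1 j (g z) (2 * eps0) x cc; rewrite -/j => /(_ _ erefl) sx.
      have {}sx : - (B + N * (2 * eps0)) <= p x - c j <= B + N * (2 * eps0).
        by apply: sx; order_lra.
      have E1 : N * (2 * eps0) = 28 * (N * (N * (N * B))) by ring.
      apply: (@no3 z w x); rewrite 1?eq_sym//.
      * by apply: contraTneq zx => ->; rewrite ltxx.
      * by apply/eqP => e; move: ij; rewrite /i; (rewrite e || rewrite -e); rewrite fw fz eqxx.
      * order_lra.
      * order_lra.
    have subPQ : cell f j \subset cell g j by apply/fintype.subsetP => y; rewrite !inE => /eqP/PjQ ->.
    have sumQ : \sum_(y in cell g j) (p y - c j) =
        \sum_(y in cell g j :\: cell f j) (p y - c j).
      by rewrite [LHS](big_setID (cell f j))/= (elimT finset.setIidPr subPQ) fsum add0r.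
    have cx : c j <= p x.
      rewrite leNgt; apply/negP => xc.
      have : \sum_(y in cell f j) (p y - c j) < 0.
        rewrite (bigD1 z0) ?inE ?fz0//=.
        have : \sum_(y in cell f j | y != z0) (p y - c j) <= 0.
          rewrite -oppr_ge0 -sumrN; apply: sumr_ge0 => y /andP[].
          by rewrite inE => /eqP /Pjx; order_lra.
        by have := Pjx z0 fz0; order_lra.
      by rewrite fsum ltxx.
    have /andP[_ s2] := gsum j.
    have xB : p x - c j <= B.
      move: s2; rewrite sumQ (bigD1 x) ?inE ?eqxx ?andbT//=; apply: le_trans; rewrite lerDl.
      apply: sumr_ge0 => y /andP[]; rewrite !inE => /andP[fy /eqP gy] _.
      by have := FQ y gy fy; order_lra.
    have z0x : - eps <= p z0 - p x <= eps.
      have up z : z \in cell f j -> p z - c j <= B.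
        by rewrite inE => /eqP /Pjx; order_lra.
      have ge00 : - 0 <= \sum_(y in cell f j) (p y - c j) by rewrite fsum oppr0.
      have z0j : z0 \in cell f j by rewrite inE fz0.
      by have := onesided_le BB up ge00 z0j; have := Pjx _ fz0; order_lra.
    have cix : c i - p x <= 2 * B.
      have := gain x; exact: gain_close_right.
    have z0nx : z0 != x by apply: contraNneq ij => e; rewrite -fz0 e.
    apply: notsingle => z fz; have BB2 : 0 <= 2 * B by order_lra.
    have [zz|//] : z = z0 \/ z = x.
      apply: near3 z0nx z0x; have := PiS z _ BB2 cix fz; have := Pi z fz; order_lra.
    by move: ij; rewrite -fz zz fz0 eqxx.
  + have Qjx y : g y = j -> p x <= p y.
      by move=> gy; apply: FQ => //; apply/eqP => fy; apply: noP; exists y.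
    have /andP[_ s2] := gsum j.
    have xB : p x - c j <= B.
      have [xc|xc] := leP (p x) (c j); first order_lra.
      move: s2; rewrite (bigD1 x) ?inE//=; apply: le_trans; rewrite lerDl.
      by apply: sumr_ge0 => y /andP[]; rewrite !inE => /eqP /Qjx; order_lra.
    have ccB : c i - c j <= 3 * B.
      have [b0|b0] := leP (p x) (c j).
        by have := gain_close_left eta0 etaB b0 (gain x); order_lra.
      by have := gain_close_right eta0 etaB (ltW b0) xB (gain x); order_lra.
    have sQj y : g y = j -> - (B + N * (3 * B)) <= p y - c j <= B + N * (3 * B).
      by apply: (@sep1 j i); [rewrite lt_eqF|order_lra].
    have sQi y : g y = i -> - (B + N * (3 * B)) <= p y - c i <= B + N * (3 * B).
      by apply: (@sep1 i j); [rewrite gt_eqF|order_lra].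
    have xj := sQj x erefl.
    have cix : c i - p x <= 7 * (N * B) by order_lra.
    have r0 : 0 <= 7 * (N * B) by order_lra.
    have PiN z : f z = i -> - eps0 <= p z - p x <= eps0.
      by move=> fz; have := PiS z _ r0 cix fz; have := Pi z fz; order_lra.
    have [w [fw wx]] : exists w, f w = i /\ w != x.
      apply: contrapT => no; apply: notsingle => z fz.
      by have [//|zx] := eqVneq z x; case: no; exists z.
    have hw := PiN w fw; have hwe : - eps <= p w - p x <= eps by order_lra.
    have Pix z : f z = i -> z = w \/ z = x.
      by move=> fz; apply: near3 wx hwe; have := PiN z fz; order_lra.
    have gwj : g w != j.
      apply/eqP => gw; have := gmin w i; rewrite gw => /(nearer_left lt) wm.
      have := fsum i; rewrite (bigD1 x) ?inE//= (bigD1 w) ?inE ?fw ?eqxx//= big1 ?addr0; first order_lra.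
      by move=> z /andP[/andP[]]; rewrite inE => /eqP /Pix[] ->; rewrite eqxx.
    have wl : - (7 * (N * (N * B))) <= p w - c (g w) <= 7 * (N * (N * B)).
      have := gmin w i => gw; have := PiS w _ r0 cix fw; have := Pi w fw => w1 w2.
      by apply/andP; split; nra.
    have clx : - (14 * (N * (N * B))) <= c (g w) - c i <= 14 * (N * (N * B)).
      by have := PiS w _ r0 cix fw; have := Pi w fw => w1 w2; order_lra.
    have E1 : N * (14 * (N * (N * B))) = 14 * (N * (N * (N * B))) by ring.
    have sQl y : g y = g w -> - (B + 14 * (N * (N * (N * B)))) <= p y - c (g w) <= B + 14 * (N * (N * (N * B))).
      move=> gy; have [gwi|gwi] := eqVneq (g w) i.
        by rewrite gwi; have := sQi y; rewrite gy => /(_ gwi); order_lra.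
      rewrite -E1; apply: (@sep1 (g w) i) => //.
      by apply: contraNneq gwi => e; apply/eqP/esym; rewrite -fw; apply: fginj; rewrite fw.
    apply: nsx; exists w; split => //.
    * split => // z gz; have [zw|//] : z = w \/ z = x.
        by apply: near3 wx hwe; have := sQj z gz; order_lra.
      by move: gwj; rewrite -zw gz eqxx.
    * split; last order_lra.
      move=> z gz; have [//|zx] : z = w \/ z = x.
        by apply: near3 wx hwe; have := sQl z gz; order_lra.
      by move: gwj; rewrite -gz zx eqxx.
    * split=> [z fz|z fz]; first by case: noP; exists z.
      have [//|li] := eqVneq (g w) i; exfalso.
      have zl : z \in cell f (g w) by rewrite inE fz.
      have r1 : 0 <= 28 * (N * (N * B)) by order_lra.
      have E2 : N * (28 * (N * (N * B))) = 28 * (N * (N * (N * B))) by ring.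
      have zx : - eps <= p z - p x <= eps.
        have : c (g w) != c i.
          by apply: contraNneq li => e; rewrite -fz -/i; apply/eqP/finj; rewrite fz.
        case: (ltgtP (c (g w)) (c i)) => // cl _.
          have up y : y \in cell f (g w) -> p y - c (g w) <= 28 * (N * (N * B)).
            rewrite inE => /eqP fy; have : p y <= p x by apply: order; rewrite fy.
            order_lra.
          have ge00 : - 0 <= \sum_(y in cell f (g w)) (p y - c (g w)) by rewrite fsum oppr0.
          by have := onesided_le r1 up ge00 zl; have := up z zl; order_lra.
        have lo y : y \in cell f (g w) -> - (28 * (N * (N * B))) <= p y - c (g w).
          rewrite inE => /eqP fy; have : p x <= p y by apply: order; rewrite fy.
          order_lra.
        have le00 : \sum_(y in cell f (g w)) (p y - c (g w)) <= 0 by rewrite fsum.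
        by have := onesided_ge r1 lo le00 zl; have := lo z zl; order_lra.
      have [zw|zz] := near3 z zx w wx hwe.
        by move: li; rewrite -fz zw fw eqxx.
      by move: li; rewrite -fz zz eqxx.
Qed.

Definition nlabels (h : 'I_n -> 'I_k) := #|h @: [set: 'I_n]%SET|.

(** Takes one representative of every old label and the other point of one splitting pair. On this
    set [g] is injective: movers become singletons, all other points keep their labels. *)
Lemma nlabels_lt : (exists x, g x != f x) -> (nlabels f < nlabels g)%N.
Proof.
move=> [x mx]; have sp := movers_split mx.
have inv (i : 'I_k) : i \in f @: [set: 'I_n]%SET -> exists y, f y = i.
  by case/imsetP => y _ ->; exists y.
pose r (i : 'I_k) : 'I_n := odflt x [pick y | f y == i].
have rE i : i \in f @: [set: 'I_n]%SET -> f (r i) = i.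
  move=> /inv[y fy]; rewrite /r; case: pickP => [z /eqP //|/(_ y)].
  by rewrite fy eqxx.
have gr y z : g y = g z -> y = z \/ (f y = g y /\ f z = g z).
  move=> e; have [gy|gy] := eqVneq (g y) (f y).
    have [gz|gz] := eqVneq (g z) (f z); first by right.
    by left; have [w [_ _ [_ H] _ _]] := movers_split gz; apply: H.
  by left; have [w [_ _ [_ H] _ _]] := movers_split gy; apply/esym/H.
have [v [fv rv sv]] : exists v, [/\ f v = f x, r (f x) != v & g v != f v \/ (forall z, g z = g v -> z = v)].
  have [w [wx Pf [fw gx] [gw _] _]] := sp.
  have [e|e] := eqVneq (r (f x)) x.
    by exists w; split; rewrite ?e 1?eq_sym//; right.
  by exists x; split => //; right.
pose T := v |: r @: (f @: [set: 'I_n]%SET).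
have rinj : {in f @: [set: 'I_n]%SET &, injective r}.
  by move=> i j ii jj e; rewrite -(rE i)// -(rE j)// e.
have vT : v \notin r @: (f @: [set: 'I_n]%SET).
  apply/imsetP => -[i ii e]; move: rv; rewrite -fv e rE// eqxx//.
have cT : #|T| = (nlabels f).+1 by rewrite /T cardsU1 vT card_in_imset.
have gv z : g z = g v -> z = v.
  case: sv => [mv|H]; last exact: H.
  by have [w [_ _ [_ H] _ _]] := movers_split mv; exact: H.
have gT : {in T &, injective g}.
  move=> y z; rewrite !in_setU1 => /predU1P[->|/imsetP[i ii ->]] /predU1P[->|/imsetP[j jj ->]] // e.
  - exact/esym/gv/esym.
  - exact/gv.
  - case: (gr _ _ e) => [//|[e1 e2]]; congr r.
    by rewrite -(rE i)// -(rE j)// e1 e2.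
rewrite -cT -(card_in_imset gT); apply: subset_leq_card.
exact: imsetS (finset.subsetT _).
Qed.

End LineStep.

Lemma sqr_le_of_sqr_le (R : realDomainType) (a b : R) : 0 <= b -> a ^+ 2 <= b ^+ 2 -> - b <= a <= b.
Proof.
move=> b0 ab; rewrite -ler_norml -[b]ger0_norm//.
by rewrite -(ler_pXn2r (n := 2)) ?nnegrE ?normr_ge0// !real_normK ?num_real.
Qed.

Section Shift.
Context (R : realType) (n k d : nat) (X : 'I_n -> 'rV[R]_d).
Variables (c : 'I_k -> 'rV[R]_d) (f g : 'I_n -> 'I_k) (eta : R).
Hypothesis eta0 : 0 <= eta.
Hypothesis st : kstep X c f g.
Hypothesis tiny : Psi X f - Psi X g <= eta ^+ 2.

Lemma sum_cell_sub (h : 'I_n -> 'I_k) i (v : 'rV[R]_d) o :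
  \sum_(y in cell h i) (X y ord0 o - v ord0 o) =
  #|cell h i|%:R * (mean X (cell h i) ord0 o - v ord0 o).
Proof.
rewrite sumrB sum_cst mulrBr; congr (_ - _).
have [->|ne] := eqVneq (cell h i) finset.set0; first by rewrite big_set0 cards0 mul0r.
by rewrite mean_coord mulrA divff ?mul1r// pnatr_eq0 cards_eq0.
Qed.

Lemma kstep_fsum i o : \sum_(y in cell f i) (X y ord0 o - c i ord0 o) = 0.
Proof.
have [->|/finset.set0Pn[x]] := eqVneq (cell f i) finset.set0; first by rewrite big_set0.
rewrite inE => /eqP <-; have [H _ _ _ _] := st.
by rewrite sum_cell_sub H subrr mulr0.
Qed.

Lemma kstep_gsum i o :
  - (n%:R * eta) <= \sum_(y in cell g i) (X y ord0 o - c i ord0 o) <= n%:R * eta.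
Proof.
apply: sqr_le_of_sqr_le; first by rewrite mulr_ge0.
rewrite sum_cell_sub !exprMn.
have H := kstep_shift i st tiny.
have cn : (#|cell g i|%:R : R) <= n%:R by rewrite ler_nat -[leqRHS]card_ord max_card.
have Hc : #|cell g i|%:R * (mean X (cell g i) ord0 o - c i ord0 o) ^+ 2 <= eta ^+ 2.
  by apply: le_trans H; rewrite ler_wpM2l//; exact: sqdist_coord.
have [e|ne] := eqVneq #|cell g i| 0%N.
  by rewrite e expr0n mul0r mulr_ge0 ?sqr_ge0.
have c1 : (1 : R) <= #|cell g i|%:R by rewrite ler1n lt0n.
rewrite expr2 -mulrA; apply: le_trans (ler_wpM2l (ler0n _ _) Hc) _.
rewrite ler_wpM2r ?sqr_ge0// expr2 (le_trans cn)// ler_peMl//.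
exact: le_trans cn.
Qed.

Lemma kstep_mean_shift i o : cell g i != finset.set0 ->
  - eta <= mean X (cell g i) ord0 o - c i ord0 o <= eta.
Proof.
move=> ne; apply: sqr_le_of_sqr_le => //.
apply: le_trans (kstep_shift i st tiny).
have c1 : (1 : R) <= #|cell g i|%:R by rewrite ler1n lt0n cards_eq0.
by apply: le_trans (sqdist_coord _ _ o) _; rewrite ler_peMl// sqdist_ge0.
Qed.

End Shift.

Section LineTrajectory.
Context (R : realType) (n k : nat) (i0 : 'I_k) (X : 'I_n -> 'rV[R]_1).
Variables (c0 : {ffun 'I_k -> 'rV[R]_1}) (eta : R).
Local Notation asg := (asg i0 X c0).
Local Notation ctr := (ctr i0 X c0).
Local Notation p := (fun x => X x ord0 ord0).
Local Notation eps := (100 * (n%:R * (n%:R * (n%:R * (n%:R * eta))))).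
Hypothesis eta0 : 0 <= eta.
Hypothesis no3 : forall a b e, a != b -> a != e -> b != e ->
  - eps <= p b - p a <= eps -> - eps <= p e - p a <= eps -> False.

Lemma sqdist1 (x y : 'rV[R]_1) : sqdist x y = (x ord0 ord0 - y ord0 ord0) ^+ 2.
Proof. by rewrite /sqdist big_ord1. Qed.

Lemma rV1_inj (x y : 'rV[R]_1) : x ord0 ord0 = y ord0 ord0 -> x = y.
Proof. by move=> e; apply/rowP => o; rewrite (ord1 o). Qed.

Lemma mean_leP (S : {set 'I_n}) (m : R) : S != finset.set0 ->
  (forall y, y \in S -> p y <= m) -> mean X S ord0 ord0 <= m.
Proof.
move=> ne H; rewrite mean_coord ler_pdivrMl ?ltr0n ?lt0n ?cards_eq0//.
by rewrite -sum_cst; exact: ler_sum.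
Qed.

Lemma mean_geP (S : {set 'I_n}) (m : R) : S != finset.set0 ->
  (forall y, y \in S -> m <= p y) -> m <= mean X S ord0 ord0.
Proof.
move=> ne H; rewrite mean_coord ler_pdivlMl ?ltr0n ?lt0n ?cards_eq0//.
by rewrite -sum_cst; exact: ler_sum.
Qed.

Lemma cell_neq0 (h : 'I_n -> 'I_k) x : cell h (h x) != finset.set0.
Proof. by apply/finset.set0Pn; exists x; rewrite inE. Qed.

Lemma asg_separated t x y : asg t x != asg t y ->
  let m := (ctr t (asg t x) ord0 ord0 + ctr t (asg t y) ord0 ord0) / 2 in
  (forall z, asg t z = asg t x -> p z <= m) /\ (forall z, asg t z = asg t y -> m <= p z) \/
  (forall z, asg t z = asg t x -> m <= p z) /\ (forall z, asg t z = asg t y -> p z <= m).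
Proof.
move=> xy m.
have ne : ctr t (asg t x) ord0 ord0 != ctr t (asg t y) ord0 ord0.
  by apply: contraNneq xy => /rV1_inj/asg_inj ->.
have mn z j := asg_min i0 X c0 t z j.
case: (ltgtP (ctr t (asg t x) ord0 ord0) (ctr t (asg t y) ord0 ord0)) ne => // lt _.
- left; split=> z zx.
    have := mn z (asg t y); rewrite zx !sqdist1 => /(nearer_left lt); rewrite /m; lra.
  have := mn z (asg t x); rewrite zx !sqdist1 => /(nearer_right lt); rewrite /m; lra.
- right; split=> z zx.
    have := mn z (asg t y); rewrite zx !sqdist1 => /(nearer_right lt); rewrite /m; lra.
  have := mn z (asg t x); rewrite zx !sqdist1 => /(nearer_left lt); rewrite /m; lra.
Qed.

(** The midpoint of the old centers separates the two clusters, hence also their means. *)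
Lemma asg_order t x y :
  ctr t.+1 (asg t x) ord0 ord0 < ctr t.+1 (asg t y) ord0 ord0 -> p x <= p y.
Proof.
move=> lt; have xy : asg t x != asg t y by apply: contraTneq lt => ->; rewrite ltxx.
have [[h1 h2]|[h1 h2]] := asg_separated xy; first exact: le_trans (h1 x erefl) (h2 y erefl).
move: lt; rewrite !ctr_mean ltNge => /negP[].
have mx := mean_geP (cell_neq0 (asg t) x) (m := (ctr t (asg t x) ord0 ord0 + ctr t (asg t y) ord0 ord0) / 2).
apply: le_trans (mx _) => [|z]; last by rewrite inE => /eqP /h1.
by apply: mean_leP (cell_neq0 _ y) _ => z; rewrite inE => /eqP /h2.
Qed.

Lemma asg_pos t x y : p x = p y -> asg t x = asg t y.
Proof. by move=> e; congr (assign _ _ _); exact: rV1_inj. Qed.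

(** Two separated clusters with equal means would have all their points at the separating midpoint,
    and coinciding points are assigned alike. *)
Lemma line_means_inj t x y :
  ctr t.+1 (asg t x) = ctr t.+1 (asg t y) -> asg t x = asg t y.
Proof.
move=> e; apply/eqP/negPn/negP => xy.
have e' : mean X (cell (asg t) (asg t x)) ord0 ord0 = mean X (cell (asg t) (asg t y)) ord0 ord0.
  by rewrite -!ctr_mean e.
have sat (S : {set 'I_n}) (m : R) z : z \in S -> (forall y, y \in S -> p y <= m) ->
    m <= mean X S ord0 ord0 -> p z = m.
  move=> zS le_m; have S0 : S != finset.set0 by apply/finset.set0Pn; exists z.
  rewrite mean_coord ler_pdivlMl ?ltr0n ?lt0n ?cards_eq0// -sum_cst => H.
  have /eqP : \sum_(y in S) (m - p y) = 0.
    apply/eqP; rewrite eq_le sumr_ge0 ?andbT; last by move=> v /le_m; rewrite subr_ge0.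
    by rewrite sumrB subr_le0.
  rewrite psumr_eq0; last by move=> v /le_m; rewrite subr_ge0.
  move=> /allP/(_ z (mem_index_enum _)); rewrite zS/= subr_eq0 => /eqP ->//.
have sat' (S : {set 'I_n}) (m : R) z : z \in S -> (forall y, y \in S -> m <= p y) ->
    mean X S ord0 ord0 <= m -> p z = m.
  move=> zS le_m; have S0 : S != finset.set0 by apply/finset.set0Pn; exists z.
  rewrite mean_coord ler_pdivrMl ?ltr0n ?lt0n ?cards_eq0// -sum_cst => H.
  have /eqP : \sum_(y in S) (p y - m) = 0.
    apply/eqP; rewrite eq_le sumr_ge0 ?andbT; last by move=> v /le_m; rewrite subr_ge0.
    by rewrite sumrB subr_le0.
  rewrite psumr_eq0; last by move=> v /le_m; rewrite subr_ge0.
  move=> /allP/(_ z (mem_index_enum _)); rewrite zS/= subr_eq0 => /eqP ->//.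
pose m := (ctr t (asg t x) ord0 ord0 + ctr t (asg t y) ord0 ord0) / 2.
have cx z : (z \in cell (asg t) (asg t x)) = (asg t z == asg t x) by rewrite inE.
have cy z : (z \in cell (asg t) (asg t y)) = (asg t z == asg t y) by rewrite inE.
suff : p x = p y by move/(asg_pos t) => exy; rewrite exy eqxx in xy.
have [[h1 h2]|[h1 h2]] := asg_separated xy.
  have h1' z : z \in cell (asg t) (asg t x) -> p z <= m by rewrite cx => /eqP; exact: h1.
  have h2' z : z \in cell (asg t) (asg t y) -> m <= p z by rewrite cy => /eqP; exact: h2.
  rewrite (sat _ _ _ (mem_cell _ x) h1'); last by rewrite e'; exact: mean_geP (cell_neq0 _ y) h2'.
  rewrite (sat' _ _ _ (mem_cell _ y) h2')//; rewrite -e'; exact: mean_leP (cell_neq0 _ x) h1'.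
have h1' z : z \in cell (asg t) (asg t x) -> m <= p z by rewrite cx => /eqP; exact: h1.
have h2' z : z \in cell (asg t) (asg t y) -> p z <= m by rewrite cy => /eqP; exact: h2.
rewrite (sat' _ _ _ (mem_cell _ x) h1'); last by rewrite e'; exact: mean_leP (cell_neq0 _ y) h2'.
by rewrite (sat _ _ _ (mem_cell _ y) h2')//; rewrite -e'; exact: mean_geP (cell_neq0 _ x) h1'.
Qed.

Lemma line_step_labels t : Psi X (asg t) - Psi X (asg t.+1) <= eta ^+ 2 ->
  Psi X (asg t.+1) < Psi X (asg t) ->
  (nlabels (asg t) < nlabels (asg t.+1))%N.
Proof.
move=> tiny dec; have st := kstep_asg_rep i0 X c0 t.
have repE x : asg_rep i0 X c0 t x = rep (ctr t.+1) (asg t x) by [].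
have repI x y : asg_rep i0 X c0 t x = asg_rep i0 X c0 t y -> asg t x = asg t y.
  by move=> e; apply: line_means_inj; rewrite -!(ctr_asg_rep i0 X c0 t) e.
(* Passing to representatives loses no label, because distinct clusters have distinct means on a
   line. *)
have -> : nlabels (asg t) = nlabels (asg_rep i0 X c0 t).
  apply/eqP; rewrite eqn_leq; apply/andP; split.
    rewrite /nlabels -(@card_in_imset _ _ (rep (ctr t.+1))).
      rewrite -imset_comp; apply: subset_leq_card; apply/fintype.subsetP => i /imsetP[x _ ->].
      by apply/imsetP; exists x.
    by move=> _ _ /imsetP[x _ ->] /imsetP[y _ ->] /repI.
  rewrite /nlabels (_ : asg_rep i0 X c0 t @: _ = rep (ctr t.+1) @: (asg t @: [set: 'I_n]%SET)).
    exact: leq_imset_card.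
  by rewrite -imset_comp.
rewrite -(Psi_asg_rep i0 X c0 t) in tiny.
have n0 (x : 'I_n) : (1 : R) <= n%:R by rewrite ler1n; exact: leq_ltn_trans (ltn_ord x).
have [x mx] : exists x, asg t.+1 x != asg_rep i0 X c0 t x.
  apply: contrapT => no; move: dec; rewrite -(Psi_asg_rep i0 X c0 t).
  rewrite (@eq_Psi _ _ _ _ X (asg t.+1) (asg_rep i0 X c0 t)) ?ltxx// => x y.
  have e z : asg t.+1 z = asg_rep i0 X c0 t z.
    by have [//|nz] := eqVneq (asg t.+1 z) (asg_rep i0 X c0 t z); case: no; exists z.
  by rewrite !e.
have [_ smin sf sg sfg] := st.
apply: (@nlabels_lt _ _ _ p (fun i => ctr t.+1 i ord0 ord0) _ _ (n%:R * eta) eta) => //.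
- by rewrite ler_peMl// (n0 x).
- by move=> i; exact: (kstep_fsum st).
- by move=> y j; rewrite -!sqdist1; exact: smin.
- by move=> y z /rV1_inj; exact: sf.
- by move=> y z /rV1_inj; exact: sfg.
- by move=> i; exact: (kstep_gsum eta0 st tiny).
- by move=> y; rewrite -!sqdist1 -lerBlDl; exact: (kstep_gain _ st).
- by move=> y z; rewrite !ctr_asg_rep; exact: asg_order.
- by move=> y z; exact: asg_pos.
- by exists x.
Qed.

(* The number of nonempty clusters, at most [k], increases at every tiny step. *)
Lemma line_window t : ~ (forall s, (t <= s <= t + k)%N ->
  Psi X (asg s) - Psi X (asg s.+1) <= eta ^+ 2 /\ Psi X (asg s.+1) < Psi X (asg s)).
Proof.
move=> H.
have inc m : (m <= k.+1)%N -> (m <= nlabels (asg (t + m)))%N.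
  elim: m => // m IH mk; have [|H1 H2] := H (t + m)%N.
    by rewrite leq_addr leq_add2l.
  rewrite addnS; apply: leq_ltn_trans (line_step_labels H1 H2).
  by apply: IH; exact: ltnW.
have := inc k.+1 (leqnn _); rewrite ltnNge => /negP[].
by rewrite -[leqRHS]card_ord; exact: max_card.
Qed.

End LineTrajectory.

(** * Tiny steps in higher dimension *)

Section BadEvents.
Context (R : realType) (n k d : nat).
Local Notation point := 'rV[R]_d.
Implicit Types (X : 'I_n -> point).

(** An approximate integer relation between few points, valid in all coordinates at once. With [tau]
    zero it is the failure of general position. *)
Definition lin_bad (S N : nat) (tau : R) X := exists z : 'I_n -> int,
  [/\ exists x, z x != 0, (#|[set x | z x != 0%R]%SET| <= S)%N,
      forall x, `|z x| <= N%:Z &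
      forall o, `|\sum_x (z x)%:~R * X x ord0 o| <= tau].

(** The normal [u] is normalized in the maximum norm, so that some coordinate has slope one. *)
Definition hyper_bad (kap : nat) (tau : R) X :=
  exists (u : 'I_d -> R) (gam : R) (S : {set 'I_n}),
  [/\ forall o, `|u o| <= 1, exists o, `|u o| = 1, (kap < #|S|)%N &
      forall x, x \in S -> `|\sum_o u o * X x ord0 o - gam| <= tau].

Definition clump_bad (kap : nat) (tau : R) X :=
  exists S : 'I_5 -> {set 'I_n},
  [/\ forall a, (0 < #|S a| <= kap)%N,
      forall a b, a != b -> [disjoint S a & S b] &
      forall a b o, `|mean X (S a) ord0 o - mean X (S b) ord0 o| <= tau].

(* [(x, (i, j))]: the point [x] leaves the label [i] for [j]. *)
Definition move := ('I_n * ('I_k * 'I_k))%type.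

(** All centers are unknowns here, so the union bound will run over a grid for k d coordinates. *)
Definition slab_bad (N : nat) (R1 w theta : R) X :=
  exists (c : 'I_k -> point) (L : seq move),
  [/\ size L = N, uniq (unzip1 L) & forall t, t \in L ->
    [/\ forall o, `|c t.2.1 ord0 o| <= R1, forall o, `|c t.2.2 ord0 o| <= R1,
        `|sqdist (X t.1) (c t.2.1) - sqdist (X t.1) (c t.2.2)| <= w &
        exists o, theta <= `|c t.2.1 ord0 o - c t.2.2 ord0 o|]].

Definition msign (j : 'I_k) (t : move) : int := (t.2.2 == j)%:Z - (t.2.1 == j)%:Z.

Definition mnet (G : seq move) (j : 'I_k) : int := \sum_(t <- G) msign j t.

(* The center of a label whose size changes by [mnet G j != 0] while its mean
   stays put. *)
Definition mcenter (G : seq move) X (j : 'I_k) : point :=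
  \row_o ((\sum_(t <- G) (msign j t)%:~R * X t.1 ord0 o) / (mnet G j)%:~R).

(** The point [b] is recorded because shifting [a] alone would also move the center [mcenter G X j];
    two points with the same move can be shifted against each other. *)
Definition pair_bad (N4 N5 : nat) (R1 w theta : R) X :=
  exists (G : seq move) (i : 'I_k) (ci : point) (L : seq ('I_n * 'I_n * 'I_k)),
  [/\ (size G <= N4)%N /\ uniq (unzip1 G), size L = N5,
      uniq (unzip1 (unzip1 L) ++ unzip2 (unzip1 L)), forall o, `|ci ord0 o| <= R1 &
      forall l, l \in L -> let: (a, b, j) := l in
      [/\ mnet G j != 0, j != i,
          ((a, (i, j)) \in G) && ((b, (i, j)) \in G) || ((a, (j, i)) \in G) && ((b, (j, i)) \in G),
          `|sqdist (X a) ci - sqdist (X a) (mcenter G X j)| <= w &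
          exists o, theta <= `|ci ord0 o - mcenter G X j ord0 o|]].

(** The partner labels are distinct, so that shifting [a] affects only its own test. This test is
    quadratic in [a] with leading coefficient bounded away from zero, which takes the place of a
    separation condition. *)
Definition single_bad (N4 N5 : nat) (R1 w : R) X :=
  exists (G : seq move) (i : 'I_k) (ci : point) (L : seq ('I_n * 'I_k)),
  [/\ (size G <= N4)%N /\ uniq (unzip1 G), size L = N5,
      uniq (unzip1 L) /\ uniq (unzip2 L), forall o, `|ci ord0 o| <= R1 &
      forall l, l \in L -> let: (a, j) := l in
      [/\ mnet G j != 0, j != i, ((a, (i, j)) \in G) || ((a, (j, i)) \in G) &
          `|sqdist (X a) ci - sqdist (X a) (mcenter G X j)| <= w]].

End BadEvents.

Lemma sqdistB (R : realType) (d : nat) (x a b : 'rV[R]_d) :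
  sqdist x a - sqdist x b =
  \sum_o (b ord0 o - a ord0 o) * (2 * x ord0 o - a ord0 o - b ord0 o).
Proof. by rewrite /sqdist -sumrB; apply: eq_bigr => o _; ring. Qed.

Lemma sqdist_approx (R : realType) (d : nat) (x a b : 'rV[R]_d) (e M : R) :
  (forall o, `|b ord0 o - a ord0 o| <= e) ->
  (forall o, `|2 * x ord0 o - a ord0 o - b ord0 o| <= M) ->
  `|sqdist x a - sqdist x b| <= d%:R * (e * M).
Proof.
move=> he hM; rewrite sqdistB; apply: le_trans (ler_norm_sum _ _ _) _.
rewrite (_ : d%:R * (e * M) = \sum_(o < d) e * M); last by rewrite sumr_const card_ord mulr_natl.
by apply: ler_sum => o _; rewrite normrM; apply: ler_pM.
Qed.

(* The pairs are matched greedily inside the fibres of [h]. *)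
Lemma pairs_or_singles (T : finType) (J : eqType) (h : T -> J) (W : {set T}) :
  exists (L : seq (T * T)) (S : {set T}),
  [/\ uniq (unzip1 L ++ unzip2 L),
      forall ab, ab \in L -> [/\ ab.1 \in W, ab.2 \in W & h ab.1 = h ab.2],
      S \subset W /\ {in S &, injective h} &
      (#|W| = (size L).*2 + #|S|)%N].
Proof.
have [m] := ubnP #|W|; elim: m W => // m IH W; rewrite ltnS => Wm.
have [inj|] := pselect ({in W &, injective h}).
  by exists [::], W; split.
move=> ninj.
have [a [b [aW bW hab ab]]] : exists a b, [/\ a \in W, b \in W, h a = h b & a != b].
  apply: contrapT => no; apply: ninj => a b aW bW hab.
  by have [//|ab] := eqVneq a b; case: no; exists a, b.
have bWa : b \in W :\ a by rewrite !inE eq_sym ab.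
have cW : #|W| = (#|W :\ a :\ b|).+2 by rewrite (cardsD1 a W) aW (cardsD1 b (W :\ a)) bWa.
have [|L [S [uL hL [SW hS] cL]]] := IH (W :\ a :\ b).
  by rewrite cW in Wm; apply: leq_trans Wm.
have sub x : x \in W :\ a :\ b -> x \in W by rewrite !inE => /and3P[].
have notL x : x \in unzip1 L ++ unzip2 L -> x \in W :\ a :\ b.
  by rewrite mem_cat => /orP[] /mapP[y /hL[h1 h2 _] ->].
have aL : a \notin unzip1 L ++ unzip2 L.
  by apply/negP => /notL; rewrite !inE eqxx andbF.
have bL : b \notin unzip1 L ++ unzip2 L.
  by apply/negP => /notL; rewrite !inE eqxx.
exists ((a, b) :: L), S; split.
- rewrite /= mem_cat inE orbCA -mem_cat negb_or ab aL /=.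
  by rewrite -cat1s uniq_catCA /= bL.
- move=> x; rewrite inE => /predU1P[->//|/hL[h1 h2 h3]].
  by split => //; exact: sub.
- by split => //; apply/fintype.subsetP => x /(fintype.subsetP SW)/sub.
- by rewrite cW cL /= doubleS !addSn.
Qed.

(** The bisector, scaled by the largest coordinate difference [B] of the two centers. *)
Lemma hyperplane (R : realType) (d : nat) (a b : 'rV[R]_d) : a != b ->
  exists (u : 'I_d -> R) (gam B : R),
  [/\ 0 < B, forall o, `|b ord0 o - a ord0 o| <= B,
      exists o, B = `|b ord0 o - a ord0 o|,
      (forall o, `|u o| <= 1) /\ exists o, `|u o| = 1 &
      forall x, sqdist x a - sqdist x b = 2 * B * (\sum_o u o * x ord0 o - gam)].
Proof.
move=> ab.
have [ho1 Ho1] : exists o, b ord0 o - a ord0 o != 0.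
  apply: contrapT => no; move/eqP: ab; apply; apply/rowP => o.
  apply/esym/eqP; rewrite -subr_eq0; apply/negPn/negP => H; by apply: no; exists o.
pose o2 := [arg max_(o > ho1) `|b ord0 o - a ord0 o|]%O.
have max_o2 o : `|b ord0 o - a ord0 o| <= `|b ord0 o2 - a ord0 o2|.
  by rewrite /o2; case: arg_maxP => // o' _ H; exact: H.
set B := `|b ord0 o2 - a ord0 o2| in max_o2 *.
have B0 : 0 < B by apply: lt_le_trans (max_o2 ho1); rewrite normr_gt0.
exists (fun o => (b ord0 o - a ord0 o) / B).
exists ((\sum_o (b ord0 o - a ord0 o) * (a ord0 o + b ord0 o)) / (2 * B)), B.
have absB : `|B| = B by rewrite gtr0_norm.
split => //; first by exists o2.
- split=> [ o|]; first by rewrite normrM normfV absB ler_pdivrMr// mul1r.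
  by exists o2; rewrite normrM normfV absB -/B divff// gt_eqF.
- move=> x; rewrite sqdistB mulrBr mulr_sumr mulrCA divff ?mulr1; last by rewrite mulf_neq0 ?gt_eqF// ltr0n.
  rewrite -sumrB; apply: eq_bigr => o _; field; rewrite gt_eqF//.
Qed.

(** * Close and far pairs of centers in one tiny step *)

Section Step.
Context (R : realType) (n k d : nat) (X : 'I_n -> 'rV[R]_d).
Variables (c : 'I_k -> 'rV[R]_d) (f g : 'I_n -> 'I_k) (eta theta R0 : R).
Hypothesis eta0 : 0 <= eta.
Hypothesis st : kstep X c f g.
Hypothesis tiny : Psi X f - Psi X g <= eta ^+ 2.
Hypothesis dn : (d <= n)%N.
Hypothesis XR : forall x o, `|X x ord0 o| <= R0.
Hypothesis theta0 : 0 <= theta.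
Hypothesis thetaE : theta ^+ 2 = R0 * eta.
Hypothesis etaR : 4 * (n%:R * (n%:R * eta)) <= R0.

Let kap := (10 * d)%N.
Hypothesis no_hyper : ~ hyper_bad kap (2 * (n%:R * (n%:R * theta))) X.

Definition movers : {set 'I_n} := [set x | g x != f x].

Definition far_apart x : bool :=
  [exists o, theta <= `|c (f x) ord0 o - c (g x) ord0 o|].

Lemma mover_neq x : x \in movers -> c (f x) != c (g x).
Proof.
by rewrite inE; apply: contraNneq => e; case: st => _ _ _ _ /(_ _ _ e) ->.
Qed.

Lemma n_ge1 (x : 'I_n) : (1 : R) <= n%:R.
Proof. by rewrite ler1n; exact: leq_ltn_trans (ltn_ord x). Qed.

Lemma eta_le_R0 (x : 'I_n) : 4 * (n%:R * eta) <= R0 /\ eta <= R0.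
Proof.
have n1 := n_ge1 x; have h1 : n%:R * eta <= n%:R * (n%:R * eta).
  by rewrite ler_wpM2l// ler_peMl.
have h2 : eta <= n%:R * eta by rewrite ler_peMl.
move: etaR eta0; lra.
Qed.

(** Replacing a center by an approximation within n eta thus costs at most half of the separation
    [theta]. *)
Lemma n_eta_theta (x : 'I_n) : 2 * (n%:R * eta) <= theta.
Proof.
rewrite -(ler_pXn2r (n := 2)) ?nnegrE ?mulr_ge0// thetaE.
have -> : (2 * (n%:R * eta)) ^+ 2 = (4 * (n%:R * (n%:R * eta))) * eta by ring.
by rewrite ler_wpM2r.
Qed.

Lemma eta_le_theta (x : 'I_n) : eta <= theta.
Proof.
apply: le_trans (n_eta_theta x); have n1 := n_ge1 x.
have h2 : eta <= n%:R * eta by rewrite ler_peMl.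
move: eta0; lra.
Qed.

Lemma mean_le (S : {set 'I_n}) o : S != finset.set0 -> `|mean X S ord0 o| <= R0.
Proof.
move=> ne; have S0 : (0 : R) < #|S|%:R by rewrite ltr0n lt0n cards_eq0.
rewrite mean_coord normrM normfV (gtr0_norm S0) ler_pdivrMl//.
rewrite -sum_cst; apply: le_trans (ler_norm_sum _ _ _) _; exact: ler_sum.
Qed.

Lemma ctr_f_le x o : `|c (f x) ord0 o| <= 2 * R0.
Proof.
have [H _ _ _ _] := st; rewrite H.
have := mean_le o (cell_neq0 f x); have := normr_ge0 (mean X (cell f (f x)) ord0 o); lra.
Qed.

Lemma shift_le i o : cell g i != finset.set0 ->
  `|mean X (cell g i) ord0 o - c i ord0 o| <= eta.
Proof. by move=> ne; rewrite ler_norml; exact: (kstep_mean_shift eta0 st tiny). Qed.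

Lemma ctr_g_le x o : `|c (g x) ord0 o| <= 2 * R0.
Proof.
have ne := cell_neq0 g x.
have := mean_le o ne; have := shift_le o ne; have [_] := eta_le_R0 x.
by rewrite !ler_norml => ? /andP[? ?] /andP[? ?]; apply/andP; split; lra.
Qed.

Lemma gsum_le i o : `|\sum_(y in cell g i) (X y ord0 o - c i ord0 o)| <= n%:R * eta.
Proof. by rewrite ler_norml; exact: (kstep_gsum eta0 st tiny). Qed.

Lemma same_sign (S : {set 'I_n}) (F : 'I_n -> R) y : y \in S ->
  (forall x, x \in S -> 0 <= F x) \/ (forall x, x \in S -> F x <= 0) ->
  `|F y| <= `|\sum_(x in S) F x|.
Proof.
move=> yS [H|H].
  rewrite !ger0_norm ?H ?sumr_ge0// (bigD1 y)//= lerDl.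
  by apply: sumr_ge0 => x /andP[xS _]; exact: H.
have H' x : x \in S -> 0 <= - F x by rewrite oppr_ge0; exact: H.
rewrite -normrN -[leRHS]normrN -sumrN !ger0_norm ?H' ?sumr_ge0// (bigD1 y)//= lerDl.
by apply: sumr_ge0 => x /andP[xS _]; exact: H'.
Qed.

Section Pair.
Variables (i j : 'I_k) (u : 'I_d -> R) (gam B : R).
Hypothesis B0 : 0 < B.
Hypothesis hB : forall o, `|c j ord0 o - c i ord0 o| <= B.
Hypothesis u1 : forall o, `|u o| <= 1.
Hypothesis hE : forall x, sqdist x (c i) - sqdist x (c j) = 2 * B * (\sum_o u o * x ord0 o - gam).

(** The signed distances of the cluster from the bisector all have one sign. Their sum is small,
    because the center lies within n B of the bisector and the points deviate little from it in
    total; so each distance is small. *)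
Lemma cell_flat y e : B <= theta -> (e == i) || (e == j) -> g y = e ->
  `|\sum_o u o * X y ord0 o - gam| <= 2 * (n%:R * (n%:R * theta)).
Proof.
move=> Bt eij gye.
pose F x := \sum_o u o * X x ord0 o - gam.
have n1 := n_ge1 y.
have dnR : (d%:R : R) <= n%:R by rewrite ler_nat.
have sq : sqdist (c i) (c j) <= d%:R * B ^+ 2.
  by rewrite sqdistC; exact: sqdist_le.
have ce : `|\sum_o u o * c e ord0 o - gam| <= n%:R * B.
  have B2 : 0 < 2 * B by rewrite mulr_gt0.
  rewrite -(ler_pM2l B2) -[X in X * _](gtr0_norm B2) -normrM -hE.
  have -> : `|sqdist (c e) (c i) - sqdist (c e) (c j)| = sqdist (c i) (c j).
    case/orP: eij => /eqP ->; rewrite sqdistxx.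
      by rewrite sub0r normrN ger0_norm// sqdist_ge0.
    by rewrite subr0 (sqdistC (c j)) ger0_norm// sqdist_ge0.
  apply: le_trans sq _; rewrite expr2 !mulrA ler_pM2r//.
  have : d%:R * B <= n%:R * B by rewrite ler_pM2r.
  have : 0 <= n%:R * B by rewrite mulr_ge0// ltW.
  lra.
have ye : y \in cell g e by rewrite inE gye.
have [_ gmin _ _ _] := st.
have B2 : 0 < 2 * B by rewrite mulr_gt0.
have sgn : (forall x, x \in cell g e -> 0 <= F x) \/ (forall x, x \in cell g e -> F x <= 0).
  case/orP: (eij) => /eqP ->; [right|left] => x; rewrite inE => /eqP gx.
    by rewrite -(pmulr_rle0 _ B2) -hE subr_le0 -gx gmin.
  by rewrite -(pmulr_rge0 _ B2) -hE subr_ge0 -gx gmin.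
apply: le_trans (same_sign ye sgn) _.
have -> : \sum_(x in cell g e) F x =
    \sum_o u o * \sum_(x in cell g e) (X x ord0 o - c e ord0 o) +
    #|cell g e|%:R * (\sum_o u o * c e ord0 o - gam).
  under [X in _ = X + _]eq_bigr => o _ do rewrite mulr_sumr.
  rewrite exchange_big/= -sum_cst -big_split/=; apply: eq_bigr => x _.
  rewrite /F addrA; congr (_ - _); rewrite -big_split/=.
  by apply: eq_bigr => o _; ring.
apply: le_trans (ler_normD _ _) _.
have h1 : `|\sum_o u o * \sum_(x in cell g e) (X x ord0 o - c e ord0 o)| <= n%:R * (n%:R * eta).
  apply: le_trans (ler_norm_sum _ _ _) _.
  apply: (@le_trans _ _ (\sum_(o < d) n%:R * eta)).
    apply: ler_sum => o _; rewrite normrM -[leRHS]mul1r; apply: ler_pM => //.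
    exact: gsum_le.
  by rewrite sumr_const card_ord -(mulr_natl _ d) ler_wpM2r// mulr_ge0.
have h2 : `|#|cell g e|%:R * (\sum_o u o * c e ord0 o - gam)| <= n%:R * (n%:R * theta).
  rewrite normrM; apply: ler_pM => //.
    by rewrite normr_nat ler_nat -[leqRHS]card_ord max_card.
  by apply: le_trans ce _; rewrite ler_wpM2l.
have h3 : n%:R * (n%:R * eta) <= n%:R * (n%:R * theta).
  by rewrite !ler_wpM2l// (eta_le_theta y).
apply: le_trans (lerD h1 h2) _; lra.
Qed.

(** The gain, at most eta^2, is 2 B times the distance from the normalized bisector, and B >=
    theta. *)
Lemma mover_flat x : theta <= B -> (f x == i) && (g x == j) || (f x == j) && (g x == i) ->
  `|\sum_o u o * X x ord0 o - gam| <= 2 * (n%:R * (n%:R * theta)).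
Proof.
move=> tB fg.
have B2 : 0 < 2 * B by rewrite mulr_gt0.
have H : `|sqdist (X x) (c i) - sqdist (X x) (c j)| <= eta ^+ 2.
  have h1 := kstep_gain_ge0 x st; have h2 := kstep_gain x st tiny.
  case/orP: fg => /andP[/eqP fx /eqP gx]; last rewrite distrC; rewrite -fx -gx ger0_norm//.
rewrite -(ler_pM2l B2) -[X in X * _](gtr0_norm B2) -normrM -hE; apply: le_trans H _.
have n1 := n_ge1 x; have et := eta_le_theta x.
have h3 : theta <= n%:R * (n%:R * theta).
  apply: (@le_trans _ _ (n%:R * theta)); first by rewrite ler_peMl.
  by rewrite ler_peMl// mulr_ge0.
rewrite expr2; apply: ler_pM => //; move: theta0 B0; lra.
Qed.
End Pair.

Lemma close_cells i j : c i != c j -> (forall o, `|c i ord0 o - c j ord0 o| < theta) ->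
  (#|[set y | (g y == i) || (g y == j)]%SET| <= kap)%N.
Proof.
move=> ij close; rewrite leqNgt; apply/negP => big; apply: no_hyper.
have [u [gam [B [B0 hB [wo eB] [u1 u2] hE]]]] := hyperplane ij.
exists u, gam, [set y | (g y == i) || (g y == j)]%SET; split => // x; rewrite inE => gx.
have Bt : B <= theta by rewrite eB distrC; exact/ltW.
exact: (cell_flat B0 hB u1 hE Bt gx).
Qed.

Lemma pair_movers i j : i != j ->
  (#|[set x in movers | (f x == i) && (g x == j) || (f x == j) && (g x == i)]%SET| <= kap)%N.
Proof.
move=> ij; set S := finset _.
have [->|/finset.set0Pn[x0]] := eqVneq S finset.set0; first by rewrite cards0.
rewrite inE => /andP[x0M fg0].
have cij : c i != c j.
  have := mover_neq x0M; case/orP: fg0 => /andP[/eqP -> /eqP ->]//.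
  by rewrite eq_sym.
rewrite leqNgt; apply/negP => big; apply: no_hyper.
have [u [gam [B [B0 hB [wo eB] [u1 u2] hE]]]] := hyperplane cij.
exists u, gam, S; split => // x; rewrite inE => /andP[_ fg].
have [Bt|/ltW tB] := leP B theta; last exact: (mover_flat B0 hE tB fg).
have gx : (g x == i) || (g x == j) by case/orP: fg => /andP[_ ->]; rewrite ?orbT.
exact: (cell_flat B0 hB u1 hE Bt gx).
Qed.

End Step.

Lemma card_bigcup_le (T J : finType) (D : {set J}) (F : J -> {set T}) m :
  (forall j, j \in D -> #|F j| <= m)%N ->
  (#|(\bigcup_(j in D) F j)%SET| <= #|D| * m)%N.
Proof.
move=> H; rewrite -sum_nat_const.
apply: (@big_ind2 _ _ (fun (A : {set T}) (s : nat) => #|A| <= s)%N).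
- by rewrite cards0.
- by move=> A a B b hA hB; apply: leq_trans (leq_card_setU A B) _; exact: leq_add.
- by move=> j jD; exact: H.
Qed.

(** * Counting the moves at a label *)

Section Counting.
Context (n k : nat) (f g : 'I_n -> 'I_k) (sep : pred 'I_n) (q d : nat).
Local Notation M := (movers f g).

Definition degree (j : 'I_k) : nat := #|[set x in M | (f x == j) || (g x == j)]|.

Lemma sum_degree : (\sum_j degree j <= 2 * #|M|)%N.
Proof.
have E j : degree j = (\sum_(x in M) ((f x == j) || (g x == j) : nat))%N.
  rewrite /degree -sum1_card [LHS](eq_bigl (fun x => (x \in M) && ((f x == j) || (g x == j)))).
    by rewrite big_mkcondr.
  by move=> x; rewrite !inE.
under eq_bigr do rewrite E.
rewrite exchange_big/= mulnC -sum_nat_const; apply: leq_sum => x _.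
apply: (@leq_trans (\sum_j ((j == f x) + (j == g x)))%N).
  apply: leq_sum => j _; rewrite !(eq_sym j).
  by case: (f x == j); case: (g x == j).
by rewrite big_split/= -!big_mkcond/= !big_pred1_eq.
Qed.

Hypothesis q2 : (k <= q * q)%N.
Hypothesis q0 : (0 < q)%N.
Hypothesis d0 : (0 < d)%N.
Hypothesis fewM : (#|M| <= 18 * k * d)%N.
Hypothesis few_close : forall i,
  (#|[set x in M | ~~ sep x && ((f x == i) || (g x == i))]%SET| <= 50 * d)%N.
Hypothesis few_pair : forall i j, i != j ->
  (#|[set x in M | (f x == i) && (g x == j) || (f x == j) && (g x == i)]%SET| <= 10 * d)%N.

(* At most [q / 10] labels have a degree above [400 q d]; each takes at most
   [10 d] moves with [i], which leaves [349 q d] of them. *)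
Lemma dense_star i : (400 * q * d < degree i)%N ->
  exists W : {set 'I_n}, [/\ (174 * q * d <= #|W|)%N, {subset W <= M},
    forall x, x \in W -> sep x &
    (forall x, x \in W -> f x = i /\ degree (g x) <= 400 * q * d)%N \/
    (forall x, x \in W -> g x = i /\ degree (f x) <= 400 * q * d)%N].
Proof.
set s := (400 * q * d)%N => di.
pose W1 := [set x in M | [&& sep x, f x == i & (degree (g x) <= s)%N]]%SET.
pose W2 := [set x in M | [&& sep x, g x == i & (degree (f x) <= s)%N]]%SET.
have [W1b|W1s] := leqP (174 * q * d) #|W1|.
  exists W1; split => //.
  - by move=> x; rewrite inE => /andP[].
  - by move=> x; rewrite inE => /and4P[].
  - by left => x; rewrite inE => /and4P[_ _ /eqP -> ->].
have [W2b|W2s] := leqP (174 * q * d) #|W2|.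
  exists W2; split => //.
  - by move=> x; rewrite inE => /andP[].
  - by move=> x; rewrite inE => /and4P[].
  - by right => x; rewrite inE => /and4P[_ _ /eqP -> ->].
pose D := [set j | (s < degree j)%N]%SET.
pose P j := [set x in M | (f x == i) && (g x == j) || (f x == j) && (g x == i)]%SET.
pose C := [set x in M | ~~ sep x && ((f x == i) || (g x == i))]%SET.
have cov : [set x in M | (f x == i) || (g x == i)]%SET \subset
    C :|: (\bigcup_(j in D :\ i) P j)%SET :|: W1 :|: W2.
  apply/fintype.subsetP => x; rewrite inE => /andP[xM fg]; rewrite !finset.in_setU.
  have fgx : g x != f x by move: xM; rewrite inE.
  have -> : (x \in C) = ~~ sep x by rewrite finset.in_set xM fg andbT.
  have -> : (x \in W1) = [&& sep x, f x == i & (degree (g x) <= s)%N] by rewrite finset.in_set xM.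
  have -> : (x \in W2) = [&& sep x, g x == i & (degree (f x) <= s)%N] by rewrite finset.in_set xM.
  case: (sep x) => //=.
  case/orP: fg => [/eqP fx|/eqP gx].
    case: (leqP (degree (g x)) s) => Hs; first by rewrite fx eqxx !orbT.
    suff -> : x \in (\bigcup_(j in D :\ i) P j)%SET by [].
    apply/finset.bigcupP; exists (g x); first by rewrite !inE -fx fgx Hs.
    by rewrite inE xM fx !eqxx.
  case: (leqP (degree (f x)) s) => Hs; first by rewrite gx eqxx !orbT.
  suff -> : x \in (\bigcup_(j in D :\ i) P j)%SET by [].
  apply/finset.bigcupP; exists (f x); first by rewrite !inE -gx eq_sym fgx Hs.
  by rewrite inE xM gx !eqxx orbT.
have := leq_trans di (subset_leq_card cov); move=> big.
have h1 := (leq_card_setU (C :|: (\bigcup_(j in D :\ i) P j)%SET :|: W1) W2).1.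
have h2 := (leq_card_setU (C :|: (\bigcup_(j in D :\ i) P j)%SET) W1).1.
have h3 := (leq_card_setU C (\bigcup_(j in D :\ i) P j)%SET).1.
have h4 : (#|(\bigcup_(j in D :\ i) P j)%SET| <= #|D :\ i| * (10 * d))%N.
  by apply: card_bigcup_le => j; rewrite !inE => /andP[ji _]; apply: few_pair; rewrite eq_sym.
have h5 : (#|D :\ i| <= #|D|)%N by apply: subset_leq_card; exact: finset.subsetDl.
have h6 := few_close i; rewrite -/C in h6.
have h7 : (#|D| * s <= 2 * (18 * k * d))%N.
  apply: leq_trans (leq_trans sum_degree _); last by rewrite leq_mul2l fewM.
  rewrite -sum_nat_const [leqRHS](bigID (mem D))/=; apply: leq_trans (leq_addr _ _).
  by apply: leq_sum => j; rewrite inE => /ltnW.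
(* Each label in [D] has degree above 400 q d, while the degrees sum to at most 36 k d <= 36 q (q
   d). *)
have h8 : (#|D| * 10 <= q)%N.
  have : (#|D| * 400 * (q * d) <= 36 * q * (q * d))%N.
    apply: (@leq_trans (2 * (18 * k * d))%N); first by move: h7; rewrite /s !mulnA.
    have -> : (2 * (18 * k * d) = 36 * d * k)%N by lia.
    have -> : (36 * q * (q * d) = 36 * d * (q * q))%N by lia.
    by rewrite leq_mul2l q2 orbT.
  by rewrite leq_pmul2r ?muln_gt0 ?q0//; lia.
have h9 : (#|D :\ i| * (10 * d) <= q * d)%N.
  by rewrite mulnA leq_pmul2r//; apply: leq_trans h8; rewrite leq_mul2r h5 orbT.
have h10 : (d <= q * d)%N by rewrite leq_pmull.
(* At most 50 d moves between close centers, q d with dense labels and fewer than 174 q d in each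
   direction: together fewer than 400 q d. *)
exfalso; move: big h1 h2 h3 h4 h6 W1s W2s h9 h10; rewrite /s -!mulnA.
move: (q * d)%N => qd.
lia.
Qed.

End Counting.

Section Sparse.
Context (R : realType) (n k d : nat) (X : 'I_n -> 'rV[R]_d).
Variables (c : 'I_k -> 'rV[R]_d) (f g : 'I_n -> 'I_k) (eta theta R0 : R) (q : nat).
Hypothesis eta0 : 0 <= eta.
Hypothesis st : kstep X c f g.
Hypothesis tiny : Psi X f - Psi X g <= eta ^+ 2.
Hypothesis dn : (d <= n)%N.
Hypothesis XR : forall x o, `|X x ord0 o| <= R0.
Hypothesis theta0 : 0 <= theta.
Hypothesis thetaE : theta ^+ 2 = R0 * eta.
Hypothesis etaR : 4 * (n%:R * (n%:R * eta)) <= R0.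
Hypothesis no_hyper : ~ hyper_bad (10 * d) (2 * (n%:R * (n%:R * theta))) X.
Hypothesis no_clump : ~ clump_bad (10 * d) (4 * theta) X.
Hypothesis no_slab : ~ slab_bad k (8 * k * d) (2 * R0) (eta ^+ 2) theta X.
Local Notation M := (movers f g).
Local Notation sep := (fun x => far_apart c f g theta x).

Lemma closeP x : ~~ sep x -> forall o, `|c (f x) ord0 o - c (g x) ord0 o| < theta.
Proof. by move=> /existsPn H o; rewrite ltNge; exact: H. Qed.

(** A mover arriving from a close center lies in the new cluster of [i], which is small by
    [close_cells]. *)
Lemma close_in i : (#|[set x in M | ~~ sep x && (g x == i)]%SET| <= 10 * d)%N /\
  forall x, x \in M -> ~~ sep x -> g x = i -> (#|cell g i| <= 10 * d)%N.
Proof.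
have H x : x \in M -> ~~ sep x -> g x = i -> (#|cell g i| <= 10 * d)%N.
  move=> xM xs gx.
  apply: leq_trans (close_cells eta0 st tiny dn theta0 thetaE etaR no_hyper (mover_neq st xM) (closeP xs)).
  by apply: subset_leq_card; apply/fintype.subsetP => y; rewrite !inE gx => ->; rewrite orbT.
split => //.
have [->|/finset.set0Pn[x]] := eqVneq [set x in M | ~~ sep x && (g x == i)]%SET finset.set0.
  by rewrite cards0.
rewrite finset.in_set => /and3P[xM xs /eqP gx]; apply: leq_trans (H x xM xs gx).
by apply: subset_leq_card; apply/fintype.subsetP => y; rewrite finset.in_set => /and3P[_ _]; rewrite inE.
Qed.

(** The targets of short moves from [i] are small clusters with means within 2 theta of [c i]. Five
    of them would be a clump, so there are at most four targets with 10 d points each. *)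
Lemma close_source i : (#|[set x in M | ~~ sep x && (f x == i)]%SET| <= 40 * d)%N.
Proof.
set S := finset _; pose T := (g @: S)%SET.
have T4 : (#|T| <= 4)%N.
  rewrite leqNgt; apply/negP => T5; apply: no_clump.
  pose w (a : 'I_5) : 'I_k := enum_val (widen_ord T5 a).
  have winj : injective w.
    by move=> a b /enum_val_inj/(congr1 val)/= e; exact: val_inj.
  have wT a : exists2 x, x \in S & g x = w a.
    have : w a \in T by exact: enum_valP.
    by case/imsetP => x xS ->; exists x.
  have ne a : cell g (w a) != finset.set0.
    by have [x _ gx] := wT a; apply/finset.set0Pn; exists x; rewrite inE gx.
  have near a o : `|mean X (cell g (w a)) ord0 o - c i ord0 o| <= 2 * theta.
    have [x xS gx] := wT a; move: xS; rewrite finset.in_set => /and3P[xM xs /eqP fx].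
    have := closeP xs o; have := shift_le eta0 st tiny o (ne a).
    have := eta_le_theta eta0 theta0 thetaE etaR x.
    rewrite fx gx ltr_norml !ler_norml => ? /andP[? ?] /andP[? ?].
    by apply/andP; split; lra.
  exists (fun a => cell g (w a)); split.
  - move=> a; rewrite lt0n cards_eq0 ne /=.
    have [x xS gx] := wT a; move: xS; rewrite finset.in_set => /and3P[xM xs _].
    by have [_] := close_in (w a); apply; [exact: xM| |].
  - move=> a b ab; rewrite -setI_eq0; apply/eqP/finset.setP => x; rewrite !inE.
    apply/negbTE/negP => /andP[/eqP ga /eqP gb]; move/eqP: ab; apply; apply: winj.
    by rewrite -ga -gb.
  - move=> a b o; have := near a o; have := near b o.
    rewrite !ler_norml => /andP[? ?] /andP[? ?]; apply/andP; split; lra.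
have sub : S \subset (\bigcup_(j in T) [set x in M | ~~ sep x && (g x == j)])%SET.
  apply/fintype.subsetP => x xS; apply/finset.bigcupP; exists (g x); first exact: imset_f.
  by move: xS; rewrite !finset.in_set eqxx andbT => /and3P[-> ->].
apply: leq_trans (subset_leq_card sub) _.
apply: leq_trans (card_bigcup_le (m := 10 * d) _) _.
  by move=> j _; have [] := close_in j.
apply: (@leq_trans (4 * (10 * d))%N); first by rewrite leq_mul2r T4 orbT.
by rewrite mulnA.
Qed.

Lemma few_close i :
  (#|[set x in M | ~~ sep x && ((f x == i) || (g x == i))]%SET| <= 50 * d)%N.
Proof.
have sub : [set x in M | ~~ sep x && ((f x == i) || (g x == i))]%SET \subset
   ([set x in M | ~~ sep x && (f x == i)] :|: [set x in M | ~~ sep x && (g x == i)])%SET.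
  apply/fintype.subsetP => x; rewrite finset.in_setU !finset.in_set => /and3P[-> ->].
  by case/orP => ->; rewrite ?orbT.
apply: leq_trans (subset_leq_card sub) _.
apply: leq_trans (leq_card_setU _ _).1 _.
by have := close_source i; have [] := close_in i; lia.
Qed.

(** 18 = 8 + 10: more than 8 k d far moves would be a slab event, and each label receives at most 10
    d short moves. *)
Lemma few_movers : (#|M| <= 18 * k * d)%N.
Proof.
pose S := [set x in M | sep x]%SET.
have Ssmall : (#|S| <= 8 * k * d)%N.
  rewrite leqNgt; apply/negP => big; apply: no_slab.
  pose F x : move n k := (x, (f x, g x)).
  exists c, (take (8 * k * d) [seq F x | x <- enum S]).
  have sz : (8 * k * d <= size [seq F x | x <- enum S])%N by rewrite size_map -cardE ltnW.
  split.
  - by rewrite size_take_min; apply/minn_idPl.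
  - rewrite /unzip1 map_take take_uniq// -map_comp (@eq_map _ _ _ id) ?map_id ?enum_uniq//.
  - move=> t /mem_take/mapP[x]; rewrite mem_enum finset.in_set => /andP[xM xs] ->/=.
    split.
    + exact: ctr_f_le st XR x.
    + exact: ctr_g_le eta0 st tiny XR etaR x.
    + by rewrite ger0_norm ?(kstep_gain_ge0 _ st)// (kstep_gain x st tiny).
    + exact/existsP.
have cov : M \subset S :|: (\bigcup_(j in [set: 'I_k]) [set x in M | ~~ sep x && (g x == j)])%SET.
  apply/fintype.subsetP => x xM; rewrite finset.in_setU finset.in_set xM /=.
  case: (boolP (sep x)) => //= xs; apply/finset.bigcupP; exists (g x); first by rewrite inE.
  by rewrite finset.in_set xM xs eqxx.
apply: leq_trans (subset_leq_card cov) _; apply: leq_trans (leq_card_setU _ _).1 _.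
have h : (#|(\bigcup_(j in [set: 'I_k]) [set x in M | ~~ sep x && (g x == j)])%SET| <= k * (10 * d))%N.
  rewrite -[X in (_ <= X * _)%N]card_ord -cardsT; apply: card_bigcup_le => j _.
  by have [] := close_in j.
by apply: leq_trans (leq_add Ssmall h) _; lia.
Qed.

End Sparse.

(** * Centers and integer relations read off from the moves *)

Section Incidence.
Context (R : realType) (n k d : nat) (X : 'I_n -> 'rV[R]_d).
Variables (f g : 'I_n -> 'I_k).
Local Notation M := (movers f g).

Definition incid (j : 'I_k) (x : 'I_n) : int := (g x == j)%:Z - (f x == j)%:Z.

Definition moves : seq (move n k) := [seq (x, (f x, g x)) | x <- enum M].

Lemma uniq_moves : uniq (unzip1 moves).
Proof. by rewrite /unzip1 -map_comp (@eq_map _ _ _ id) ?map_id ?enum_uniq. Qed.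

Lemma incid_stay j x : x \notin M -> incid j x = 0.
Proof. by rewrite inE negbK /incid => /eqP ->; rewrite subrr. Qed.

Lemma sum_moves (V : zmodType) j (F : int -> 'I_n -> V) : (forall x, F 0 x = 0) ->
  \sum_(t <- moves) F (msign j t) t.1 = \sum_x F (incid j x) x.
Proof.
move=> F0; rewrite big_map big_enum/= [RHS](bigID (mem M))/= [X in _ = _ + X]big1 ?addr0//.
by move=> x /(incid_stay j) ->.
Qed.

Lemma mnet_moves j : mnet moves j = \sum_x incid j x.
Proof. exact: (sum_moves j (F := fun z _ => z)). Qed.

Lemma incid_supp j : #|[set x | incid j x != 0%R]%SET| = degree f g j.
Proof.
apply: eq_card => x; rewrite !inE /incid.
have [->|ne] := eqVneq (g x) (f x); first by rewrite subrr eqxx.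
case: (g x =P j) => [gj|_]; case: (f x =P j) => [fj|_] //=.
by rewrite gj fj eqxx in ne.
Qed.

Lemma incid_le j x : `|incid j x| <= 1.
Proof. by rewrite /incid; case: (g x == j); case: (f x == j). Qed.

Lemma sum_incid j (F : 'I_n -> R) :
  \sum_x (incid j x)%:~R * F x = \sum_(x in cell g j) F x - \sum_(x in cell f j) F x.
Proof.
rewrite (big_mkcond (fun x => x \in cell g j)) (big_mkcond (fun x => x \in cell f j)) -sumrB; apply: eq_bigr => x _.
rewrite !inE /incid; case: (g x == j); case: (f x == j) => /=;
  by rewrite ?subrr ?subr0 ?sub0r ?mul0r ?mul1r ?mulN1r ?mulNr ?mul1r.
Qed.

End Incidence.

Section SparseStep.
Context (R : realType) (n k d : nat) (X : 'I_n -> 'rV[R]_d).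
Variables (c : 'I_k -> 'rV[R]_d) (f g : 'I_n -> 'I_k) (eta theta R0 : R) (q : nat).
Hypothesis eta0 : 0 <= eta.
Hypothesis st : kstep X c f g.
Hypothesis tiny : Psi X f - Psi X g <= eta ^+ 2.
Local Notation M := (movers f g).
Local Notation G := (moves f g).
Local Notation w := (8 * (n%:R * (n%:R * (R0 * eta)))).

(** The deviations from [c j] sum to zero over the old cluster and to at most n eta over the new
    one; the difference involves only the points that moved. *)
Lemma incid_relation j o :
  `|\sum_x (incid f g j x)%:~R * X x ord0 o - (\sum_x incid f g j x)%:~R * c j ord0 o|
  <= n%:R * eta.
Proof.
have -> : \sum_x (incid f g j x)%:~R * X x ord0 o - (\sum_x incid f g j x)%:~R * c j ord0 o =
    \sum_(x in cell g j) (X x ord0 o - c j ord0 o).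
  transitivity (\sum_x (incid f g j x)%:~R * (X x ord0 o - c j ord0 o)).
    rewrite rmorph_sum/= mulr_suml -sumrB.
    by apply: eq_bigr => x _; ring.
  by rewrite (sum_incid _ _ _ (fun x => X x ord0 o - c j ord0 o)) (kstep_fsum st) subr0.
exact: (gsum_le eta0 st tiny).
Qed.

Hypothesis dn : (d <= n)%N.
Hypothesis d0 : (0 < d)%N.
Hypothesis XR : forall x o, `|X x ord0 o| <= R0.
Hypothesis theta0 : 0 <= theta.
Hypothesis thetaE : theta ^+ 2 = R0 * eta.
Hypothesis etaR : 4 * (n%:R * (n%:R * eta)) <= R0.
Hypothesis q2 : (k <= q * q)%N.
Hypothesis q0 : (0 < q)%N.
Hypothesis no_hyper : ~ hyper_bad (10 * d) (2 * (n%:R * (n%:R * theta))) X.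
Hypothesis no_clump : ~ clump_bad (10 * d) (4 * theta) X.
Hypothesis no_slab : ~ slab_bad k (8 * k * d) (2 * R0) (eta ^+ 2) theta X.
Hypothesis no_lin : ~ lin_bad (2 * (400 * q * d)) (2 * n) (3 * (n%:R * (n%:R * eta))) X.
Hypothesis no_pair : ~ pair_bad k (18 * k * d) (58 * q * d) (2 * R0) w (theta / 2) X.
Hypothesis no_single : ~ single_bad k (18 * k * d) (58 * q * d) (2 * R0) w X.

Lemma mnet_neq0 j x : x \in M -> (f x == j) || (g x == j) ->
  (degree f g j <= 400 * q * d)%N -> mnet G j != 0.
Proof.
move=> xM fgj dj; apply/negP => /eqP net0; apply: no_lin.
have n1 : (1 : R) <= n%:R by exact: n_ge1 x.
exists (incid f g j); split.
- have : (0 < degree f g j)%N.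
    by rewrite /degree card_gt0; apply/finset.set0Pn; exists x; rewrite finset.in_set xM.
  by rewrite -incid_supp card_gt0 => /finset.set0Pn[y]; rewrite inE => Hy; exists y.
- by rewrite incid_supp; apply: leq_trans dj _; rewrite leq_pmull.
- move=> y; apply: le_trans (incid_le f g j y) _.
  by have := ltn_ord x; clear; lia.
- move=> o; have := incid_relation j o; rewrite -mnet_moves net0 mul0r subr0 => H.
  apply: le_trans H _; have h0 : 0 <= n%:R * eta by rewrite mulr_ge0.
  have h1 : n%:R * eta <= n%:R * (n%:R * eta) by rewrite ler_peMl.
  lra.
Qed.

Lemma mcenter_near j o : mnet G j != 0 ->
  `|c j ord0 o - mcenter G X j ord0 o| <= n%:R * eta.
Proof.
move=> net; have net' : ((mnet G j)%:~R : R) != 0 by rewrite intr_eq0.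
have p1 : 1 <= `|(mnet G j)%:~R : R|.
  by rewrite -intr_norm -[1]/(1%:~R) ler_int -gtz0_ge1 normr_gt0.
have := incid_relation j o; rewrite -mnet_moves.
rewrite -(sum_moves (V := R) f g j (F := fun z x => z%:~R * X x ord0 o)); last by move=> x; rewrite mul0r.
rewrite mxE; set A := \sum_(t <- _) _; set p := (mnet G j)%:~R in net' p1 *.
have -> : A - p * c j ord0 o = - (p * (c j ord0 o - A / p)).
  by rewrite mulrBr (mulrC p (A / p)) divfK// opprB.
rewrite normrN normrM => H; apply: le_trans H.
by rewrite ler_peMl.
Qed.

(** Here the unknown center of a sparse label is replaced by [mcenter], a function of the moving
    points alone. *)
Lemma partner_facts x i j : x \in M -> far_apart c f g theta x ->
  (f x = i /\ g x = j) \/ (g x = i /\ f x = j) -> (degree f g j <= 400 * q * d)%N ->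
  [/\ mnet G j != 0, j != i, `|sqdist (X x) (c i) - sqdist (X x) (mcenter G X j)| <= w,
      (exists o, theta / 2 <= `|c i ord0 o - mcenter G X j ord0 o|) &
      forall o, `|c i ord0 o| <= 2 * R0].
Proof.
move=> xM xs fg dj.
have n1 : (1 : R) <= n%:R by exact: n_ge1 x.
have net : mnet G j != 0.
  by apply: mnet_neq0 xM _ dj; case: fg => -[-> ->]; rewrite eqxx ?orbT.
have ctrR i' o : i' = i \/ i' = j -> `|c i' ord0 o| <= 2 * R0.
  have hf := ctr_f_le st XR x o; have hg := ctr_g_le eta0 st tiny XR etaR x o.
  by case: fg => -[fx gx]; rewrite fx gx in hf hg => -[->|->].
have near o := mcenter_near o net.
have [e1 e2] := eta_le_R0 eta0 etaR x.
split => //.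
- by move: xM; rewrite inE; case: fg => -[-> ->] //; rewrite eq_sym.
(* 8 = 7 + 1: the approximated center costs 7 n^2 R0 eta, as |2 x - a - b| <= 7 R0 in every
   coordinate, and the gain eta^2 is at most n^2 R0 eta. *)
- rewrite -(subrKA (sqdist (X x) (c j))); apply: le_trans (ler_normD _ _) _.
  have hA : `|sqdist (X x) (c i) - sqdist (X x) (c j)| <= eta ^+ 2.
    have h1 := kstep_gain_ge0 x st; have h2 := kstep_gain x st tiny.
    by case: fg => -[fx gx]; [|rewrite distrC]; rewrite -fx -gx ger0_norm.
  have hB : `|sqdist (X x) (c j) - sqdist (X x) (mcenter G X j)| <= d%:R * ((n%:R * eta) * (7 * R0)).
    apply: sqdist_approx => o; first by rewrite distrC; exact: near.
    have := near o; have := ctrR j o (or_intror erefl); have := XR x o.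
    by rewrite !ler_norml => /andP[? ?] /andP[? ?] /andP[? ?]; apply/andP; split; lra.
  have R00 : 0 <= R0 by exact: le_trans e2.
  have hC : d%:R * ((n%:R * eta) * (7 * R0)) <= 7 * (n%:R * (n%:R * (R0 * eta))).
    have -> : d%:R * ((n%:R * eta) * (7 * R0)) = d%:R * (n%:R * (7 * (R0 * eta))) by ring.
    have -> : 7 * (n%:R * (n%:R * (R0 * eta))) = n%:R * (n%:R * (7 * (R0 * eta))) by ring.
    by rewrite ler_wpM2r ?ler_nat// !mulr_ge0.
  have hD : eta ^+ 2 <= n%:R * (n%:R * (R0 * eta)).
    apply: (@le_trans _ _ (R0 * eta)); first by rewrite expr2 ler_wpM2r.
    have h0 : 0 <= R0 * eta by rewrite mulr_ge0.
    apply: (@le_trans _ _ (n%:R * (R0 * eta))); first by rewrite ler_peMl.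
    by rewrite ler_peMl// mulr_ge0.
  have := lerD hA hB; lra.
- have /existsP[wo hw] := xs; exists wo.
  have nt := n_eta_theta eta0 theta0 thetaE etaR x.
  have hw' : theta <= `|c i ord0 wo - c j ord0 wo|.
    by case: fg hw => -[-> ->] //; rewrite distrC.
  have := ler_distD (mcenter G X j ord0 wo) (c i ord0 wo) (c j ord0 wo).
  by rewrite (distrC (mcenter G X j ord0 wo)); have := near wo; lra.
- by move=> o; apply: ctrR; left.
Qed.

(** A dense label would yield 174 q d moves in one direction. As 174 = 2 * 58 + 58, they contain 58
    q d disjoint pairs with common partners or 58 q d points with distinct partners. *)
Lemma sparse_step i : (degree f g i <= 400 * q * d)%N.
Proof.
rewrite leqNgt; apply/negP => dense.
have fewM := few_movers eta0 st tiny dn XR theta0 thetaE etaR no_hyper no_slab.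
have fewC := few_close eta0 st tiny dn theta0 thetaE etaR no_hyper no_clump.
have fewP := pair_movers eta0 st tiny dn theta0 thetaE etaR no_hyper.
have [W [Wbig WM Wsep Wdir]] := dense_star q2 q0 d0 fewM fewC fewP dense.
have szG : (size G <= 18 * k * d)%N by rewrite size_map -cardE.
have memG x : x \in M -> (x, (f x, g x)) \in G.
  by move=> xM; apply: (map_f (fun x => (x, (f x, g x)))); rewrite mem_enum.
have [h [hdir facts]] : exists h : 'I_n -> 'I_k,
    ((forall x, x \in W -> f x = i /\ g x = h x) \/ (forall x, x \in W -> g x = i /\ f x = h x)) /\
    forall x, x \in W -> (degree f g (h x) <= 400 * q * d)%N.
  case: Wdir => H; [exists g|exists f]; split.
  - by left=> x xW; have [-> _] := H x xW.
  - by move=> x xW; have [_ ->] := H x xW.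
  - by right=> x xW; have [-> _] := H x xW.
  - by move=> x xW; have [_ ->] := H x xW.
have F x : x \in W -> [/\ mnet G (h x) != 0, h x != i,
      `|sqdist (X x) (c i) - sqdist (X x) (mcenter G X (h x))| <= w,
      (exists o, theta / 2 <= `|c i ord0 o - mcenter G X (h x) ord0 o|) &
      forall o, `|c i ord0 o| <= 2 * R0].
  move=> xW; apply: partner_facts (WM x xW) (Wsep x xW) _ (facts x xW).
  by case: hdir => H; [left|right]; exact: H.
have [x0 x0W] : exists x, x \in W.
  apply/finset.set0Pn; rewrite -card_gt0; apply: leq_trans Wbig.
  by rewrite !muln_gt0 q0 d0.
have [_ _ _ _ ciR] := F x0 x0W.
have memGi x : x \in W -> ((x, (i, h x)) \in G) || ((x, (h x, i)) \in G).
  move=> xW; have := memG x (WM x xW); case: hdir => H; have [-> ->] := H x xW => ->//.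
  by rewrite orbT.
have [L [S [uL hL [SW hS] cW]]] := pairs_or_singles h W.
have [Lbig|Lsmall] := leqP (58 * q * d) (size L).
  apply: no_pair; exists G, i, (c i).
  exists (take (58 * q * d) [seq (ab.1, ab.2, h ab.1) | ab <- L]); split => //.
  - by split => //; exact: uniq_moves.
  - by rewrite size_take_min size_map; apply/minn_idPl.
  - rewrite /unzip1 /unzip2 !map_take -!map_comp.
    by apply: (subseq_uniq _ uL); apply: cat_subseq; exact: take_subseq.
  - move=> _ /mem_take/mapP[[a b] abL ->] /=.
    have [/= aW bW hab] := hL _ abL; have [F1 F2 F3 F4 _] := F a aW.
    split => //; have := memG b (WM b bW); have := memG a (WM a aW).
    case: hdir => H; have [-> ->] := H a aW; have [-> ->] := H b bW; rewrite -hab => -> ->//.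
    by rewrite orbT.
have Sbig : (58 * q * d <= #|S|)%N by move: Wbig Lsmall; rewrite cW -muln2 -!mulnA; lia.
apply: no_single; exists G, i, (c i).
exists (take (58 * q * d) [seq (a, h a) | a <- enum S]); split => //.
- by split => //; exact: uniq_moves.
- by rewrite size_take_min size_map -cardE; apply/minn_idPl.
- rewrite /unzip1 /unzip2 !map_take -!map_comp !take_uniq//.
    by rewrite map_inj_in_uniq ?enum_uniq// => a b; rewrite !mem_enum; exact: hS.
  by rewrite (@eq_map _ _ _ id) ?map_id ?enum_uniq.
- move=> _ /mem_take/mapP[a aS ->] /=; rewrite mem_enum in aS.
  have aW := fintype.subsetP SW a aS.
  by have [F1 F2 F3 F4 _] := F a aW; split => //; exact: memGi.
Qed.

End SparseStep.

(** Equal means of two disjoint clusters are an exact integer relation whose coefficients are the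
    cluster sizes. *)
Lemma means_inj_of_general (R : realType) (n k d : nat) (i0 : 'I_k) (X : 'I_n -> 'rV[R]_d)
    (c0 : {ffun 'I_k -> 'rV[R]_d}) t : ~ lin_bad n n 0 X -> forall x y,
  ctr i0 X c0 t.+1 (asg i0 X c0 t x) = ctr i0 X c0 t.+1 (asg i0 X c0 t y) ->
  asg i0 X c0 t x = asg i0 X c0 t y.
Proof.
move=> gen x y e; apply/eqP/negPn/negP => xy; apply: gen.
set a := asg i0 X c0 t in e xy *; pose A := cell a (a x); pose B := cell a (a y).
have eAB : mean X A = mean X B by rewrite -!ctr_mean e.
have A0 : (0 < #|A|)%N by apply/card_gt0P; exists x; rewrite inE.
have B0 : (0 < #|B|)%N by apply/card_gt0P; exists y; rewrite inE.
have An : (#|A| <= n)%N by rewrite -[leqRHS]card_ord max_card.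
have Bn : (#|B| <= n)%N by rewrite -[leqRHS]card_ord max_card.
exists (fun u => #|B|%:Z * (u \in A)%:Z - #|A|%:Z * (u \in B)%:Z); split.
- exists x; rewrite !inE eqxx (negbTE xy) mulr1 mulr0 subr0 eqz_nat -lt0n//.
- by rewrite -[leqRHS]card_ord max_card.
- by move=> u; rewrite !inE; case: eqP => [->|_]; [rewrite (negbTE xy)|case: eqP => _];
    rewrite ?mulr1 ?mulr0 ?subr0 ?sub0r ?normrN.
- move=> o; rewrite (_ : \sum_u _ = 0) ?normr0//.
  have S (C D : {set 'I_n}) : \sum_u ((#|C|%:Z * (u \in D)%:Z)%:~R * X u ord0 o) = #|C|%:R * \sum_(u in D) X u ord0 o.
    rewrite mulr_sumr [RHS]big_mkcond; apply: eq_bigr => u _.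
    by case: (u \in D); rewrite ?mulr1 ?mulr0 ?mul0r.
  under eq_bigr do rewrite rmorphB/= mulrBl.
  rewrite sumrB !S.
  have -> : \sum_(u in A) X u ord0 o = #|A|%:R * mean X A ord0 o.
    by rewrite mean_coord mulrA divff ?mul1r// pnatr_eq0 -lt0n.
  have -> : \sum_(u in B) X u ord0 o = #|B|%:R * mean X B ord0 o.
    by rewrite mean_coord mulrA divff ?mul1r// pnatr_eq0 -lt0n.
  by rewrite eAB; ring.
Qed.

Section TwoIncidences.
Context (n k : nat) (f0 f1 f2 : 'I_n -> 'I_k) (i : 'I_k).
Let v := incid f0 f1 i.
Let v' := incid f1 f2 i.

(** Otherwise the two changes would be proportional. A point that has entered can only leave, so
    they would be opposite, and the cluster would return to its first composition. *)
Lemma incid_cancel (p p' : int) : p != 0 ->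
  cell f1 i != cell f0 i -> cell f2 i != cell f1 i -> cell f2 i != cell f0 i ->
  exists x, p' * v x - p * v' x != 0.
Proof.
move=> p0 h10 h21 h20; apply: contrapT => no.
have E x : p' * v x = p * v' x.
  by apply/eqP; rewrite -subr_eq0; apply/negPn/negP => H; apply: no; exists x.
have [x vx] : exists x, v x != 0.
  apply: contrapT => nv; move/eqP: h10; apply; apply/finset.setP => x; rewrite !inE.
  have : v x = 0 by apply/eqP/negPn/negP => H; apply: nv; exists x.
  by rewrite /v /incid; case: (f1 x == i); case: (f0 x == i).
have [y v'y] : exists y, v' y != 0.
  apply: contrapT => nv; move/eqP: h21; apply; apply/finset.setP => y; rewrite !inE.
  have : v' y = 0 by apply/eqP/negPn/negP => H; apply: nv; exists y.
  by rewrite /v' /incid; case: (f2 y == i); case: (f1 y == i).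
have pp : p' = - p.
  have := E x; have := E y; move: vx v'y; rewrite /v /v' /incid.
  case: (f0 x == i); case: (f1 x == i); case: (f2 x == i);
  case: (f0 y == i); case: (f1 y == i); case: (f2 y == i) => //= _ _; move/eqP: p0; lia.
move/eqP: h20; apply; apply/finset.setP => z; rewrite !inE.
have := E z; rewrite pp /v /v' /incid; move/eqP: p0.
case: (f0 z == i); case: (f1 z == i); case: (f2 z == i) => //=; lia.
Qed.

End TwoIncidences.

(** * Two consecutive tiny steps *)

Section PlaneWindow.
Context (R : realType) (n k d : nat) (i0 : 'I_k) (X : 'I_n -> 'rV[R]_d).
Variables (c0 : {ffun 'I_k -> 'rV[R]_d}) (eta theta R0 : R) (q : nat).
Local Notation asg := (asg i0 X c0).
Local Notation ctr := (ctr i0 X c0).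
Hypothesis eta0 : 0 <= eta.
Hypothesis dn : (d <= n)%N.
Hypothesis d0 : (0 < d)%N.
Hypothesis XR : forall x o, `|X x ord0 o| <= R0.
Hypothesis theta0 : 0 <= theta.
Hypothesis thetaE : theta ^+ 2 = R0 * eta.
Hypothesis etaR : 4 * (n%:R * (n%:R * eta)) <= R0.
Hypothesis q2 : (k <= q * q)%N.
Hypothesis q0 : (0 < q)%N.
Hypothesis general : ~ lin_bad n n 0 X.
Hypothesis no_hyper : ~ hyper_bad (10 * d) (2 * (n%:R * (n%:R * theta))) X.
Hypothesis no_clump : ~ clump_bad (10 * d) (4 * theta) X.
Hypothesis no_slab : ~ slab_bad k (8 * k * d) (2 * R0) (eta ^+ 2) theta X.
Hypothesis no_lin : ~ lin_bad (2 * (400 * q * d)) (2 * n) (3 * (n%:R * (n%:R * eta))) X.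
Hypothesis no_pair : ~ pair_bad k (18 * k * d) (58 * q * d) (2 * R0)
  (8 * (n%:R * (n%:R * (R0 * eta)))) (theta / 2) X.
Hypothesis no_single : ~ single_bad k (18 * k * d) (58 * q * d) (2 * R0)
  (8 * (n%:R * (n%:R * (R0 * eta)))) X.

Lemma incid_sum_le (f g : 'I_n -> 'I_k) i : `|\sum_x incid f g i x| <= n%:Z.
Proof.
apply: le_trans (ler_norm_sum _ _ _) _.
apply: le_trans (ler_sum _ (fun x _ => incid_le f g i x)) _.
by rewrite sumr_const card_ord -natz.
Qed.

Lemma plane_window t : Psi X (asg t) - Psi X (asg t.+1) <= eta ^+ 2 ->
  Psi X (asg t.+1) - Psi X (asg t.+2) <= eta ^+ 2 ->
  Psi X (asg t.+2) < Psi X (asg t.+1) -> False.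
Proof.
move=> tiny1 tiny2 dec.
have minj := means_inj_of_general (i0 := i0) (c0 := c0) (t := t.+1) general.
have [i [h10 h21 h20]] := three_configurations minj dec.
set f0 := asg_rep i0 X c0 t in h10 h20; set f1 := asg t.+1 in h10 h21.
set f2 := asg_lazy i0 X c0 t.+1 in h21 h20.
have st1 : kstep X (ctr t.+1) f0 f1 := kstep_asg_rep i0 X c0 t.
have st2 : kstep X (ctr t.+2) f1 f2 := kstep_asg_lazy minj.
rewrite -(Psi_asg_rep i0 X c0 t) in tiny1.
rewrite -(Psi_asg_lazy i0 X c0 t.+1) in tiny2.
have sp1 : (degree f0 f1 i <= 400 * q * d)%N.
  exact: (sparse_step eta0 st1 tiny1 dn d0 XR theta0 thetaE etaR q2 q0 no_hyper no_clump no_slab no_lin no_pair no_single).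
have sp2 : (degree f1 f2 i <= 400 * q * d)%N.
  exact: (sparse_step eta0 st2 tiny2 dn d0 XR theta0 thetaE etaR q2 q0 no_hyper no_clump no_slab no_lin no_pair no_single).
have rel1 := incid_relation eta0 st1 tiny1 i; have rel2 := incid_relation eta0 st2 tiny2 i.
pose p := \sum_x incid f0 f1 i x; pose p' := \sum_x incid f1 f2 i x.
have [x0 _] : exists x, x \in [set: 'I_n]%SET.
  apply: contrapT => no; move/eqP: h10; apply; apply/finset.setP => x.
  by case: no; exists x; rewrite inE.
have n1 : (1 : R) <= n%:R by exact: n_ge1 x0.
have ne0 : 0 <= n%:R * eta by rewrite mulr_ge0.
have ne1 : n%:R * eta <= n%:R * (n%:R * eta) by rewrite ler_peMl.
have pn (f g : 'I_n -> 'I_k) : `|(\sum_x incid f g i x)%:~R : R| <= n%:R.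
  by rewrite -intr_norm; have := incid_sum_le f g i; rewrite -(ler_int R).
(* If the first step keeps the size of [i], its relation is free of the center. Otherwise
   cross-multiplication by the size changes removes it; of the three errors n^2 eta, the last comes
   from the shift of the center between the steps. *)
apply: no_lin; have [p0|p0] := eqVneq p 0.
  exists (incid f0 f1 i); split.
  - have [x]: exists x, 0 * incid f1 f0 i x - 1 * incid f0 f1 i x != 0.
      apply: contrapT => nv; move/eqP: h10; apply; apply/finset.setP => x; rewrite !inE.
      have : 0 * incid f1 f0 i x - 1 * incid f0 f1 i x = 0 by apply/eqP/negPn/negP => H; apply: nv; exists x.
      by rewrite mul0r mul1r sub0r /incid; case: (f1 x == i); case: (f0 x == i).
    by rewrite mul0r mul1r sub0r oppr_eq0 => Hx; exists x.
  - by rewrite incid_supp; apply: leq_trans sp1 _; rewrite leq_pmull.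
  - by move=> x; apply: le_trans (incid_le _ _ _ _) _; have := ltn_ord x0; clear; lia.
  - move=> o; have := rel1 o; rewrite -/p p0 mul0r subr0 => H; apply: le_trans H _; lra.
exists (fun x => p' * incid f0 f1 i x - p * incid f1 f2 i x); split.
- exact: incid_cancel.
- have sub : [set x | p' * incid f0 f1 i x - p * incid f1 f2 i x != 0%R]%SET \subset
     ([set x | incid f0 f1 i x != 0%R] :|: [set x | incid f1 f2 i x != 0%R])%SET.
    apply/fintype.subsetP => x; rewrite !inE; apply: contraR; rewrite negb_or !negbK.
    by move=> /andP[/eqP -> /eqP ->]; rewrite !mulr0 subrr.
  apply: leq_trans (subset_leq_card sub) _; apply: leq_trans (leq_card_setU _ _).1 _.
  by rewrite !incid_supp mul2n -addnn leq_add.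
- move=> x; apply: le_trans (ler_normB _ _) _; rewrite !normrM.
  have h (a b : int) : `|a| <= n%:Z -> `|b| <= 1 -> `|a| * `|b| <= n%:Z.
    move=> ha hb; rewrite -[n%:Z]mulr1; exact: ler_pM.
  rewrite mul2n -addnn PoszD; apply: lerD; apply: h => //; try exact: incid_le; exact: incid_sum_le.
- move=> o.
  have cc : `|ctr t.+1 i ord0 o - ctr t.+2 i ord0 o| <= eta.
    rewrite (ctrS _ _ _ t.+1); case: ifPn => [_|ne]; first by rewrite subrr normr0.
    by rewrite distrC; exact: (shift_le eta0 st1 tiny1).
  set A := \sum_x (incid f0 f1 i x)%:~R * X x ord0 o.
  set B := \sum_x (incid f1 f2 i x)%:~R * X x ord0 o.
  have -> : \sum_x (p' * incid f0 f1 i x - p * incid f1 f2 i x)%:~R * X x ord0 o =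
      p'%:~R * (A - p%:~R * ctr t.+1 i ord0 o) - p%:~R * (B - p'%:~R * ctr t.+2 i ord0 o)
      + p'%:~R * p%:~R * (ctr t.+1 i ord0 o - ctr t.+2 i ord0 o).
    transitivity (p'%:~R * A - p%:~R * B); last by ring.
    by rewrite /A /B !mulr_sumr -sumrB; apply: eq_bigr => x _; ring.
  have b1 : `|p'%:~R * (A - p%:~R * ctr t.+1 i ord0 o)| <= n%:R * (n%:R * eta).
    by rewrite normrM; apply: ler_pM => //; [exact: pn|exact: rel1].
  have b2 : `|p%:~R * (B - p'%:~R * ctr t.+2 i ord0 o)| <= n%:R * (n%:R * eta).
    by rewrite normrM; apply: ler_pM => //; [exact: pn|exact: rel2].
  have b3 : `|p'%:~R * p%:~R * (ctr t.+1 i ord0 o - ctr t.+2 i ord0 o)| <= n%:R * (n%:R * eta).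
    by rewrite -mulrA normrM; apply: ler_pM => //; [exact: pn|rewrite normrM; apply: ler_pM => //; exact: pn].
  apply: le_trans (ler_normD _ _) _; have := ler_normB (p'%:~R * (A - p%:~R * ctr t.+1 i ord0 o)) (p%:~R * (B - p'%:~R * ctr t.+2 i ord0 o)).
  lra.
Qed.

End PlaneWindow.

(** * Probabilities of the bad events *)

Lemma measurable_all_in d (T : measurableType d) (L : eqType) (s : seq L) (E : L -> set T) :
  (forall l, l \in s -> measurable (E l)) ->
  measurable [set g | forall l, l \in s -> E l g]%classic.
Proof.
elim: s => [|a s IH] mE.
  by rewrite [X in measurable X](_ : _ = setT)//; apply/seteqP; split.
rewrite [X in measurable X](_ : _ =
    (E a `&` [set g | forall l', l' \in s -> E l' g])%classic).
  apply: measurableI; first by apply: mE; rewrite mem_head.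
  by apply: IH => x xs; apply: mE; rewrite inE xs orbT.
apply/seteqP; split => g /=.
  by move=> H; split; [apply: H; rewrite mem_head|move=> x xs; apply: H; rewrite inE xs orbT].
by move=> [Ea H] x; rewrite inE => /predU1P[->//|]; exact: H.
Qed.

Lemma measurable_norm_le d (T : measurableType d) (R : realType) (F : T -> R) (w : R) :
  measurable_fun setT F -> measurable [set g | `|F g| <= w]%classic.
Proof.
move=> mF; have -> : [set g | `|F g| <= w]%classic = (setT `&` F @^-1` `[- w, w])%classic.
  by apply/seteqP; split => g /=; rewrite in_itv/= -ler_norml => //; case.
by apply: mF => //; exact: measurable_itv.
Qed.

Lemma measurable_norm_ge d (T : measurableType d) (R : realType) (F : T -> R) (w : R) :
  measurable_fun setT F -> measurable [set g | w <= `|F g|]%classic.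
Proof.
move=> mF; have mN : measurable_fun setT (fun g => `|F g|).
  exact: (measurableT_comp (@normr_measurable R setT) mF).
have -> : [set g | w <= `|F g|]%classic = (setT `&` (fun g => `|F g|)%R @^-1` `[w, +oo[)%classic.
  by apply/seteqP; split => g /=; rewrite in_itv/= andbT => //; case.
by apply: mN => //; exact: measurable_itv.
Qed.

Section ChainCovers.
Context (R : realType) (I : finType) (sigma : R).
Hypothesis sigma0 : 0 < sigma.

Lemma normal_prob_affine (F : (I -> R) -> R) (g : I -> R) (v : I) (w a0 : R) :
  0 <= w -> 0 < a0 ->
  (exists a b, a0 <= `|a| /\ forall t, F (upd g v t) = a * t + b) ->
  (normal_prob 0 sigma [set t | (`|F (upd g v t)| <= w)%R]%classic <= (w / (sigma * a0))%:E)%E.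
Proof.
move=> w0 a00 [a [b [a0a FE]]].
have na : a != 0 by rewrite -normr_gt0; exact: lt_le_trans a0a.
under eq_set => t do rewrite FE.
apply: le_trans (normal_prob_slab sigma0 b na w0) _.
rewrite lee_fin ler_wpM2l// lef_pV2 ?posrE ?mulr_gt0// ?normr_gt0//.
by rewrite ler_pM2l.
Qed.

Lemma pcover_chain_line (L : eqType) (S : set (I -> R)) (s : seq L) (v : L -> I)
    (E : L -> set (coordT R I)) (p : R) : 0 <= p -> uniq s ->
  (forall g, S g -> forall l, l \in s -> E l g) ->
  (forall l, l \in s -> measurable (E l)) ->
  (forall l g, l \in s ->
     (normal_prob 0 sigma [set t | E l (upd g (v l) t)]%classic <= p%:E)%E) ->
  {in s &, forall l l', l != l' -> forall g t, E l' (upd g (v l) t) <-> E l' g} ->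
  pcover sigma S (p ^+ size s).
Proof.
move=> p0 us SE mE Ep Einv.
apply: (@pcover_sub _ _ _ _ [set g | forall l, l \in s -> E l g]%classic) => //.
apply: pcover_gprob; first exact: (measurable_all_in (T := coordT R I)).
exact: gprob_chain_line Ep Einv.
Qed.

Lemma pcover_chain_diag (L : eqType) (S : set (I -> R)) (s : seq L) (v v' : L -> I)
    (E : L -> set (coordT R I)) (w : R) : 0 <= w -> uniq s ->
  (forall g, S g -> forall l, l \in s -> E l g) ->
  (forall l, l \in s -> measurable (E l)) ->
  (forall l, l \in s -> v l != v' l) ->
  (forall l g u, l \in s -> exists a b, [/\ a <= b, b - a <= w & forall t,
     E l (upd (upd g (v l) t) (v' l) (u - t)) -> a <= t <= b]) ->
  {in s &, forall l l', l != l' -> forall g u t t',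
     E l' (upd (upd g (v l) t) (v' l) (u - t)) ->
     E l' (upd (upd g (v l) t') (v' l) (u - t'))} ->
  pcover sigma S ((w / sigma) ^+ size s).
Proof.
move=> w0 us SE mE vv Ep Einv.
apply: (@pcover_sub _ _ _ _ [set g | forall l, l \in s -> E l g]%classic) => //.
apply: pcover_gprob; first exact: (measurable_all_in (T := coordT R I)).
exact: gprob_chain_diag Ep Einv.
Qed.

End ChainCovers.

Lemma grid (R : realType) (B e : R) : 0 <= B -> 0 < e ->
  exists (N : nat) (pt : 'I_N -> R), [/\ (0 < N)%N, N%:R <= 2 * B / e + 2 &
    forall v, `|v| <= B -> exists i, `|v - pt i| <= e].
Proof.
move=> B0 e0; pose N := (Num.truncn (2 * B / e)).+1.
have Be0 : 0 <= 2 * B / e by rewrite divr_ge0 ?mulr_ge0// ltW.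
exists N, (fun i => - B + i%:R * e); split => //.
  rewrite /N -addn1 natrD (_ : 2 = 1 + 1)// addrA lerD2r.
  by have /truncn_itv/andP[h _] := Be0; rewrite (le_trans h)// lerDl.
move=> v; rewrite ler_norml => /andP[v1 v2].
have x0 : 0 <= (v + B) / e by apply: divr_ge0; [lra|exact: ltW].
have /truncn_itv/andP[h1 h2] := x0.
have iN : (Num.truncn ((v + B) / e) < N)%N.
  rewrite ltnS; apply: le_truncn; rewrite ler_pM2r ?invr_gt0//; lra.
exists (Ordinal iN) => /=.
rewrite ler_pdivlMr// in h1; rewrite ltr_pdivrMr// -natr1 mulrDl mul1r in h2.
by rewrite ler_norml; apply/andP; split; lra.
Qed.

Section Points.
Context (R : realType) (n d : nat) (mu : 'I_n -> 'rV[R]_d).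
Local Notation I := ('I_n * 'I_d)%type.
Implicit Types (g : I -> R).

Definition pts g : 'I_n -> 'rV[R]_d := fun i => mu i + \row_(j < d) g (i, j).

Lemma ptsE g x o : pts g x ord0 o = mu x ord0 o + g (x, o).
Proof. by rewrite !mxE. Qed.

Lemma pts_upd g v t x o :
  pts (upd g v t) x ord0 o = if (x, o) == v then mu x ord0 o + t else pts g x ord0 o.
Proof. by rewrite !ptsE /upd; case: ifP. Qed.

Lemma pts_upd_neq g v t x : x != v.1 -> pts (upd g v t) x = pts g x.
Proof.
move=> xv; apply/rowP => o; rewrite pts_upd ifF//.
by apply/negbTE; apply: contraNneq xv => <-.
Qed.

Lemma measurable_pts x o :
  measurable_fun setT (fun g : coordT R I => pts g x ord0 o : R).
Proof.
rewrite (_ : (fun g => _) = (fun g : coordT R I => mu x ord0 o + g (x, o))).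
  by apply: measurable_funD; [exact: measurable_cst|exact: measurable_coord].
by apply/funext => g; rewrite ptsE.
Qed.

End Points.

Section LinearCovers.
Context (R : realType) (sigma : R) (n d : nat) (mu : 'I_n -> 'rV[R]_d).
Hypothesis sigma0 : 0 < sigma.
Local Notation I := ('I_n * 'I_d)%type.
Local Notation X := (pts mu).
Implicit Types (g : I -> R).

Lemma lin_upd (a : 'I_n -> R) g x o t :
  \sum_y a y * X (upd g (x, o) t) y ord0 o =
  a x * t + (a x * mu x ord0 o + \sum_(y | y != x) a y * X g y ord0 o).
Proof.
rewrite (bigD1 x)//= pts_upd eqxx addrA -mulrDr (addrC t); congr (_ + _).
by apply: eq_bigr => y yx; rewrite pts_upd_neq.
Qed.

Lemma lin_upd_eq (a : 'I_n -> R) g v t o : (v.2 != o) || (a v.1 == 0) ->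
  \sum_y a y * X (upd g v t) y ord0 o = \sum_y a y * X g y ord0 o.
Proof.
move=> H; apply: eq_bigr => y _; rewrite pts_upd; case: eqP => // e.
by move: H; rewrite -e /= eqxx => /eqP ->; rewrite !mul0r.
Qed.

Lemma measurable_lin (a : 'I_n -> R) o :
  measurable_fun setT (fun g : coordT R I => \sum_y a y * X g y ord0 o : R).
Proof.
apply: measurable_sum => y; apply: measurable_funM; first exact: measurable_cst.
exact: measurable_pts.
Qed.

Section Codes.
Variables (S N : nat).
Local Notation J := {ffun 'I_S -> 'I_n * 'I_(2 * N).+1}.

Definition int_of_code (c : J) (x : 'I_n) : int :=
  \sum_s ((c s).1 == x)%:Z * ((c s).2%:Z - N%:Z).

Lemma int_code (z : 'I_n -> int) : (exists x, z x != 0) ->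
  (#|[set x | z x != 0%R]%SET| <= S)%N -> (forall x, `|z x| <= N%:Z) ->
  exists c, z =1 int_of_code c.
Proof.
move=> [x0 _]; set A := finset _ => AS zN; pose e := enum A.
have eS : (size e <= S)%N by rewrite -cardE.
have zb x : (`|(z x + N%:Z)%R|%N < (2 * N).+1)%N by have := zN x; lia.
pose c : J := [ffun s : 'I_S => if (s < size e)%N then
  (nth x0 e s, Ordinal (zb (nth x0 e s))) else (x0, inord N)].
exists c => x.
have E s : ((c s).1 == x)%:Z * ((c s).2%:Z - N%:Z) =
    if (s < size e)%N then (nth x0 e s == x)%:Z * z (nth x0 e s) else 0.
  rewrite ffunE; case: ifP => _ /=; last by rewrite inordK ?subrr ?mulr0//; lia.
  congr (_ * _); have := zN (nth x0 e s); lia.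
rewrite /int_of_code (eq_bigr _ (fun s _ => E s)) -big_mkcond /=.
rewrite -(big_ord_widen S (fun s => (nth x0 e s == x)%:Z * z (nth x0 e s)) eS).
rewrite -(big_mkord xpredT (fun s => (nth x0 e s == x)%:Z * z (nth x0 e s))).
rewrite -(big_nth x0 xpredT (fun y => (y == x)%:Z * z y)) big_enum/=.
have [xA|xA] := boolP (x \in A).
  rewrite (bigD1 x)//= eqxx mul1r big1 ?addr0// => y /andP[_ /negbTE ->].
  by rewrite mul0r.
rewrite big1 => [|y yA]; first by move: xA; rewrite inE negbK => /eqP.
by case: eqP yA => [->|_ _]; rewrite ?(negbTE xA)// mul0r.
Qed.

End Codes.

(** For a fixed relation, a point with nonzero coefficient has slope at least one, and its [d]
    coordinates give independent tests of probability tau / sigma. *)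
Lemma pcover_lin S N (tau : R) : 0 <= tau ->
  pcover sigma [set g | lin_bad S N tau (X g)]%classic
    (((n * (2 * N).+1) ^ S)%:R * (tau / sigma) ^+ d).
Proof.
move=> tau0; pose J := {ffun 'I_S -> 'I_n * 'I_(2 * N).+1}.
have -> : ((n * (2 * N).+1) ^ S)%N = #|{: J}| by rewrite card_ffun card_prod !card_ord.
have p0 : 0 <= (tau / sigma) by rewrite divr_ge0// ltW.
pose B (c : J) : set (I -> R) := [set g | (exists x, int_of_code c x != 0) /\
  forall o, `|\sum_x (int_of_code c x)%:~R * X g x ord0 o| <= tau]%classic.
apply: (@pcover_sub _ _ _ _ [set g | exists c, B c g]%classic).
  move=> g [z [[x zx] zS zN zX]].
  have [c zc] := int_code (ex_intro _ x zx) zS zN; exists c; split.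
    by exists x; rewrite -zc.
  by move=> o; under eq_bigr do rewrite -zc; exact: zX.
apply: pcover_bigU => [|c]; first exact: exprn_ge0.
have [[x cx]|no] := pselect (exists x, int_of_code c x != 0); last first.
  apply: (@pcover_sub _ _ _ _ set0); first by move=> g [].
  by apply: pcover0; exact: exprn_ge0.
rewrite -[X in _ ^+ X](size_enum_ord d).
apply: (@pcover_chain_line _ _ _ _ _ _ (fun o => (x, o))
  (fun o => [set g | `|\sum_y (int_of_code c y)%:~R * X g y ord0 o| <= tau]%classic)) => //.
- exact: enum_uniq.
- by move=> g [_ H] o _; exact: H.
- by move=> o _; apply: (@measurable_norm_le _ (coordT R I)); exact: (measurable_lin (fun y => (int_of_code c y)%:~R)).
- move=> o g _.
  have := @normal_prob_affine _ _ _ sigma0 (fun g => \sum_y (int_of_code c y)%:~R * X g y ord0 o) g (x, o) tau 1 tau0 ltr01.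
  rewrite mulr1; apply; exists (int_of_code c x)%:~R.
  eexists; split; last by move=> t; exact: (lin_upd (fun y => (int_of_code c y)%:~R)).
  by rewrite -intr_norm -[1]/(1%:~R) ler_int -gtz0_ge1 normr_gt0.
- move=> o o' _ _ oo g t /=.
  by rewrite (lin_upd_eq (a := fun y => (int_of_code c y)%:~R))//= oo.
Qed.

Lemma mean_lin g (S : {set 'I_n}) o : mean (X g) S ord0 o =
  \sum_y ((#|S|%:R)^-1 * (y \in S)%:R) * X g y ord0 o.
Proof.
rewrite mean_coord mulr_sumr big_mkcond; apply: eq_bigr => y _.
by case: (y \in S); rewrite ?mulr1 ?mulr0 ?mul0r.
Qed.

(** The means of four sets are compared with the mean of the first. In each difference a point of
    its own set has slope at least 1 / n, and by disjointness it occurs in no other difference. *)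
Lemma pcover_clump kap (tau : R) : 0 <= tau ->
  pcover sigma [set g | clump_bad kap tau (X g)]%classic
    (((n.+1 ^ kap) ^ 5)%:R * (n%:R * tau / sigma) ^+ (4 * d)).
Proof.
move=> tau0; pose J := {ffun 'I_5 -> {ffun 'I_kap -> option 'I_n}}.
have -> : ((n.+1 ^ kap) ^ 5)%N = #|{: J}|.
  by rewrite !card_ffun card_option !card_ord.
have p0 : 0 <= n%:R * tau / sigma by rewrite divr_ge0 ?mulr_ge0// ltW.
pose D (c : J) a : {set 'I_n} := [set x | [exists s, c a s == Some x]]%SET.
pose B (c : J) : set (I -> R) := fun g => [/\ forall a, (0 < #|D c a|)%N,
  forall a b, a != b -> [disjoint D c a & D c b] &
  forall a b o, `|mean (X g) (D c a) ord0 o - mean (X g) (D c b) ord0 o| <= tau].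
apply: (@pcover_sub _ _ _ _ [set g | exists c, B c g]%classic).
  move=> g [S [S0 Sd Sm]].
  pose c : J := [ffun a => [ffun s : 'I_kap => nth None [seq Some x | x <- enum (S a)] s]].
  have DE a : D c a = S a.
    apply/finset.setP => x; rewrite inE; apply/existsP/idP => [[s]|xS].
      rewrite !ffunE; have [lt|ge] := ltnP s (size (enum (S a))); last first.
        by rewrite nth_default// size_map.
      rewrite (nth_map x)// => /eqP[<-]; rewrite -mem_enum; exact: mem_nth.
    have xe : x \in enum (S a) by rewrite mem_enum.
    have lt : (index x (enum (S a)) < kap)%N.
      by rewrite (leq_trans _ (andP (S0 a)).2)// cardE index_mem.
    by exists (Ordinal lt); rewrite !ffunE /= (nth_map x) ?index_mem// nth_index.
  exists c; split.
  - by move=> a; rewrite DE; have /andP[] := S0 a.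
  - by move=> a b; rewrite !DE; exact: Sd.
  - by move=> a b o; rewrite !DE; exact: Sm.
apply: pcover_bigU => [|c]; first exact: exprn_ge0.
have [[ne dis]|no] := pselect ((forall a, (0 < #|D c a|)%N) /\
    forall a b, a != b -> [disjoint D c a & D c b]); last first.
  apply: (@pcover_sub _ _ _ _ set0); first by move=> g [H1 H2 _]; exact: no.
  by apply: pcover0; exact: exprn_ge0.
have /choice[xx xxD] : forall a, exists x, x \in D c a.
  by move=> a; apply/finset.set0Pn; rewrite -card_gt0.
have sz : size (enum {: 'I_4 * 'I_d}) = (4 * d)%N by rewrite -cardE card_prod !card_ord.
rewrite -sz.
pose F (l : 'I_4 * 'I_d) g := mean (X g) (D c (lift ord0 l.1)) ord0 l.2 - mean (X g) (D c ord0) ord0 l.2.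
pose co (l : 'I_4 * 'I_d) y : R := (#|D c (lift ord0 l.1)|%:R)^-1 * (y \in D c (lift ord0 l.1))%:R -
   (#|D c ord0|%:R)^-1 * (y \in D c ord0)%:R.
have FE l g : F l g = \sum_y co l y * X g y ord0 l.2.
  by rewrite /F !mean_lin -sumrB; apply: eq_bigr => y _; rewrite -mulrBl.
have notin a b : a != b -> (xx a \in D c b) = false.
  move=> ab; have := dis a b ab; rewrite disjoint_subset => /fintype.subsetP/(_ _ (xxD a)).
  by rewrite inE => /negbTE.
apply: (@pcover_chain_line _ _ _ _ _ _ (fun l => (xx (lift ord0 l.1), l.2))
  (fun l => [set g | `|F l g| <= tau]%classic)) => //.
- exact: enum_uniq.
- by move=> g [_ _ H] l _; exact: H.
- move=> l _; apply: (@measurable_norm_le _ (coordT R I)).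
  by rewrite (_ : F l = fun g => \sum_y co l y * X g y ord0 l.2); [exact: measurable_lin|apply/funext => g; exact: FE].
- move=> l g _; set a := lift ord0 l.1.
  have n1 : (0 : R) < n%:R by rewrite ltr0n; exact: leq_ltn_trans (ltn_ord (xx a)).
  have a0 : 0 < (n%:R : R)^-1 by rewrite invr_gt0.
  rewrite (_ : n%:R * tau / sigma = tau / (sigma * (n%:R)^-1)); last first.
    by field; rewrite !gt_eqF.
  apply: (@normal_prob_affine _ _ _ sigma0 (F l) g (xx a, l.2) tau _ tau0 a0).
  exists (co l (xx a)); eexists; split; last first.
    by move=> t; rewrite FE; exact: lin_upd.
  have cpos : (0 : R) < #|D c a|%:R by rewrite ltr0n ne.
  rewrite /co -/a xxD notin// mulr1 mulr0 subr0 gtr0_norm ?invr_gt0// lef_pV2 ?posrE//.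
  by rewrite ler_nat -[leqRHS]card_ord max_card.
- move=> l l' _ _ ll g t /=; rewrite !FE lin_upd_eq//=.
  case: eqP => //= e; have ll1 : l.1 != l'.1.
    by apply: contraNneq ll => e1; rewrite (surjective_pairing l) e1 e -surjective_pairing.
  by rewrite /co !notin ?mulr0 ?subrr// (inj_eq lift_inj).
Qed.

End LinearCovers.

Section SlabCovers.
Context (R : realType) (sigma : R) (n k d : nat) (mu : 'I_n -> 'rV[R]_d).
Hypothesis sigma0 : 0 < sigma.
Local Notation I := ('I_n * 'I_d)%type.
Local Notation X := (pts mu).
Implicit Types (g : I -> R).

Lemma form_upd (u : 'I_d -> R) g x o t :
  \sum_o' u o' * X (upd g (x, o) t) x ord0 o' =
  u o * t + (u o * mu x ord0 o + \sum_(o' | o' != o) u o' * X g x ord0 o').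
Proof.
rewrite (bigD1 o)//= pts_upd eqxx addrA -mulrDr (addrC t); congr (_ + _).
apply: eq_bigr => o' oo; rewrite pts_upd ifF//.
by apply/negbTE; apply: contraNneq oo => -[->].
Qed.

Lemma measurable_form (u : 'I_d -> R) x :
  measurable_fun setT (fun g : coordT R I => \sum_o u o * X g x ord0 o : R).
Proof.
apply: measurable_sum => o; apply: measurable_funM; first exact: measurable_cst.
exact: measurable_pts.
Qed.

Lemma measurable_sqdist x (c : coordT R I -> 'rV[R]_d) :
  (forall o, measurable_fun setT (fun g : coordT R I => c g ord0 o : R)) ->
  measurable_fun setT (fun g : coordT R I => sqdist (X g x) (c g) : R).
Proof.
move=> mc; apply: measurable_sum => o; apply: measurable_funX.
apply: measurable_funB; [exact: measurable_pts|exact: mc].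
Qed.

Lemma sqdistB_upd (a b : 'rV[R]_d) g x o : exists be, forall t,
  sqdist (X (upd g (x, o) t) x) a - sqdist (X (upd g (x, o) t) x) b =
  2 * (b ord0 o - a ord0 o) * t + be.
Proof.
eexists => t; rewrite sqdistB.
have -> : \sum_o' (b ord0 o' - a ord0 o') * (2 * X (upd g (x, o) t) x ord0 o' - a ord0 o' - b ord0 o') =
  \sum_o' (2 * (b ord0 o' - a ord0 o')) * X (upd g (x, o) t) x ord0 o' +
  \sum_o' (b ord0 o' - a ord0 o') * (- a ord0 o' - b ord0 o').
  by rewrite -big_split/=; apply: eq_bigr => o' _; ring.
by rewrite (form_upd (fun o' => 2 * (b ord0 o' - a ord0 o'))) -addrA.
Qed.

(** The normal is rounded with step e / R0, since it multiplies coordinates up to R0, and the offset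
    with step [e]. Afterwards the [kap] points are independent, and the coordinate of modulus one
    keeps slope at least 1 / 2. *)
Lemma pcover_hyper kap (tau R0 e : R) : (0 < kap)%N -> (0 < d)%N ->
  0 <= tau -> 0 < e -> 2 * e <= R0 ->
  exists N1 N2 : nat, [/\ N1%:R <= 2 * R0 / e + 2, N2%:R <= 2 * (tau + d%:R * R0) / e + 2 &
  pcover sigma [set g | (forall x o, `|X g x ord0 o| <= R0) /\ hyper_bad kap tau (X g)]%classic
    ((N1 ^ d * N2 * d * n ^ kap)%:R * (2 * (tau + d%:R * e + e) / sigma) ^+ kap)].
Proof.
move=> kap0 d0 tau0 e0 eR; have R00 : 0 < R0 by lra.
have eR0 : 0 < e / R0 by rewrite divr_gt0.
have B20 : 0 <= tau + d%:R * R0 by rewrite addr_ge0// mulr_ge0// ltW.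
have [N1 [pt1 [N10 N1b H1]]] := grid ler01 eR0.
have [N2 [pt2 [N20 N2b H2]]] := grid B20 e0.
exists N1, N2; split => //; first by rewrite mulr1 invf_div mulrA in N1b.
pose J := ({ffun 'I_d -> 'I_N1} * 'I_N2 * 'I_d * {ffun 'I_kap -> 'I_n})%type.
have -> : (N1 ^ d * N2 * d * n ^ kap)%N = #|{: J}|.
  by rewrite !card_prod !card_ffun !card_ord.
pose w := tau + d%:R * e + e.
have w0 : 0 <= w by rewrite /w !addr_ge0 ?mulr_ge0// ltW.
have p0 : 0 <= 2 * w / sigma by rewrite divr_ge0 ?mulr_ge0// ltW.
pose u (c : J) o := pt1 (c.1.1.1 o).
pose E (c : J) s : set (I -> R) := fun g =>
  `|\sum_o u c o * X g (c.2 s) ord0 o - pt2 c.1.1.2| <= w.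
pose B (c : J) : set (I -> R) := fun g =>
  [/\ injective c.2, 2^-1 <= `|u c c.1.2| & forall s, E c s g].
apply: (@pcover_sub _ _ _ _ [set g | exists c, B c g]%classic).
  move=> g [XR [uu [gam [S [u1 [ostar uo] Sbig HS]]]]].
  have [x0 x0S] : exists x, x \in S by apply/finset.set0Pn; rewrite -card_gt0 (leq_ltn_trans _ Sbig).
  have gamB : `|gam| <= tau + d%:R * R0.
    have -> : gam = \sum_o uu o * X g x0 ord0 o - (\sum_o uu o * X g x0 ord0 o - gam) by ring.
    apply: le_trans (ler_normB _ _) _; rewrite addrC; apply: lerD; first exact: HS.
    apply: le_trans (ler_norm_sum _ _ _) _.
    apply: (@le_trans _ _ (\sum_(o < d) R0)); last by rewrite sumr_const card_ord mulr_natl.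
    by apply: ler_sum => o _; rewrite normrM -[leRHS]mul1r; apply: ler_pM.
  have /choice[cu Hcu] : forall o, exists i, `|uu o - pt1 i| <= e / R0 by move=> o; exact: H1.
  have [cg Hcg] := H2 _ gamB.
  pose e' := enum S.
  have ltS (s : 'I_kap) : (s < size e')%N by rewrite -cardE; apply: leq_trans (ltnW Sbig).
  exists ([ffun o => cu o], cg, ostar, [ffun s : 'I_kap => nth x0 e' s]); split.
  - move=> s s'; rewrite !ffunE => /eqP.
    by rewrite nth_uniq ?ltS ?enum_uniq// => /eqP/val_inj.
  - rewrite /u /= ffunE; have := Hcu ostar; have := ler_distD 0 (uu ostar) (pt1 (cu ostar)).
    have := ler_normB (uu ostar) (uu ostar - pt1 (cu ostar)).
    rewrite (_ : uu ostar - (uu ostar - _) = pt1 (cu ostar)); last by ring.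
    have h2 : e / R0 <= 2^-1 by rewrite ler_pdivrMr//; lra.
    have := ler_normD (pt1 (cu ostar)) (uu ostar - pt1 (cu ostar)).
    rewrite (_ : pt1 (cu ostar) + _ = uu ostar); last by ring.
    rewrite uo; lra.
  - move=> s; rewrite /E /u /= ffunE.
    set x := nth _ _ _; have xS : x \in S by rewrite -mem_enum mem_nth// ltS.
    have -> : \sum_o pt1 ([ffun o => cu o] o) * X g x ord0 o - pt2 cg =
      (\sum_o uu o * X g x ord0 o - gam) - (\sum_o (uu o - pt1 (cu o)) * X g x ord0 o) + (gam - pt2 cg).
      transitivity (\sum_o uu o * X g x ord0 o - \sum_o (uu o - pt1 (cu o)) * X g x ord0 o - pt2 cg).
        congr (_ - _); rewrite -sumrB; apply: eq_bigr => o _; rewrite ffunE; ring.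
      by ring.
    apply: le_trans (ler_normD _ _) _; apply: lerD => //.
    apply: le_trans (ler_normB _ _) _; apply: lerD; first exact: HS.
    apply: le_trans (ler_norm_sum _ _ _) _.
    rewrite (_ : d%:R * e = \sum_(o < d) e); last by rewrite sumr_const card_ord mulr_natl.
    apply: ler_sum => o _; rewrite normrM -[leRHS](divfK (lt0r_neq0 R00)).
    by apply: ler_pM.
apply: pcover_bigU => [|c]; first exact: exprn_ge0.
have [[inj uc]|no] := pselect (injective c.2 /\ 2^-1 <= `|u c c.1.2|); last first.
  apply: (@pcover_sub _ _ _ _ set0); first by move=> g [H1' H2' _]; exact: no.
  by apply: pcover0; exact: exprn_ge0.
rewrite -[X in _ ^+ X](size_enum_ord kap).
apply: (@pcover_chain_line _ _ _ _ _ _ (fun s => (c.2 s, c.1.2)) (E c)) => //.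
- exact: enum_uniq.
- by move=> g [_ _ H] s _; exact: H.
- move=> s _; apply: (@measurable_norm_le _ (coordT R I)).
  by apply: measurable_funB; [exact: measurable_form|exact: measurable_cst].
- move=> s g _.
  have := @normal_prob_affine _ _ _ sigma0 (fun g => \sum_o u c o * X g (c.2 s) ord0 o - pt2 c.1.1.2) g (c.2 s, c.1.2) w 2^-1 w0.
  rewrite (_ : w / (sigma * 2^-1) = 2 * w / sigma); last by field; rewrite gt_eqF.
  apply; first by rewrite invr_gt0.
  exists (u c c.1.2); eexists; split => // t.
  by rewrite form_upd -addrA.
- move=> s s' _ _ ss g t; rewrite /E pts_upd_neq//=.
  by apply: contraNneq ss => /inj ->.
Qed.

(** With all centers rounded, the separation falls from theta to theta / 2; the slope is twice the
    separation, hence still at least theta. Distinct points then give independent tests. *)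
Lemma pcover_slab N (R0 R1 w theta e : R) : (0 < N)%N -> (0 < d)%N ->
  0 <= R0 -> 0 <= R1 -> 0 <= w -> 0 < e -> 4 * e <= theta ->
  let w' := w + 2 * (d%:R * (e * (2 * R0 + 2 * R1 + e))) in
  exists N1 : nat, N1%:R <= 2 * R1 / e + 2 /\
  pcover sigma [set g | (forall x o, `|X g x ord0 o| <= R0) /\ slab_bad k N R1 w theta (X g)]%classic
    ((N1 ^ (k * d) * (n * (k * k) * d) ^ N)%:R * (w' / (sigma * theta)) ^+ N).
Proof.
move=> N0 d0 R00 R10 w0 e0 et w'.
have th0 : 0 < theta by lra.
have [N1 [pt1 [N10 N1b H1]]] := grid R10 e0.
exists N1; split => //.
pose J := ({ffun 'I_k * 'I_d -> 'I_N1} * {ffun 'I_N -> move n k * 'I_d})%type.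
have -> : (N1 ^ (k * d) * (n * (k * k) * d) ^ N)%N = #|{: J}|.
  by rewrite !card_prod !card_ffun !card_prod !card_ord.
have M0 : 0 <= 2 * R0 + 2 * R1 + e by lra.
have w'0 : 0 <= w' by rewrite /w' addr_ge0 ?mulr_ge0// ltW.
have p0 : 0 <= w' / (sigma * theta) by rewrite divr_ge0 ?mulr_ge0// ltW.
pose ce (c : J) i : 'rV[R]_d := \row_o pt1 (c.1 (i, o)).
pose mv (c : J) s : move n k := (c.2 s).1.
pose E (c : J) s : set (I -> R) := fun g =>
  `|sqdist (X g (mv c s).1) (ce c (mv c s).2.1) - sqdist (X g (mv c s).1) (ce c (mv c s).2.2)| <= w'.
pose B (c : J) : set (I -> R) := fun g =>
  [/\ injective (fun s => (mv c s).1),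
    forall s, theta / 2 <= `|ce c (mv c s).2.1 ord0 (c.2 s).2 - ce c (mv c s).2.2 ord0 (c.2 s).2| & forall s, E c s g].
apply: (@pcover_sub _ _ _ _ [set g | exists c, B c g]%classic).
  move=> g [XR [cc [L [szL uL HL]]]].
  have [t0 t0L] : exists t0, t0 \in L by move: szL N0; case: (L) => [<-//|t s] _ _; exists t; rewrite mem_head.
  have /choice[oo Hoo] : forall t, exists o, t \in L -> theta <= `|cc t.2.1 ord0 o - cc t.2.2 ord0 o|.
    move=> t; have [tL|_] := boolP (t \in L); last by exists (Ordinal d0).
    by have [_ _ _ [wo hw]] := HL t tL; exists wo.
  have /choice[rn Hrn] : forall io, exists j : 'I_N1, `|cc io.1 ord0 io.2| <= R1 ->
      `|cc io.1 ord0 io.2 - pt1 j| <= e.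
    move=> io; have [h|_] := boolP (`|cc io.1 ord0 io.2| <= R1).
      by have [j Hj] := H1 _ h; exists j.
    by exists (Ordinal N10).
  pose c : J := ([ffun io => rn io], [ffun s : 'I_N => (nth t0 L s, oo (nth t0 L s))]).
  have mvE s : mv c s = nth t0 L s by rewrite /mv /c /= ffunE.
  have mvL s : mv c s \in L by rewrite mvE mem_nth// szL.
  have near i : (forall o, `|cc i ord0 o| <= R1) -> forall o, `|cc i ord0 o - ce c i ord0 o| <= e.
    by move=> h o; rewrite /ce mxE /c /= ffunE; exact: (Hrn (i, o)).
  have dist x i : (forall o, `|cc i ord0 o| <= R1) ->
      `|sqdist (X g x) (cc i) - sqdist (X g x) (ce c i)| <= d%:R * (e * (2 * R0 + 2 * R1 + e)).
    move=> h; apply: sqdist_approx => o; first by rewrite distrC; exact: near.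
    have := near i h o; have := h o; have := XR x o.
    by rewrite !ler_norml => /andP[? ?] /andP[? ?] /andP[? ?]; apply/andP; split; lra.
  exists c; split.
  - move=> s s' /=; rewrite !mvE => h; apply/val_inj/eqP.
    have lt (r : 'I_N) : (r < size (unzip1 L))%N by rewrite size_map szL.
    rewrite -(nth_uniq t0.1 (lt s) (lt s') uL) /unzip1 !(nth_map t0) ?szL//.
    by rewrite h.
  - move=> s; have [h1 h2 _ _] := HL _ (mvL s); have := Hoo _ (mvL s).
    have -> : (c.2 s).2 = oo (mv c s) by rewrite mvE /c /= ffunE.
    have := near _ h1 (oo (mv c s)); have := near _ h2 (oo (mv c s)).
    set a := cc _ _ _; set a' := ce _ _ _ _; set b := cc _ _ _; set b' := ce _ _ _ _ => n1 n2 n3.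
    have : `|b - a| <= `|b - b'| + `|a - a'| + `|b' - a'|.
      have -> : b - a = (b - b') - (a - a') + (b' - a') by ring.
      by apply: le_trans (ler_normD _ _) _; rewrite lerD2r ler_normB.
    lra.
  - move=> s; rewrite /E; have [h1 h2 h3 _] := HL _ (mvL s).
    have := dist (mv c s).1 _ h1; have := dist (mv c s).1 _ h2; move: h3.
    set a := sqdist _ _; set b := sqdist _ _; set b' := sqdist _ (ce _ _); set a' := sqdist _ (ce _ _) => n1 n2 n3.
    have : `|a' - b'| <= `|a - b| + `|b - b'| + `|a - a'|.
      have -> : a' - b' = (a - b) + (b - b') - (a - a') by ring.
      by apply: le_trans (ler_normB _ _) _; rewrite lerD2r ler_normD.
    rewrite /w'; lra.
apply: pcover_bigU => [|c]; first exact: exprn_ge0.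
have [[inj slope]|no] := pselect (injective (fun s => (mv c s).1) /\
    forall s, theta / 2 <= `|ce c (mv c s).2.1 ord0 (c.2 s).2 - ce c (mv c s).2.2 ord0 (c.2 s).2|); last first.
  apply: (@pcover_sub _ _ _ _ set0); first by move=> g [H1' H2' _]; exact: no.
  by apply: pcover0; exact: exprn_ge0.
rewrite -[X in _ ^+ X](size_enum_ord N).
apply: (@pcover_chain_line _ _ _ _ _ _ (fun s => ((mv c s).1, (c.2 s).2)) (E c)) => //.
- exact: enum_uniq.
- by move=> g [_ _ H] s _; exact: H.
- move=> s _; apply: (@measurable_norm_le _ (coordT R I)).
  by apply: measurable_funB; apply: measurable_sqdist => o; exact: measurable_cst.
- move=> s g _.
  apply: (@normal_prob_affine _ _ _ sigma0 (fun g => sqdist (X g (mv c s).1) (ce c (mv c s).2.1) - sqdist (X g (mv c s).1) (ce c (mv c s).2.2)) g ((mv c s).1, (c.2 s).2) w' theta w'0 th0).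
  have [be Hbe] := sqdistB_upd (ce c (mv c s).2.1) (ce c (mv c s).2.2) g (mv c s).1 (c.2 s).2.
  eexists; exists be; split; last exact: Hbe.
  rewrite normrM ger0_norm//; have := slope s; rewrite distrC; lra.
- move=> s s' _ _ ss g t; rewrite /E pts_upd_neq//=.
  by apply: contraNneq ss => /inj ->.
Qed.

End SlabCovers.

Lemma option_code (T : eqType) (N : nat) (G : seq T) : (size G <= N)%N ->
  exists c : {ffun 'I_N -> option T}, pmap id [seq c s | s <- enum 'I_N] = G.
Proof.
move=> GN; exists [ffun s : 'I_N => nth None (map Some G) s].
have -> : [seq [ffun s : 'I_N => nth None (map Some G) s] s | s <- enum 'I_N] =
    map Some G ++ nseq (N - size G) None.
  apply: (@eq_from_nth _ None).
    by rewrite size_map size_enum_ord size_cat size_map size_nseq subnKC.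
  move=> i; rewrite size_map size_enum_ord => iN.
  rewrite (nth_map (Ordinal iN)) ?size_enum_ord// ffunE (nth_enum_ord _ iN)//.
  rewrite nth_cat; case: ifP => // /negbT; rewrite -leqNgt => h.
  by rewrite nth_default// nth_nseq; case: ifP.
rewrite pmap_cat (_ : pmap id (nseq _ None) = [::]) ?cats0.
  by elim: (G) => //= x s ->.
by elim: (_ - _)%N.
Qed.

(** * Events whose centers depend on the moving points *)

Section MoveCovers.
Context (R : realType) (sigma : R) (n k d : nat) (mu : 'I_n -> 'rV[R]_d).
Hypothesis sigma0 : 0 < sigma.
Local Notation I := ('I_n * 'I_d)%type.
Local Notation X := (pts mu).
Implicit Types (g : I -> R) (G : seq (move n k)).

Definition mweight G (j : 'I_k) (x : 'I_n) : int := \sum_(t <- G | t.1 == x) msign j t.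

Lemma mweightE G j x m : uniq (unzip1 G) -> (x, m) \in G -> mweight G j x = msign j (x, m).
Proof.
elim: G => [//|[y m'] G IH] /=; rewrite /mweight big_cons inE => /andP[yG uG] /=.
have [e|ne] := eqVneq y x.
  have nG : forall m'', (x, m'') \notin G.
    by move=> m''; apply: contra yG => h; rewrite e; apply/mapP; exists (x, m'').
  rewrite (negbTE (nG m)) orbF => /eqP[_ ->]; rewrite e big_seq_cond big1 ?addr0//.
  by move=> [z m''] /= /andP[zG /eqP zx]; rewrite zx (negbTE (nG _)) in zG.
rewrite xpair_eqE eq_sym (negbTE ne) /=; exact: IH.
Qed.

Lemma mcenter_upd G g x o t j o' :
  mcenter G (X (upd g (x, o) t)) j ord0 o' = mcenter G (X g) j ord0 o' +
  (o' == o)%:R * (mweight G j x)%:~R * (t - g (x, o)) / (mnet G j)%:~R.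
Proof.
rewrite !mxE -mulrDl; congr (_ / _).
rewrite /mweight rmorph_sum/= -mulrA mulr_suml mulr_sumr [X in _ + X]big_mkcond -big_split/=.
apply: eq_bigr => m _; rewrite pts_upd xpair_eqE.
case: eqP => [->|_] /=; last by rewrite addr0.
case: eqP => [->|_] /=; last by rewrite mul0r addr0.
by rewrite ptsE; ring.
Qed.

Lemma measurable_mcenter G j o :
  measurable_fun setT (fun g : coordT R I => mcenter G (X g) j ord0 o : R).
Proof.
rewrite (_ : (fun g => _) = (fun g : coordT R I =>
    (mnet G j)%:~R^-1 * \sum_(t <- G) (msign j t)%:~R * X g t.1 ord0 o)); last first.
  by apply/funext => g; rewrite mxE mulrC.
apply: measurable_funM; first exact: measurable_cst.
apply: measurable_sum => t; apply: measurable_funM; first exact: measurable_cst.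
exact: measurable_pts.
Qed.

Lemma msign_le j (t : move n k) : `|msign j t| <= 1.
Proof. by rewrite /msign; case: (t.2.1 == j); case: (t.2.2 == j). Qed.

Lemma mnet_le G j : `|mnet G j| <= (size G)%:Z.
Proof.
apply: le_trans (ler_norm_sum _ _ _) _.
apply: le_trans (ler_sum _ (fun t _ => msign_le j t)) _.
by rewrite big_const_seq count_predT iter_addr addr0 -natz.
Qed.

(* Opposite shifts of two points with the same move cancel in every center, so
   such a pair can be resampled with all centers of type [mcenter] fixed. *)
Lemma mcenter_diag G g a b m o t u j : uniq (unzip1 G) -> a != b ->
  (a, m) \in G -> (b, m) \in G ->
  mcenter G (X (upd (upd g (a, o) t) (b, o) (u - t))) j =
  mcenter G (X (upd (upd g (a, o) 0) (b, o) u)) j.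
Proof.
move=> uG ab aG bG; apply/rowP => o'.
have e s : upd g (a, o) s (b, o) = g (b, o).
  by rewrite /upd xpair_eqE eq_sym (negbTE ab).
rewrite !mcenter_upd !e !(mweightE _ uG aG) !(mweightE _ uG bG).
have -> : msign j (b, m) = msign j (a, m) by [].
set s := _%:~R; set p := _%:~R^-1; set z := (_ == _)%:R; ring.
Qed.

Lemma center_round (cc ce x : 'rV[R]_d) (e R0 R1 : R) : 0 < e ->
  (forall o, `|cc ord0 o| <= R1) -> (forall o, `|cc ord0 o - ce ord0 o| <= e) ->
  (forall o, `|x ord0 o| <= R0) ->
  `|sqdist x cc - sqdist x ce| <= d%:R * (e * (2 * R0 + 2 * R1 + e)).
Proof.
move=> e0 cR near xR; apply: sqdist_approx => o; first by rewrite distrC; exact: near.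
have := near o; have := cR o; have := xR o.
by rewrite !ler_norml => /andP[? ?] /andP[? ?] /andP[? ?]; apply/andP; split; lra.
Qed.

(** Given the moves, only the [d] coordinates of the center of [i] are rounded. Along the
    antidiagonal of [a] and [b] all centers [mcenter] are fixed, so the test at the pair is affine
    and the other tests do not change. *)
Lemma pcover_pair N4 N5 (R0 R1 w theta e : R) : (0 < N5)%N -> (0 < d)%N ->
  0 <= R0 -> 0 <= R1 -> 0 <= w -> 0 < e -> 2 * e <= theta ->
  let w' := w + d%:R * (e * (2 * R0 + 2 * R1 + e)) in
  exists N1 : nat, N1%:R <= 2 * R1 / e + 2 /\
  pcover sigma [set g | (forall x o, `|X g x ord0 o| <= R0) /\ pair_bad k N4 N5 R1 w theta (X g)]%classic
    (((n * (k * k)).+1 ^ N4 * k * N1 ^ d * (n * n * k * d) ^ N5)%:R * (2 * w' / theta / sigma) ^+ N5).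
Proof.
move=> N50 d0 R00 R10 w0 e0 et w'.
have th0 : 0 < theta by lra.
have [N1 [pt1 [N10 N1b H1]]] := grid R10 e0.
exists N1; split => //.
pose J := ({ffun 'I_N4 -> option (move n k)} * 'I_k * {ffun 'I_d -> 'I_N1} *
  {ffun 'I_N5 -> 'I_n * 'I_n * 'I_k * 'I_d})%type.
have -> : ((n * (k * k)).+1 ^ N4 * k * N1 ^ d * (n * n * k * d) ^ N5)%N = #|{: J}|.
  by rewrite !card_prod !card_ffun card_option !card_prod !card_ord.
have M0 : 0 <= 2 * R0 + 2 * R1 + e by lra.
have w'0 : 0 <= w' by rewrite /w' addr_ge0 ?mulr_ge0// ltW.
have p0 : 0 <= 2 * w' / theta by rewrite divr_ge0 ?mulr_ge0// ltW.
pose GG (c : J) := pmap id [seq c.1.1.1 s | s <- enum 'I_N4].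
pose ce (c : J) : 'rV[R]_d := \row_o pt1 (c.1.2 o).
pose la (c : J) s := (c.2 s).1.1.1; pose lb (c : J) s := (c.2 s).1.1.2.
pose lj (c : J) s := (c.2 s).1.2; pose lo (c : J) s := (c.2 s).2.
(* The separation is part of the event because it depends on a random center. It is constant along
   the antidiagonal, where either it fails or the slope is at least [theta]. *)
pose E (c : J) s : set (I -> R) := fun g =>
  `|sqdist (X g (la c s)) (ce c) - sqdist (X g (la c s)) (mcenter (GG c) (X g) (lj c s))| <= w' /\
  theta / 2 <= `|ce c ord0 (lo c s) - mcenter (GG c) (X g) (lj c s) ord0 (lo c s)|.
pose C (c : J) : Prop := [/\ uniq (unzip1 (GG c)),
  forall s s', la c s != lb c s',
  forall s s', s != s' -> la c s != la c s' /\ lb c s != lb c s' &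
  forall s, exists m, (la c s, m) \in GG c /\ (lb c s, m) \in GG c].
pose B (c : J) : set (I -> R) := fun g => C c /\ forall s, E c s g.
apply: (@pcover_sub _ _ _ _ [set g | exists c, B c g]%classic).
  move=> g [XR [G [i [ci [L [[szG uG] szL uL ciR HL]]]]]].
  have [l0 l0L] : exists l0, l0 \in L by move: szL N50; case: (L) => [<-//|t s] _ _; exists t; rewrite mem_head.
  have /choice[oo Hoo] : forall l, exists o, l \in L ->
      theta <= `|ci ord0 o - mcenter G (X g) l.2 ord0 o|.
    move=> l; have [lL|_] := boolP (l \in L); last by exists (Ordinal d0).
    by move: lL; case: l => [[a b] j] /HL[_ _ _ _ [wo hw]]; exists wo.
  have /choice[rn Hrn] : forall o, exists j : 'I_N1, `|ci ord0 o - pt1 j| <= e.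
    by move=> o; exact: H1.
  have [cG HG] := option_code szG.
  pose c : J := (cG, i, [ffun o => rn o], [ffun s : 'I_N5 => (nth l0 L s, oo (nth l0 L s))]).
  have GE : GG c = G by [].
  have lt (s : 'I_N5) : (s < size L)%N by rewrite szL.
  have c2 s : c.2 s = (nth l0 L s, oo (nth l0 L s)) by rewrite /c /= ffunE.
  have sL (s : 'I_N5) : nth l0 L s \in L by apply: mem_nth; exact: lt.
  have near o : `|ci ord0 o - ce c ord0 o| <= e by rewrite /ce mxE /c /= ffunE; exact: Hrn.
  move: uL; rewrite cat_uniq => /and3P[ua /hasPn disj ub].
  have aE s : la c s = nth l0.1.1 (unzip1 (unzip1 L)) s.
    by rewrite /la c2 /unzip1 -map_comp (nth_map l0).
  have bE s : lb c s = nth l0.1.2 (unzip2 (unzip1 L)) s.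
    by rewrite /lb c2 /unzip1 /unzip2 -map_comp (nth_map l0).
  have ina s : la c s \in unzip1 (unzip1 L) by rewrite aE mem_nth// !size_map.
  have inb s : lb c s \in unzip2 (unzip1 L) by rewrite bE mem_nth// !size_map.
  exists c; split.
    split; rewrite ?GE//.
    - by move=> s s'; apply/eqP => h; have /negP := disj _ (inb s'); apply; rewrite -h; exact: ina.
    - by move=> s s' ss; rewrite !aE !bE !nth_uniq ?size_map.
    - move=> s; have := HL _ (sL s); rewrite /la /lb c2 /=.
      case: (nth l0 L s) => [[a b] j] /= [_ _ H _ _].
      by case/orP: H => /andP[h1 h2]; [exists (i, j)|exists (j, i)].
  move=> s; have := HL _ (sL s); have := Hoo _ (sL s); rewrite /E GE /la /lj /lo c2 /=.
  case: (nth l0 L s) => [[a b] j] /= Ho [_ _ _ Hw _]; split.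
    have := center_round (x := X g a) e0 ciR near (XR a); move: Hw.
    set A := sqdist _ ci; set A' := sqdist _ (ce c); set M := sqdist _ (mcenter _ _ _) => h1 h2.
    have : `|A' - M| <= `|A - M| + `|A - A'|.
      have -> : A' - M = (A - M) - (A - A') by ring.
      exact: ler_normB.
    rewrite /w'; lra.
  move: Ho; set M := mcenter _ _ _ _ _; set o := oo _; have := near o.
  have : `|ci ord0 o - M| <= `|ci ord0 o - ce c ord0 o| + `|ce c ord0 o - M|.
    have -> : ci ord0 o - M = (ci ord0 o - ce c ord0 o) + (ce c ord0 o - M) by ring.
    exact: ler_normD.
  lra.
apply: pcover_bigU => [|c]; first by rewrite exprn_ge0// divr_ge0// ltW.
have [[uG dab dd mem]|no] := pselect (C c); last first.
  apply: (@pcover_sub _ _ _ _ set0); first by move=> g [H _]; exact: no.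
  by apply: pcover0; rewrite exprn_ge0// divr_ge0// ltW.
rewrite -[X in _ ^+ X](size_enum_ord N5).
apply: (@pcover_chain_diag _ _ _ sigma0 _ _ _ (fun s => (la c s, lo c s)) (fun s => (lb c s, lo c s)) (E c)) => //.
- exact: enum_uniq.
- by move=> g [_ H] s _; exact: H.
- move=> s _; apply: measurableI.
    apply: (@measurable_norm_le _ (coordT R I)).
    apply: measurable_funB; apply: measurable_sqdist => o; first exact: measurable_cst.
    exact: measurable_mcenter.
  apply: (@measurable_norm_ge _ (coordT R I)).
  by apply: measurable_funB; [exact: measurable_cst|exact: measurable_mcenter].
- by move=> s _; rewrite xpair_eqE negb_and dab.
- move=> s g u _; set a := la c s; set b := lb c s; set o := lo c s; set j := lj c s.
  have [m [ma mb]] := mem s.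
  pose M := mcenter (GG c) (X (upd (upd g (a, o) 0) (b, o) u)) j.
  have ME t : mcenter (GG c) (X (upd (upd g (a, o) t) (b, o) (u - t))) j = M.
    by apply: mcenter_diag ma mb => //; exact: dab.
  have [be Hbe] := sqdistB_upd mu (ce c) M g a o.
  set sl := 2 * (M ord0 o - ce c ord0 o) in Hbe.
  have EE t : E c s (upd (upd g (a, o) t) (b, o) (u - t)) ->
      `|sl * t + be| <= w' /\ theta <= `|sl|.
    rewrite /E -/a -/o -/j ME (pts_upd_neq _ _ (v := (b, o))) ?dab// Hbe => -[h1 h2].
    by split => //; rewrite /sl normrM ger0_norm// distrC; lra.
  have [ths|nth'] := leP theta `|sl|; last first.
    exists 0, 0; split => // [|t /EE[_]]; first by rewrite subrr.
    by rewrite leNgt nth'.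
  have sl0 : 0 < `|sl| by lra.
  exists (- be / sl - w' / `|sl|), (- be / sl + w' / `|sl|); split.
  + by have : 0 <= w' / `|sl|; [rewrite divr_ge0|lra].
  + rewrite (_ : _ - _ = 2 * w' / `|sl|); last by ring.
    by rewrite ler_wpM2l ?mulr_ge0// lef_pV2 ?posrE.
  + move=> t /EE[h _]; rewrite -ler_distl.
    rewrite -(ler_pM2l sl0) -normrM mulrCA divff ?gt_eqF// mulr1.
    rewrite (_ : sl * _ = sl * t + be)//; field.
    by rewrite -normr_gt0.
- move=> s s' _ _ ss g u t t'; rewrite /E.
  set a := la c s; set b := lb c s; set o := lo c s.
  have [m [ma mb]] := mem s.
  have [daa dbb] := dd s s' ss.
  have aX r : X (upd (upd g (a, o) r) (b, o) (u - r)) (la c s') = X g (la c s').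
    by rewrite !pts_upd_neq//= 1?eq_sym// eq_sym dab.
  by rewrite !aX !(mcenter_diag g o _ u _ uG (dab s s) ma mb).
Qed.

(** Moving [a] by t moves the center by al t, so the leading coefficient is 1 - (1 - al)^2. *)
Lemma single_quad (G : seq (move n k)) (c : 'rV[R]_d) g a o j :
  let al := (mweight G j a)%:~R / (mnet G j)%:~R : R in exists b0 c0, forall t,
  sqdist (X (upd g (a, o) t) a) c - sqdist (X (upd g (a, o) t) a) (mcenter G (X (upd g (a, o) t)) j)
  = (al * (2 - al)) * t ^+ 2 + b0 * t + c0.
Proof.
move=> al; pose m := mu a ord0 o; pose mc := mcenter G (X g) j ord0 o.
exists (2 * (m - c ord0 o) - 2 * (1 - al) * (m - mc + al * g (a, o))).
exists ((m - c ord0 o) ^+ 2 - (m - mc + al * g (a, o)) ^+ 2 +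
  \sum_(o' | o' != o) ((X g a ord0 o' - c ord0 o') ^+ 2 - (X g a ord0 o' - mcenter G (X g) j ord0 o') ^+ 2)).
move=> t; rewrite /sqdist -sumrB (bigD1 o)//= pts_upd eqxx mcenter_upd eqxx.
under eq_bigr => o' oo.
  rewrite mcenter_upd (negbTE oo) !mul0r addr0 pts_upd xpair_eqE eqxx (negbTE oo) /=.
  over.
rewrite -/m -/mc mul1r [(mweight G j a)%:~R * _ / _]mulrAC -/al.
set S := \sum_(_ | _) _; ring.
Qed.

(** Here |al| is the inverse of a positive integer at most [N4], so |2 - al| >= 1 and the leading
    coefficient is at least 1 / N4. Shifting [a] moves only the derived centers of [i] and of its
    partner, and the tests use the rounded center for [i]. *)
Lemma pcover_single N4 N5 (R0 R1 w e : R) : (0 < N5)%N -> (0 < d)%N ->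
  0 <= R0 -> 0 <= R1 -> 0 <= w -> 0 < e ->
  let w' := w + d%:R * (e * (2 * R0 + 2 * R1 + e)) in
  exists N1 : nat, N1%:R <= 2 * R1 / e + 2 /\
  pcover sigma [set g | (forall x o, `|X g x ord0 o| <= R0) /\ single_bad k N4 N5 R1 w (X g)]%classic
    (((n * (k * k)).+1 ^ N4 * k * N1 ^ d * (n * k) ^ N5)%:R *
     (Num.sqrt (2 * w' * N4%:R) / sigma) ^+ N5).
Proof.
move=> N50 d0 R00 R10 w0 e0 w'.
have [N1 [pt1 [N10 N1b H1]]] := grid R10 e0.
exists N1; split => //.
pose J := ({ffun 'I_N4 -> option (move n k)} * 'I_k * {ffun 'I_d -> 'I_N1} *
  {ffun 'I_N5 -> 'I_n * 'I_k})%type.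
have -> : ((n * (k * k)).+1 ^ N4 * k * N1 ^ d * (n * k) ^ N5)%N = #|{: J}|.
  by rewrite !card_prod !card_ffun card_option !card_prod !card_ord.
have M0 : 0 <= 2 * R0 + 2 * R1 + e by lra.
have w'0 : 0 <= w' by rewrite /w' addr_ge0 ?mulr_ge0// ltW.
have p0 : 0 <= Num.sqrt (2 * w' * N4%:R) / sigma by rewrite divr_ge0 ?sqrtr_ge0// ltW.
pose GG (c : J) := pmap id [seq c.1.1.1 s | s <- enum 'I_N4].
pose ce (c : J) : 'rV[R]_d := \row_o pt1 (c.1.2 o).
pose la (c : J) s := (c.2 s).1; pose lj (c : J) s := (c.2 s).2; pose ii (c : J) := c.1.1.2.
pose o : 'I_d := Ordinal d0.
pose E (c : J) s : set (I -> R) := fun g =>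
  `|sqdist (X g (la c s)) (ce c) - sqdist (X g (la c s)) (mcenter (GG c) (X g) (lj c s))| <= w'.
pose C (c : J) : Prop := [/\ uniq (unzip1 (GG c)) /\ (size (GG c) <= N4)%N,
  forall s s', s != s' -> la c s != la c s' /\ lj c s != lj c s',
  forall s, mnet (GG c) (lj c s) != 0 /\ lj c s != ii c &
  forall s, exists m, (la c s, m) \in GG c /\ (m = (ii c, lj c s) \/ m = (lj c s, ii c))].
pose B (c : J) : set (I -> R) := fun g => C c /\ forall s, E c s g.
apply: (@pcover_sub _ _ _ _ [set g | exists c, B c g]%classic).
  move=> g [XR [G [i [ci [L [[szG uG] szL [ua uj] ciR HL]]]]]].
  have [l0 l0L] : exists l0, l0 \in L by move: szL N50; case: (L) => [<-//|t s] _ _; exists t; rewrite mem_head.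
  have /choice[rn Hrn] : forall o, exists j : 'I_N1, `|ci ord0 o - pt1 j| <= e.
    by move=> o'; exact: H1.
  have [cG HG] := option_code szG.
  pose c : J := (cG, i, [ffun o => rn o], [ffun s : 'I_N5 => nth l0 L s]).
  have GE : GG c = G by [].
  have lt (s : 'I_N5) : (s < size L)%N by rewrite szL.
  have c2 s : c.2 s = nth l0 L s by rewrite /c /= ffunE.
  have sL (s : 'I_N5) : nth l0 L s \in L by apply: mem_nth; exact: lt.
  have near o' : `|ci ord0 o' - ce c ord0 o'| <= e by rewrite /ce mxE /c /= ffunE; exact: Hrn.
  have aE s : la c s = nth l0.1 (unzip1 L) s by rewrite /la c2 (nth_map l0).
  have jE s : lj c s = nth l0.2 (unzip2 L) s by rewrite /lj c2 (nth_map l0).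
  exists c; split.
    split; rewrite ?GE//.
    - by move=> s s' ss; rewrite !aE !jE !nth_uniq ?size_map.
    - move=> s; have := HL _ (sL s); rewrite /lj c2 /=.
      by case: (nth l0 L s) => [a j] /= [? ? _ _].
    - move=> s; have := HL _ (sL s); rewrite /la /lj /ii c2 /=.
      case: (nth l0 L s) => [a j] /= [_ _ H _].
      by case/orP: H => h; [exists (i, j)|exists (j, i)]; split => //; [left|right].
  move=> s; have := HL _ (sL s); rewrite /E GE /la /lj c2 /=.
  case: (nth l0 L s) => [a j] /= [_ _ _ Hw].
  have := center_round (x := X g a) e0 ciR near (XR a); move: Hw.
  set A := sqdist _ ci; set A' := sqdist _ (ce c); set M := sqdist _ (mcenter _ _ _) => h1 h2.
  have : `|A' - M| <= `|A - M| + `|A - A'|.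
    have -> : A' - M = (A - M) - (A - A') by ring.
    exact: ler_normB.
  rewrite /w'; lra.
apply: pcover_bigU => [|c]; first exact: exprn_ge0.
have [[[uG szG] dd jj mem]|no] := pselect (C c); last first.
  apply: (@pcover_sub _ _ _ _ set0); first by move=> g [H _]; exact: no.
  by apply: pcover0; exact: exprn_ge0.
rewrite -[X in _ ^+ X](size_enum_ord N5).
apply: (@pcover_chain_line _ _ _ _ _ _ (fun s => (la c s, o)) (E c)) => //.
- exact: enum_uniq.
- by move=> g [_ H] s _; exact: H.
- move=> s _; apply: (@measurable_norm_le _ (coordT R I)).
  apply: measurable_funB; apply: measurable_sqdist => o'; first exact: measurable_cst.
  exact: measurable_mcenter.
- move=> s g _; rewrite /E; set a := la c s; set j := lj c s.
  have [b0 [c0 Hq]] := single_quad (GG c) (ce c) g a o j.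
  set al := _ / _ in Hq.
  have [p1 ji] := jj s; rewrite -/j in p1 ji.
  have [m [ma mm]] := mem s; rewrite -/a -/j in ma mm.
  have pr : 1 <= `|(mnet (GG c) j)%:~R : R|.
    by rewrite -intr_norm -[1]/(1%:~R) ler_int -gtz0_ge1 normr_gt0.
  have pN : `|(mnet (GG c) j)%:~R : R| <= N4%:R.
    rewrite -intr_norm; apply: (@le_trans _ _ (size (GG c))%:R); last by rewrite ler_nat.
    by have := mnet_le (GG c) j; rewrite -(ler_int R).
  have wt : `|(mweight (GG c) j a)%:~R : R| = 1.
    rewrite (mweightE _ uG ma) /msign; case: mm => -> /=; rewrite eqxx eq_sym (negbTE ji) /=.
      by rewrite subr0 normr1.
    by rewrite sub0r rmorphN1 normrN1.
  have p00 : 0 < `|(mnet (GG c) j)%:~R : R| by lra.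
  have alE : `|al| = `|(mnet (GG c) j)%:~R : R|^-1 by rewrite normrM normfV wt mul1r.
  have al1 : `|al| <= 1 by rewrite alE invf_le1.
  have N40 : (0 : R) < N4%:R by lra.
  have alN : (N4%:R)^-1 <= `|al| by rewrite alE lef_pV2.
  have al2 : 1 <= `|2 - al| by have := ler_norml al 1; rewrite al1 => /esym/andP[_ h]; rewrite ger0_norm; lra.
  have AN : (N4%:R)^-1 <= `|al * (2 - al)|.
    by rewrite normrM; apply: le_trans alN _; rewrite ler_peMr.
  have A0 : 0 < `|al * (2 - al)| by apply: lt_le_trans AN; rewrite invr_gt0.
  have A0' : al * (2 - al) != 0 by rewrite -normr_gt0.
  under eq_set => t do rewrite Hq.
  apply: le_trans (normal_prob_quad sigma0 b0 c0 A0' w'0) _.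
  rewrite lee_fin ler_wpM2r ?invr_ge0 ?(ltW sigma0)// ler_wsqrtr//.
  rewrite ler_wpM2l ?mulr_ge0// -[leRHS]invrK lef_pV2 ?posrE ?invr_gt0//.
- move=> s s' _ _ ss g t; rewrite /E.
  have [daa djj] := dd s s' ss.
  have [m [ma mm]] := mem s; have [_ ji] := jj s'.
  have -> : X (upd g (la c s, o) t) (la c s') = X g (la c s').
    by rewrite pts_upd_neq//= eq_sym.
  have -> : mcenter (GG c) (X (upd g (la c s, o) t)) (lj c s') = mcenter (GG c) (X g) (lj c s').
    apply/rowP => o'; rewrite mcenter_upd (mweightE _ uG ma) /msign.
    have z1 : (ii c == lj c s') = false by rewrite eq_sym (negbTE ji).
    have z2 : (lj c s == lj c s') = false by rewrite (negbTE djj).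
    by case: mm => -> /=; rewrite z1 z2 subrr mulr0 !mul0r addr0.
  by [].
Qed.

End MoveCovers.

Section TailCover.
Context (R : realType) (I : finType) (sigma : R).
Hypothesis sigma0 : 0 < sigma.

Lemma pcover_tail (a : R) : 0 <= a ->
  pcover sigma [set g : I -> R | exists i, a * sigma < `|g i|]%classic
    (#|I|%:R * (2 * expR (- (a ^+ 2 / 4)))).
Proof.
move=> a0; have p0 : 0 <= 2 * expR (- (a ^+ 2 / 4)) by rewrite mulr_ge0 ?expR_ge0.
apply: (pcover_bigU (S := fun i => [set g : I -> R | a * sigma < `|g i|]%classic)) => // i.
rewrite -[X in pcover _ _ X]expr1.
apply: (@pcover_chain_line _ _ _ _ _ [:: i] id (fun i => [set g | a * sigma < `|g i|]%classic)) => //.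
- by move=> g Hg j; rewrite inE => /eqP ->.
- move=> j _; have := @measurable_norm_le _ (coordT R I) R (fun g => g j) (a * sigma) (measurable_coord j).
  move=> /measurableC; congr measurable.
  by apply/seteqP; split => g /=; [move/negP; rewrite -ltNge|rewrite ltNge => /negP].
- move=> j g _; have := normal_prob_tail sigma0 a0; rewrite /upd.
  by congr (_ <= _)%E; congr (normal_prob _ _ _); apply/seteqP; split => t /=; rewrite eqxx.
- by move=> j j'; rewrite !inE => /eqP -> /eqP ->; rewrite eqxx.
Qed.

End TailCover.

(** Two of the points are resampled against the third, which makes two independent tests and hence a
    square. *)
Lemma pcover_three (R : realType) (sigma : R) (n : nat) (mu : 'I_n -> 'rV[R]_1) (eps : R) :
  0 < sigma -> 0 <= eps ->
  pcover sigma [set g | exists a b e, [/\ a != b, a != e, b != e,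
      `|pts mu g b ord0 ord0 - pts mu g a ord0 ord0| <= eps &
      `|pts mu g e ord0 ord0 - pts mu g a ord0 ord0| <= eps]]%classic
    ((n ^ 3)%:R * (eps / sigma) ^+ 2).
Proof.
move=> sigma0 eps0; pose J := ('I_n * 'I_n * 'I_n)%type.
have -> : (n ^ 3)%N = #|{: J}| by rewrite !card_prod !card_ord !expnS expn0 muln1 mulnA.
have p0 : 0 <= eps / sigma by rewrite divr_ge0// ltW.
pose y (c : J) (l : bool) := if l then c.1.2 else c.2.
pose F (c : J) l (g : 'I_n * 'I_1 -> R) := pts mu g (y c l) ord0 ord0 - pts mu g c.1.1 ord0 ord0.
pose B (c : J) : set ('I_n * 'I_1 -> R) := fun g =>
  [/\ c.1.1 != c.1.2, c.1.1 != c.2, c.1.2 != c.2 & forall l, `|F c l g| <= eps].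
apply: (@pcover_sub _ _ _ _ [set g | exists c, B c g]%classic).
  by move=> g [a [b [e [ab ae be h1 h2]]]]; exists (a, b, e); split => // -[].
apply: pcover_bigU => [|c]; first exact: exprn_ge0.
have [[ab ae be]|no] := pselect [/\ c.1.1 != c.1.2, c.1.1 != c.2 & c.1.2 != c.2]; last first.
  apply: (@pcover_sub _ _ _ _ set0); first by move=> g [? ? ? _]; apply: no; split.
  by apply: pcover0; exact: exprn_ge0.
have ya l : y c l != c.1.1 by case: l; rewrite eq_sym.
have yy l l' : l != l' -> y c l' != y c l by case: l; case: l' => //= _; rewrite // eq_sym.
apply: (@pcover_chain_line _ _ _ _ _ [:: true; false] (fun l => (y c l, ord0))
  (fun l => [set g | `|F c l g| <= eps]%classic)) => //.
- by move=> g [_ _ _ H] l _; exact: H.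
- move=> l _; apply: (@measurable_norm_le _ (coordT R _)).
  by apply: measurable_funB; exact: measurable_pts.
- move=> l g _.
  have := @normal_prob_affine _ _ _ sigma0 (F c l) g (y c l, ord0) eps 1 eps0 ltr01.
  rewrite mulr1; apply; exists 1; eexists; split; first by rewrite normr1.
  move=> t; rewrite /F pts_upd eqxx pts_upd_neq/=; last by rewrite eq_sym.
  by rewrite mul1r (addrC (mu _ _ _)) -addrA.
- move=> l l' _ _ ll g t; rewrite /F /= !pts_upd_neq//=; last exact: yy.
  by rewrite eq_sym.
Qed.

(** * Arithmetic of the union bounds *)

Ltac nonneg := solve [repeat (first [assumption | apply: ltW; assumption | exact: ler0n
  | apply: mulr_ge0 | apply: addr_ge0 | apply: exprn_ge0 | rewrite invr_ge0])].

Lemma exprM5 (R : comPzRingType) (x1 x2 x3 x4 x5 : R) m :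
  (x1 * x2 * x3 * x4 * x5) ^+ m = x1 ^+ m * x2 ^+ m * x3 ^+ m * x4 ^+ m * x5 ^+ m.
Proof. by rewrite !exprMn. Qed.

Section Absorb.
Context (R : realType) (n k d q : nat) (b t sigma eta theta R0 : R).
Hypothesis sigma0 : 0 < sigma.
Hypothesis eta0 : 0 < eta.
Hypothesis b2 : 2 <= b.
Hypothesis nb : n%:R <= b.
Hypothesis R0b : R0 <= b * sigma.
Hypothesis R00 : 0 < R0.
Hypothesis theta0 : 0 < theta.
Hypothesis thetaE : theta ^+ 2 = R0 * eta.
Hypothesis t0 : 0 < t.
Hypothesis tE : t ^+ 2 = b * (eta / sigma).
Hypothesis etaR : 4 * (n%:R * (n%:R * eta)) <= R0.
Hypothesis kn : (k <= n)%N.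
Hypothesis k0 : (0 < k)%N.
Hypothesis q0 : (0 < q)%N.
Hypothesis q2 : (k <= q * q)%N.
(* [b] dominates [n] and [R0 / sigma].  Only the powers of [n] carry the exponent
   [q], since the power of [1 / sigma] in the final bound must not depend on [k]. *)
Local Notation z := (n%:R ^+ (5 * (20 * 20 + 1) * q) * (b ^+ 28 * t)).
Hypothesis z1 : z <= 1.

Let b1 : 1 <= b. Proof. by move: b2; lra. Qed.
Let b0 : 0 <= b. Proof. by move: b2; lra. Qed.
Let bX m : 1 <= b ^+ m. Proof. exact: exprn_ege1. Qed.
Let bX0 m : 0 <= b ^+ m. Proof. exact: exprn_ge0. Qed.
Let kb : k%:R <= b. Proof. by apply: le_trans nb; rewrite ler_nat. Qed.
Let t0' : 0 <= t. Proof. exact: ltW. Qed.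
Let n1 : 1 <= n%:R :> R. Proof. by rewrite ler1n (leq_trans k0). Qed.
Let n0 : 0 <= n%:R :> R. Proof. exact: ler0n. Qed.
Let nX m : 1 <= n%:R ^+ m :> R. Proof. exact: exprn_ege1. Qed.

Lemma nat_le_pow c m : (c <= 2 ^ m)%N -> c%:R <= b ^+ m.
Proof.
move=> cm; apply: (@le_trans _ _ ((2 ^ m)%N%:R)); first by rewrite ler_nat.
by rewrite natrX lerXn2r ?nnegrE.
Qed.

Lemma t_le1 : t <= 1.
Proof.
have b28 : 0 <= b ^+ 28 * t by nonneg.
by apply: le_trans z1; apply: (@le_trans _ _ (b ^+ 28 * t)); rewrite ler_peMl.
Qed.

(** Each factor [t] pays for 28 factors [b] and for 5 (20^2 + 1) q factors [n]; as [z <= 1], four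
    factors [z] may be kept. The allowance 28 is exhausted in [clump_num], and the one for [n]
    nearly so in [lin_num]. *)
Lemma absorbn e1 e r m x : (e1 <= 5 * (20 * 20 + 1) * q * r)%N -> (e <= 28 * r)%N ->
  (4 <= r * m)%N -> x <= (n%:R ^+ e1 * (b ^+ e * t ^+ r)) ^+ m -> x <= z ^+ 4.
Proof.
move=> e1r er rm H; apply: le_trans H _.
have z0 : 0 <= z by nonneg.
apply: (@le_trans _ _ ((z ^+ r) ^+ m)).
  apply: lerXn2r; rewrite ?nnegrE; [nonneg|nonneg|].
  rewrite exprMn -exprM; apply: ler_pM; [nonneg|nonneg|exact: ler_weXn2l|].
  rewrite exprMn -exprM; apply: ler_pM; [nonneg|nonneg|exact: ler_weXn2l|done].
by rewrite -exprM ler_wiXn2l.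
Qed.

Lemma absorb e r m x : (e <= 28 * r)%N -> (4 <= r * m)%N ->
  x <= (b ^+ e * t ^+ r) ^+ m -> x <= z ^+ 4.
Proof. by move=> er rm H; apply: (@absorbn 0 e r m) => //; rewrite expr0 mul1r. Qed.

(** [t] is the common scale: it bounds theta / sigma here, and its inverse bounds the sizes of all
    grids below. *)
Lemma theta_sigma : theta / sigma <= t.
Proof.
rewrite -(ler_pXn2r (n := 2)) ?nnegrE ?divr_ge0 ?(ltW theta0) ?(ltW sigma0)//.
have -> : (theta / sigma) ^+ 2 = (R0 / sigma) * (eta / sigma).
  by rewrite expr_div_n thetaE; field; rewrite gt_eqF.
by rewrite tE ler_pM2r; [rewrite ler_pdivrMr|rewrite divr_gt0].
Qed.

Lemma R0_eta : R0 / eta <= b ^+ 2 / t ^+ 2.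
Proof.
have b00 : 0 < b by move: b2; lra.
have -> : b ^+ 2 / t ^+ 2 = b * sigma / eta by rewrite tE; field; rewrite !gt_eqF.
by rewrite ler_pM2r ?invr_gt0.
Qed.

Lemma R0_theta : R0 / theta <= b / t.
Proof.
rewrite -(ler_pXn2r (n := 2)) ?nnegrE ?divr_ge0 ?(ltW theta0) ?(ltW R00)//.
rewrite [leRHS]expr_div_n; apply: le_trans R0_eta.
rewrite expr_div_n thetaE expr2 invfM mulrA mulfK ?gt_eqF//.
Qed.

Lemma grid_eta N1 : N1%:R <= 2 * (2 * R0) / eta + 2 -> N1%:R <= b ^+ 5 / t ^+ 2.
Proof.
move=> H; apply: le_trans H _.
have h1 := R0_eta; have h2 : 1 <= b ^+ 2 / t ^+ 2.
  by rewrite ler_pdivlMr ?exprn_gt0// mul1r (le_trans _ (bX 2))// exprn_ile1// t_le1.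
have h3 : 8 * (b ^+ 2 / t ^+ 2) <= b ^+ 5 / t ^+ 2.
  rewrite mulrA ler_pM2r ?invr_gt0 ?exprn_gt0// (exprD b 3 2) ler_wpM2r//.
  exact: (@nat_le_pow 8 3).
have -> : 2 * (2 * R0) / eta = 4 * (R0 / eta) by rewrite !mulrA -natrM.
lra.
Qed.

Lemma pow_pair (x B P : R) (m r : nat) :
  x * B ^+ (r * m) * P ^+ (r * m) = x * ((B * P) ^+ r) ^+ m.
Proof. by rewrite -mulrA -exprMn exprM. Qed.

Lemma pow_split (A B P : R) (m r : nat) :
  A ^+ m * B ^+ (r * m) * P ^+ (r * m) = (A * (B * P) ^+ r) ^+ m.
Proof. by rewrite exprMn -exprM exprMn mulrA. Qed.

Hypothesis d2 : (2 <= d)%N.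
Hypothesis dn : (d <= n)%N.
Let db : d%:R <= b. Proof. by apply: le_trans nb; rewrite ler_nat. Qed.
Let n2 : 2 <= n%:R :> R. Proof. by rewrite ler_nat (leq_trans d2). Qed.

Lemma nat_le_npow c m : (c <= 2 ^ m)%N -> c%:R <= n%:R ^+ m :> R.
Proof.
move=> cm; apply: (@le_trans _ _ ((2 ^ m)%N%:R)); first by rewrite ler_nat.
by rewrite natrX lerXn2r ?nnegrE.
Qed.

Lemma small_steps : [/\ 4 * eta <= theta, 2 * theta <= R0 & eta <= R0].
Proof.
have e0 : 0 <= eta := ltW eta0.
have h1 : 2 * (n%:R * eta) <= n%:R * (n%:R * eta) by rewrite ler_wpM2r// mulr_ge0.
have h2 : 2 * eta <= n%:R * eta by rewrite ler_wpM2r.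
have h3 : 16 * eta <= R0 by move: etaR; lra.
split; last by lra.
  rewrite -(ler_pXn2r (n := 2)) ?nnegrE ?mulr_ge0 ?(ltW theta0)// thetaE.
  have -> : (4 * eta) ^+ 2 = 16 * eta * eta by ring.
  by rewrite ler_wpM2r.
rewrite -(ler_pXn2r (n := 2)) ?nnegrE ?mulr_ge0 ?(ltW theta0) ?(ltW R00)// exprMn thetaE.
have -> : 2 ^+ 2 * (R0 * eta) = R0 * (4 * eta) by ring.
by rewrite expr2 ler_wpM2l ?(ltW R00)//; lra.
Qed.

Lemma lin_num :
  ((n * (2 * (2 * n)).+1) ^ (2 * (400 * q * d)))%:R *
  (3 * (n%:R * (n%:R * eta)) / sigma) ^+ d <= z ^+ 4.
Proof.
(* The tolerance is of order eta rather than theta, so each coordinate contributes [t ^+ 2]; two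
   coordinates make the fourth power. *)
apply: (@absorbn (5 * (2 * (400 * q))) 3 2 d) => //.
  by clear -q0; lia.
  by clear -d2; lia.
have hA : (n * (2 * (2 * n)).+1)%:R <= n%:R ^+ 5 :> R.
  apply: (@le_trans _ _ (n%:R * (5 * n)%:R)).
    have n1' : (0 < n)%N by move: n1; rewrite ler1n.
    by rewrite -natrM ler_nat leq_mul2l; apply/orP; right; clear -n1'; lia.
  have -> : n%:R ^+ 5 = n%:R * (n%:R ^+ 3 * n%:R) :> R by ring.
  rewrite natrM; apply: ler_wpM2l => //; apply: ler_wpM2r => //; exact: (@nat_le_npow 5 3).
have hp : 3 * (n%:R * (n%:R * eta)) / sigma <= b ^+ 3 * t ^+ 2.
  rewrite tE.
  have -> : 3 * (n%:R * (n%:R * eta)) / sigma = 3 * (n%:R * (n%:R * (eta / sigma))) by ring.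
  have -> : b ^+ 3 * (b * (eta / sigma)) = b ^+ 2 * (b * (b * (eta / sigma))) by ring.
  have e0 : 0 <= eta / sigma := divr_ge0 (ltW eta0) (ltW sigma0).
  apply: ler_pM; [nonneg|nonneg| |].
    exact: (@nat_le_pow 3 2).
  by apply: ler_pM; [nonneg|nonneg| |apply: ler_pM] => //; nonneg.
rewrite natrX (_ : (2 * (400 * q * d) = 2 * (400 * q) * d)%N); last by clear; lia.
rewrite exprM -exprMn; apply: lerXn2r; rewrite ?nnegrE; [nonneg|nonneg|].
apply: ler_pM; [nonneg|nonneg| |done].
by rewrite [leRHS]exprM lerXn2r ?nnegrE.
Qed.

Lemma clump_num :
  ((n.+1 ^ (10 * d)) ^ 5)%:R * (n%:R * (4 * theta) / sigma) ^+ (4 * d) <= z ^+ 4.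
Proof.
apply: (@absorb 112 4 d) => //; first by clear -d2; lia.
have hA : n.+1%:R <= b ^+ 2.
  apply: (@le_trans _ _ (2 * n%:R)); first by rewrite -natr1; move: n1; lra.
  by rewrite expr2; apply: ler_pM.
have hp : n%:R * (4 * theta) / sigma <= b ^+ 3 * t.
  have -> : n%:R * (4 * theta) / sigma = 4 * (n%:R * (theta / sigma)) by ring.
  have -> : b ^+ 3 * t = b ^+ 2 * (b * t) by ring.
  have e0 : 0 <= theta / sigma := divr_ge0 (ltW theta0) (ltW sigma0).
  apply: ler_pM; [nonneg|nonneg| |].
    exact: (@nat_le_pow 4 2).
  by apply: ler_pM => //; exact: theta_sigma.
rewrite -expnM natrX (_ : (10 * d * 5 = 50 * d)%N); last by clear; lia.
rewrite !exprM -exprMn; apply: lerXn2r; rewrite ?nnegrE; [nonneg|nonneg|].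
have -> : b ^+ 112 * t ^+ 4 = (b ^+ 2) ^+ 50 * (b ^+ 3 * t) ^+ 4.
  by ring.
have x0 : 0 <= n%:R * (4 * theta) / sigma by nonneg.
by apply: ler_pM; [nonneg|nonneg| |]; apply: lerXn2r; rewrite ?nnegrE//; nonneg.
Qed.

Lemma hyper_num N1 N2 :
  N1%:R <= 2 * R0 / theta + 2 ->
  N2%:R <= 2 * (2 * (n%:R * (n%:R * theta)) + d%:R * R0) / theta + 2 ->
  (N1 ^ d * N2 * d * n ^ (10 * d))%:R *
  (2 * (2 * (n%:R * (n%:R * theta)) + d%:R * theta + theta) / sigma) ^+ (10 * d) <= z ^+ 4.
Proof.
move=> hN1 hN2.
(* Of ten factors [t] per dimension, one pays for the grid of the normal and one for that of the
   offset. *)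
apply: (@absorb 69 8 d) => //; first by clear -d2; lia.
have ti : 1 <= t^-1 by rewrite invf_ge1// t_le1.
have rt := R0_theta.
have b1t : 1 <= b / t by rewrite (le_trans ti)// ler_peMl// (le_trans _ ti).
have bt0 : 0 <= b / t by lra.
have hN1' : N1%:R <= b ^+ 3 / t.
  apply: le_trans hN1 _; have -> : 2 * R0 / theta = 2 * (R0 / theta) by ring.
  have : 4 * (b / t) <= b ^+ 2 * (b / t) by rewrite ler_wpM2r//; exact: (@nat_le_pow 4 2).
  have -> : b ^+ 2 * (b / t) = b ^+ 3 / t by ring.
  lra.
have nn : n%:R * n%:R <= b * b by apply: ler_pM.
have bb : 1 <= b * b by rewrite -expr2.
have hN2' : N2%:R <= b ^+ 5 / t.
  apply: le_trans hN2 _.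
  have -> : 2 * (2 * (n%:R * (n%:R * theta)) + d%:R * R0) / theta =
      4 * (n%:R * n%:R) + 2 * (d%:R * (R0 / theta)).
    by field; rewrite gt_eqF.
  have h1 : d%:R * (R0 / theta) <= b * (b / t).
    by apply: ler_pM => //; exact: divr_ge0 (ltW R00) (ltW theta0).
  have h2 : b * b <= b * (b / t).
    by rewrite ler_wpM2l// ler_peMr.
  have h3 : 8 * (b * (b / t)) <= b ^+ 3 * (b * (b / t)).
    by apply: ler_wpM2r; [nonneg|exact: (@nat_le_pow 8 3)].
  have -> : b ^+ 5 / t = b ^+ 3 * (b * (b / t)) by ring.
  lra.
set p := 2 * _ / sigma.
have p0 : 0 <= p by rewrite /p; nonneg.
have hp : p <= b ^+ 5 * t.
  have th := theta_sigma; have ts0 : 0 <= theta / sigma := divr_ge0 (ltW theta0) (ltW sigma0).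
  have -> : p = (4 * (n%:R * n%:R) + 2 * d%:R + 2) * (theta / sigma) by rewrite /p; ring.
  apply: ler_pM; [nonneg|nonneg| |done].
  have h1 : b <= b * b by rewrite ler_peMl.
  have h3 : 8 * (b * b) <= b ^+ 3 * (b * b) by apply: ler_wpM2r; [nonneg|exact: (@nat_le_pow 8 3)].
  have -> : b ^+ 5 = b ^+ 3 * (b * b) by ring.
  move: db; lra.
rewrite !natrM !natrX.
have -> : b ^+ 69 * t ^+ 8 = (b ^+ 3 / t) * (b ^+ 5 / t) * b * b ^+ 10 * (b ^+ 5 * t) ^+ 10.
  by field; rewrite gt_eqF.
have xd x : 1 <= x -> x <= x ^+ d by move=> x1; rewrite -[leLHS]expr1 ler_weXn2l// ltnW.
have b3t : 0 <= b ^+ 3 / t by nonneg.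
have b5t : 1 <= b ^+ 5 / t by rewrite (exprSr b 4) -mulrA (le_trans b1t)// ler_peMl.
have b5t0 : 0 <= b ^+ 5 / t by nonneg.
have b5 : 0 <= b ^+ 5 * t by nonneg.
clearbody p; rewrite exprM5; apply: ler_pM; [nonneg|nonneg| |]; last first.
  by rewrite [leLHS]exprM; apply: lerXn2r; rewrite ?nnegrE; [nonneg|nonneg|apply: lerXn2r; rewrite ?nnegrE //].
apply: ler_pM; [nonneg|nonneg| |]; last first.
  by rewrite [leLHS]exprM; apply: lerXn2r; rewrite ?nnegrE; [nonneg|nonneg|apply: lerXn2r; rewrite ?nnegrE //].
apply: ler_pM; [nonneg|nonneg| |]; last first.
  by apply: le_trans db _; exact: xd.
apply: ler_pM; [nonneg|nonneg| |].
  by apply: lerXn2r; rewrite ?nnegrE.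
by apply: le_trans hN2' _; exact: xd.
Qed.

Let round_le : d%:R * (eta * (2 * R0 + 2 * (2 * R0) + eta)) <= 7 * (n%:R * theta ^+ 2).
Proof.
have [_ _ e3] := small_steps.
have -> : 7 * (n%:R * theta ^+ 2) = n%:R * (eta * (7 * R0)) by rewrite thetaE; ring.
apply: ler_pM; [nonneg|nonneg|by rewrite ler_nat|].
by apply: ler_wpM2l; [nonneg|lra].
Qed.

Lemma slab_num N1 : N1%:R <= 2 * (2 * R0) / eta + 2 ->
  (N1 ^ (k * d) * (n * (k * k) * d) ^ (8 * k * d))%:R *
  ((eta ^+ 2 + 2 * (d%:R * (eta * (2 * R0 + 2 * (2 * R0) + eta)))) / (sigma * theta)) ^+ (8 * k * d)
  <= z ^+ 4.
Proof.
move=> /grid_eta hN.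
(* Of eight factors [t] per coordinate of a center, two pay for its grid of step [eta]. *)
apply: (@absorb 77 6 (k * d)) => //; first by clear -d2 k0; nia.
set p := (_ / (sigma * theta)).
have p0 : 0 <= p by rewrite /p; nonneg.
have hp : p <= b ^+ 5 * t.
  have [_ _ e3] := small_steps.
  have -> : b ^+ 5 * t = b ^+ 4 * (b * t) by ring.
  have w1 : eta ^+ 2 <= n%:R * theta ^+ 2.
    rewrite thetaE expr2 mulrA; apply: ler_wpM2r; [nonneg|].
    by apply: le_trans e3 _; rewrite ler_peMl// ltW.
  apply: (@le_trans _ _ (15 * (n%:R * (theta / sigma)))).
    rewrite /p ler_pdivrMr ?mulr_gt0//.
    have -> : 15 * (n%:R * (theta / sigma)) * (sigma * theta) = 15 * (n%:R * theta ^+ 2).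
      by field; rewrite gt_eqF.
    by move: w1 round_le; lra.
  apply: ler_pM; [nonneg|nonneg|exact: (@nat_le_pow 15 4)|].
  by apply: ler_pM => //; [nonneg|exact: theta_sigma].
have hM : (n * (k * k) * d)%:R <= b ^+ 4.
  have -> : b ^+ 4 = b * (b * b) * b by ring.
  by rewrite !natrM; apply: ler_pM => //; apply: ler_pM => //; apply: ler_pM.
clearbody p; rewrite natrM !natrX -(mulnA 8) pow_split.
have -> : b ^+ 77 * t ^+ 6 = b ^+ 5 / t ^+ 2 * (b ^+ 4 * (b ^+ 5 * t)) ^+ 8.
  by field; rewrite gt_eqF.
apply: lerXn2r; rewrite ?nnegrE; [nonneg|nonneg|].
apply: ler_pM; [nonneg|nonneg|done|].
by apply: lerXn2r; rewrite ?nnegrE; [nonneg|nonneg|apply: ler_pM].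
Qed.

(** The choice of the moves costs at most n^(72 k d), and k <= q^2 turns this into n^(72 q) for each
    of the q d units. Of 58 factors [t] per unit, two pay for the grid of the single rounded
    center. *)
Let move_count N1 (B P : R) e : N1%:R <= 2 * (2 * R0) / eta + 2 ->
  0 <= B -> 0 <= P -> B * P <= b ^+ e * t ->
  ((n * (k * k)).+1 ^ (18 * k * d) * k * N1 ^ d)%:R * B ^+ (58 * q * d) * P ^+ (58 * q * d) <=
  (n%:R ^+ (72 * q) * (b ^+ (6 + e * 58) * t ^+ 56)) ^+ (q * d).
Proof.
move=> /grid_eta hN B0 P0 BP.
have kn' : k%:R <= n%:R :> R by rewrite ler_nat.
have hA : (n * (k * k)).+1%:R <= n%:R ^+ 4 :> R.
  have h : (n * (k * k))%:R <= n%:R ^+ 3 :> R by rewrite !natrM exprS expr2; apply: ler_pM => //; apply: ler_pM.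
  rewrite (exprS _ 3) -natr1; apply: (@le_trans _ _ (2 * n%:R ^+ 3)); last by rewrite ler_wpM2r ?exprn_ge0.
  by have := nX 3; lra.
have qd1 : (0 < q * d)%N by rewrite muln_gt0 q0 (ltnW d2).
have xd x : 1 <= x -> x <= x ^+ (q * d) by move=> x1; rewrite -[leLHS]expr1 ler_weXn2l.
rewrite -(mulnA 58 q d) pow_pair.
have -> : n%:R ^+ (72 * q) * (b ^+ (6 + e * 58) * t ^+ 56) =
    n%:R ^+ (72 * q) * b * (b ^+ 5 / t ^+ 2) * (b ^+ e * t) ^+ 58.
  rewrite exprD (exprM b e) exprMn; set u := n%:R ^+ (72 * q).
  rewrite (_ : t ^+ 58 = t ^+ 56 * t ^+ 2); last by rewrite -exprD.
  by set v := t ^+ 56; set y := (b ^+ e) ^+ 58; field; rewrite gt_eqF.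
rewrite [leRHS]exprMn; apply: ler_pM; [nonneg|nonneg| |]; last first.
  by apply: lerXn2r; rewrite ?nnegrE; [nonneg|nonneg|apply: lerXn2r; rewrite ?nnegrE; [nonneg|nonneg|]].
rewrite !natrM !natrX [leRHS]exprMn; apply: ler_pM; [nonneg|nonneg| |]; last first.
  apply: (@le_trans _ _ ((b ^+ 5 / t ^+ 2) ^+ d)).
    by apply: lerXn2r; rewrite ?nnegrE//; nonneg.
  apply: ler_weXn2l; last by rewrite leq_pmull.
  by rewrite ler_pdivlMr ?exprn_gt0// mul1r (le_trans _ (bX 5))// exprn_ile1// t_le1.
rewrite [leRHS]exprMn; apply: ler_pM; [nonneg|nonneg| |]; last first.
  by apply: le_trans kb _; exact: xd.
apply: (@le_trans _ _ ((n%:R ^+ 4) ^+ (18 * k * d))).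
  by apply: lerXn2r; rewrite ?nnegrE.
rewrite -!exprM; apply: ler_weXn2l => //.
have h : (k * d <= q * q * d)%N by rewrite leq_mul2r q2 orbT.
by move: h; clear; lia.
Qed.

Let step_w : 0 <= 8 * (n%:R * (n%:R * (R0 * eta))) + d%:R * (eta * (2 * R0 + 2 * (2 * R0) + eta))
   <= 15 * (n%:R * (n%:R * theta ^+ 2)).
Proof.
apply/andP; split; first by nonneg.
have : n%:R * theta ^+ 2 <= n%:R * (n%:R * theta ^+ 2) by rewrite ler_peMl//; nonneg.
by move: round_le; rewrite -thetaE; lra.
Qed.

Lemma pair_num N1 : N1%:R <= 2 * (2 * R0) / eta + 2 ->
  ((n * (k * k)).+1 ^ (18 * k * d) * k * N1 ^ d * (n * n * k * d) ^ (58 * q * d))%:R *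
  (2 * (8 * (n%:R * (n%:R * (R0 * eta))) + d%:R * (eta * (2 * R0 + 2 * (2 * R0) + eta))) /
   (theta / 2) / sigma) ^+ (58 * q * d) <= z ^+ 4.
Proof.
move=> hN; have /andP[w0 w1] := step_w.
set w' := 8 * _ + _ in w0 w1 *.
apply: (@absorbn (72 * q) (6 + 12 * 58) 56 (q * d)) => //; [by clear -q0; lia|by clear -d2 q0; nia|].
rewrite natrM (natrX _ (n * n * k * d)%N); apply: move_count => //; [nonneg|].
have hM : (n * n * k * d)%:R <= b ^+ 4.
  have -> : b ^+ 4 = b * b * b * b by ring.
  by rewrite !natrM; apply: ler_pM => //; apply: ler_pM => //; apply: ler_pM.
have -> : b ^+ 12 * t = b ^+ 4 * (b ^+ 6 * (b * (b * t))) by ring.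
apply: ler_pM; [nonneg|nonneg|done|].
apply: (@le_trans _ _ (60 * (n%:R * (n%:R * (theta / sigma))))).
  rewrite ler_pdivrMr// ler_pdivrMr ?divr_gt0//.
  have -> : 60 * (n%:R * (n%:R * (theta / sigma))) * sigma * (theta / 2) = 2 * (15 * (n%:R * (n%:R * theta ^+ 2))).
    by field; rewrite gt_eqF.
  by rewrite ler_wpM2l.
apply: ler_pM; [nonneg|nonneg|exact: (@nat_le_pow 60 6)|].
apply: ler_pM => //; [nonneg|].
by apply: ler_pM => //; [nonneg|exact: theta_sigma].
Qed.

Lemma single_num N1 : N1%:R <= 2 * (2 * R0) / eta + 2 ->
  ((n * (k * k)).+1 ^ (18 * k * d) * k * N1 ^ d * (n * k) ^ (58 * q * d))%:R *
  (Num.sqrt (2 * (8 * (n%:R * (n%:R * (R0 * eta))) + d%:R * (eta * (2 * R0 + 2 * (2 * R0) + eta)))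
   * (18 * k * d)%:R) / sigma) ^+ (58 * q * d) <= z ^+ 4.
Proof.
move=> hN; have /andP[w0 w1] := step_w.
set w' := 8 * _ + _ in w0 w1 *.
apply: (@absorbn (72 * q) (6 + 12 * 58) 56 (q * d)) => //; [by clear -q0; lia|by clear -d2 q0; nia|].
rewrite natrM (natrX _ (n * k)%N).
apply: move_count => //; first by rewrite divr_ge0 ?sqrtr_ge0 ?ltW.
have hM : (n * k)%:R <= b ^+ 2 by rewrite natrM expr2; apply: ler_pM.
have hs : Num.sqrt (2 * w' * (18 * k * d)%:R) <= b ^+ 5 * (b * b * theta).
  rewrite -(ler_pXn2r (n := 2)) ?nnegrE ?sqrtr_ge0//; last by nonneg.
  rewrite sqr_sqrtr; last by nonneg.
  (* 540 = 2 * 15 * 18 collects the constants of the radicand, and 540 <= 2^10 <= b^10. *)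
  have -> : (b ^+ 5 * (b * b * theta)) ^+ 2 = 2 * (15 * (b * (b * theta ^+ 2))) * (18 * b * b) + 
     (b ^+ 10 - 540) * (b * b * (b * (b * theta ^+ 2))) by ring.
  rewrite -[leLHS]addr0; apply: lerD.
    apply: ler_pM; [nonneg|nonneg| |].
      apply: ler_wpM2l => //; apply: le_trans w1 _; apply: ler_wpM2l => //.
      by apply: ler_pM => //; [nonneg|apply: ler_pM => //; nonneg].
    by rewrite !natrM; apply: ler_pM => //; apply: ler_pM.
  apply: mulr_ge0; last by nonneg.
  by rewrite subr_ge0; exact: (@nat_le_pow 540 10).
apply: (@le_trans _ _ (b ^+ 2 * (b ^+ 5 * (b * b * t)))).
  apply: ler_pM => //; first by rewrite divr_ge0 ?sqrtr_ge0 ?ltW.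
  rewrite ler_pdivrMr//; apply: le_trans hs _.
  have -> : b ^+ 5 * (b * b * t) * sigma = b ^+ 5 * (b * b * (t * sigma)) by ring.
  apply: ler_wpM2l; first by nonneg.
  apply: ler_wpM2l; first by nonneg.
  by have := theta_sigma; rewrite ler_pdivrMr.
have -> : b ^+ 2 * (b ^+ 5 * (b * b * t)) = b ^+ 9 * t by ring.
by apply: ler_wpM2r => //; apply: ler_weXn2l.
Qed.

End Absorb.

(** * The probability of a tiny window *)

Definition plane_bad (R : realType) (n k d q : nat) (eta theta R0 : R) (X : 'I_n -> 'rV[R]_d) : Prop :=
  lin_bad n n 0 X \/
  lin_bad (2 * (400 * q * d)) (2 * n) (3 * (n%:R * (n%:R * eta))) X \/
  hyper_bad (10 * d) (2 * (n%:R * (n%:R * theta))) X \/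
  clump_bad (10 * d) (4 * theta) X \/
  slab_bad k (8 * k * d) (2 * R0) (eta ^+ 2) theta X \/
  pair_bad k (18 * k * d) (58 * q * d) (2 * R0) (8 * (n%:R * (n%:R * (R0 * eta)))) (theta / 2) X \/
  single_bad k (18 * k * d) (58 * q * d) (2 * R0) (8 * (n%:R * (n%:R * (R0 * eta)))) X.

Definition tiny_window (R : realType) (n k d : nat) (i0 : 'I_k) (X : 'I_n -> 'rV[R]_d)
    (c0 : {ffun 'I_k -> 'rV[R]_d}) (eta : R) (W t : nat) : Prop :=
  forall s, (t <= s < t + W)%N ->
  Psi X (asg i0 X c0 s) - Psi X (asg i0 X c0 s.+1) <= eta ^+ 2 /\
  Psi X (asg i0 X c0 s.+1) < Psi X (asg i0 X c0 s).

Section PlaneCover.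
Context (R : realType) (n k d q : nat) (mu : 'I_n -> 'rV[R]_d) (b t sigma eta theta R0 : R).
Hypothesis sigma0 : 0 < sigma.
Hypothesis eta0 : 0 < eta.
Hypothesis b2 : 2 <= b.
Hypothesis nb : n%:R <= b.
Hypothesis R0b : R0 <= b * sigma.
Hypothesis R00 : 0 < R0.
Hypothesis theta0 : 0 < theta.
Hypothesis thetaE : theta ^+ 2 = R0 * eta.
Hypothesis t0 : 0 < t.
Hypothesis tE : t ^+ 2 = b * (eta / sigma).
Hypothesis etaR : 4 * (n%:R * (n%:R * eta)) <= R0.
Hypothesis kn : (k <= n)%N.
Hypothesis k0 : (0 < k)%N.
Hypothesis q0 : (0 < q)%N.
Hypothesis q2 : (k <= q * q)%N.
Local Notation z := (n%:R ^+ (5 * (20 * 20 + 1) * q) * (b ^+ 28 * t)).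
Hypothesis z1 : z <= 1.
Hypothesis d2 : (2 <= d)%N.
Hypothesis dn : (d <= n)%N.

Lemma pcover_plane : pcover sigma
  [set g | (forall x o, `|pts mu g x ord0 o| <= R0) /\ plane_bad k q eta theta R0 (pts mu g)]%classic
  (6 * z ^+ 4).
Proof.
have e0 : 0 <= eta by exact: ltW.
have th0 : 0 <= theta by exact: ltW.
have R0' : 0 <= R0 by exact: ltW.
have d0 : (0 < d)%N by exact: ltnW.
have n0 : 0 <= n%:R :> R by [].
have z0 : 0 <= z ^+ 4 by rewrite exprn_ge0// mulr_ge0 ?exprn_ge0// mulr_ge0 ?exprn_ge0 ?ltW//; move: b2; lra.
have [e4 e2 e1] : [/\ 4 * eta <= theta, 2 * theta <= R0 & eta <= R0].
  by eapply small_steps; eassumption.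
pose A (P : ('I_n -> 'rV[R]_d) -> Prop) : set ('I_n * 'I_d -> R) :=
  fun g => (forall x o, `|pts mu g x ord0 o| <= R0) /\ P (pts mu g).
(* Exact relations have probability zero: the bound contains the factor 0^d with [d] positive. *)
have c0 : pcover sigma (A (fun X => lin_bad n n 0 X)) 0.
  apply: pcover_sub (pcover_le _ (pcover_lin mu sigma0 n n (lexx 0))); first by move=> g [].
  by rewrite mul0r expr0n eqn0Ngt d0 mulr0.
have c1 : pcover sigma (A (fun X => lin_bad (2 * (400 * q * d)) (2 * n) (3 * (n%:R * (n%:R * eta))) X)) (z ^+ 4).
  have w0 : 0 <= 3 * (n%:R * (n%:R * eta)) by nonneg.
  apply: pcover_sub (pcover_le _ (pcover_lin mu sigma0 (2 * (400 * q * d)) (2 * n) w0)); first by move=> g [].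
  by eapply lin_num; eassumption.
have c2 : pcover sigma (A (fun X => hyper_bad (10 * d) (2 * (n%:R * (n%:R * theta))) X)) (z ^+ 4).
  have w0 : 0 <= 2 * (n%:R * (n%:R * theta)) by nonneg.
  have kap0 : (0 < 10 * d)%N by rewrite muln_gt0.
  have [N1 [N2 [h1 h2 H]]] := pcover_hyper mu sigma0 kap0 d0 w0 theta0 e2.
  by apply: pcover_le H; eapply (hyper_num (eta := eta)); eassumption.
have c3 : pcover sigma (A (fun X => clump_bad (10 * d) (4 * theta) X)) (z ^+ 4).
  have w0 : 0 <= 4 * theta by nonneg.
  apply: pcover_sub (pcover_le _ (pcover_clump mu sigma0 (10 * d) w0)); first by move=> g [].
  by eapply (clump_num (eta := eta)); eassumption.
have R10 : 0 <= 2 * R0 by nonneg.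
have c4 : pcover sigma (A (fun X => slab_bad k (8 * k * d) (2 * R0) (eta ^+ 2) theta X)) (z ^+ 4).
  have w0 : 0 <= eta ^+ 2 by nonneg.
  have N0 : (0 < 8 * k * d)%N by rewrite !muln_gt0 k0.
  have [N1 [h1 H]] := pcover_slab k mu sigma0 N0 d0 R0' R10 w0 eta0 e4.
  by apply: pcover_le H; eapply slab_num; eassumption.
have w0 : 0 <= 8 * (n%:R * (n%:R * (R0 * eta))) by nonneg.
have N0 : (0 < 58 * q * d)%N by rewrite !muln_gt0 q0.
have c5 : pcover sigma (A (fun X => pair_bad k (18 * k * d) (58 * q * d) (2 * R0)
    (8 * (n%:R * (n%:R * (R0 * eta)))) (theta / 2) X)) (z ^+ 4).
  have e5 : 2 * eta <= theta / 2 by move: e4; lra.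
  have [N1 [h1 H]] := pcover_pair k mu sigma0 (18 * k * d) N0 d0 R0' R10 w0 eta0 e5.
  by apply: pcover_le H; eapply pair_num; eassumption.
have c6 : pcover sigma (A (fun X => single_bad k (18 * k * d) (58 * q * d) (2 * R0)
    (8 * (n%:R * (n%:R * (R0 * eta)))) X)) (z ^+ 4).
  have [N1 [h1 H]] := pcover_single k mu sigma0 (18 * k * d) N0 d0 R0' R10 w0 eta0.
  by apply: pcover_le H; eapply (single_num (theta := theta)); eassumption.
have -> : 6 * z ^+ 4 = 0 + (z ^+ 4 + (z ^+ 4 + (z ^+ 4 + (z ^+ 4 + (z ^+ 4 + z ^+ 4))))) by ring.
have H := pcoverU c0 (pcoverU c1 (pcoverU c2 (pcoverU c3 (pcoverU c4 (pcoverU c5 c6))))).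
apply: pcover_sub H => g [XR].
case=> [h|[h|[h|[h|[h|[h|h]]]]]]; [left|right; left|right; right; left|right; right; right; left|
  right; right; right; right; left|right; right; right; right; right; left|right; right; right; right; right; right];
  by split.
Qed.

End PlaneCover.

Lemma plane_bad_window (R : realType) (n k d q : nat) (i0 : 'I_k) (X : 'I_n -> 'rV[R]_d)
    (c0 : {ffun 'I_k -> 'rV[R]_d}) (eta theta R0 : R) t :
  0 <= eta -> (d <= n)%N -> (0 < d)%N -> (forall x o, `|X x ord0 o| <= R0) ->
  0 <= theta -> theta ^+ 2 = R0 * eta -> 4 * (n%:R * (n%:R * eta)) <= R0 ->
  (k <= q * q)%N -> (0 < q)%N -> tiny_window i0 X c0 eta 2 t ->
  plane_bad k q eta theta R0 X.
Proof.
move=> eta0 dn d0 XR theta0 thetaE etaR q2 q0 win.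
have [t1 _] : Psi X (asg i0 X c0 t) - Psi X (asg i0 X c0 t.+1) <= eta ^+ 2 /\
    Psi X (asg i0 X c0 t.+1) < Psi X (asg i0 X c0 t) by apply: win; lia.
have [t2 dec] : Psi X (asg i0 X c0 t.+1) - Psi X (asg i0 X c0 t.+2) <= eta ^+ 2 /\
    Psi X (asg i0 X c0 t.+2) < Psi X (asg i0 X c0 t.+1) by apply: win; lia.
apply: contrapT => nb.
have [n0 [n1 [n2 [n3 [n4 [n5 n6]]]]]] : ~ lin_bad n n 0 X /\
  ~ lin_bad (2 * (400 * q * d)) (2 * n) (3 * (n%:R * (n%:R * eta))) X /\
  ~ hyper_bad (10 * d) (2 * (n%:R * (n%:R * theta))) X /\
  ~ clump_bad (10 * d) (4 * theta) X /\
  ~ slab_bad k (8 * k * d) (2 * R0) (eta ^+ 2) theta X /\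
  ~ pair_bad k (18 * k * d) (58 * q * d) (2 * R0) (8 * (n%:R * (n%:R * (R0 * eta)))) (theta / 2) X /\
  ~ single_bad k (18 * k * d) (58 * q * d) (2 * R0) (8 * (n%:R * (n%:R * (R0 * eta)))) X.
  by rewrite /plane_bad in nb; tauto.
exact: (plane_window eta0 dn d0 XR theta0 thetaE etaR q2 q0 n0 n2 n3 n4 n1 n5 n6 t1 t2 dec).
Qed.

Lemma pow_base (R : comPzRingType) (b h : R) : (b ^+ 28) ^+ 4 * (b * h) ^+ 2 = b ^+ 114 * h ^+ 2.
Proof. by rewrite -exprM exprMn mulrA -exprD. Qed.

Section WindowCover.
Context (R : realType) (n k q : nat) (sigma : R).
Hypothesis sigma0 : 0 < sigma.
Hypothesis k0 : (0 < k)%N.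
Hypothesis kn : (k <= n)%N.
Hypothesis q0 : (0 < q)%N.
Hypothesis q2 : (k <= q * q)%N.
Local Notation b := (4 * n%:R * (1 + sigma^-1)).
Local Notation R0 := (1 + 4 * n%:R * sigma).
Local Notation e := (5 * (20 * 20 + 1) * q)%N.
(** One constant for all dimensions: 100^2 n^11 suffices on the line, where the tolerance is 100 n^4
    eta and there are n^3 triples. The rest is z^4, with 114 = 4 * 28 + 2 because t^4 = b^2 (eta /
    sigma)^2. *)
Local Notation V := (100 ^+ 2 * (n%:R ^+ (4 * e + 11) * b ^+ 114)).

Let n1 : 1 <= n%:R :> R. Proof. by rewrite ler1n (leq_trans k0). Qed.
Let is0 : 0 < sigma^-1. Proof. by rewrite invr_gt0. Qed.

Lemma base_ge : [/\ 2 <= b, n%:R <= b, 1 <= b & R0 <= b * sigma].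
Proof.
have h : 0 <= 4 * n%:R * sigma^-1 by rewrite !mulr_ge0// ltW.
have E : b = 4 * n%:R + 4 * n%:R * sigma^-1 by ring.
split; try by rewrite E; move: n1 h; lra.
have -> : b * sigma = 4 * n%:R + 4 * n%:R * sigma by field; rewrite gt_eqF.
by move: n1; lra.
Qed.

Lemma base_factor_ge1 : 1 <= n%:R ^+ (4 * e + 11) * b ^+ 114.
Proof.
have [_ _ b1 _] := base_ge.
by apply: mulr_ege1; exact: exprn_ege1.
Qed.

Lemma plane_window_cover d (mu : 'I_n -> 'rV[R]_d) i0 (c0 : {ffun 'I_k -> 'rV[R]_d}) (eta : R) :
  (2 <= d)%N -> (d <= n)%N -> 0 < eta ->
  pcover sigma [set g | (forall x o, `|pts mu g x ord0 o| <= R0) /\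
      exists t, tiny_window i0 (pts mu g) c0 eta 2 t]%classic (V * (eta / sigma) ^+ 2).
Proof.
move=> d2 dn eta0; have [b2 nb b1 R0b] := base_ge.
have b0 : 0 < b by apply: lt_le_trans b1.
have R00 : 0 < R0 by rewrite addr_gt0// !mulr_gt0//; apply: lt_le_trans n1.
have h0 : 0 < eta / sigma by rewrite divr_gt0.
pose t := Num.sqrt (b * (eta / sigma)); pose theta := Num.sqrt (R0 * eta).
have t0 : 0 < t by rewrite sqrtr_gt0 mulr_gt0.
have th0 : 0 < theta by rewrite sqrtr_gt0 mulr_gt0.
have tE : t ^+ 2 = b * (eta / sigma) by rewrite sqr_sqrtr// mulr_ge0// ltW.
have thE : theta ^+ 2 = R0 * eta by rewrite sqr_sqrtr// mulr_ge0// ltW.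
pose z := n%:R ^+ e * (b ^+ 28 * t).
have zE : 6 * z ^+ 4 <= V * (eta / sigma) ^+ 2.
  have -> : z ^+ 4 = n%:R ^+ (4 * e) * (b ^+ 114 * (eta / sigma) ^+ 2).
    have -> : z ^+ 4 = (n%:R ^+ e) ^+ 4 * ((b ^+ 28) ^+ 4 * (t ^+ 2) ^+ 2).
      rewrite /z; move: (n%:R ^+ e) (b ^+ 28) => u v; ring.
    by rewrite tE pow_base -exprM (mulnC e).
  rewrite -(mulrA (100 ^+ 2)) -(mulrA (n%:R ^+ (4 * e + 11))).
  have p0 : 0 <= b ^+ 114 * (eta / sigma) ^+ 2 by rewrite mulr_ge0 ?exprn_ge0// ltW.
  have h : n%:R ^+ (4 * e) * (b ^+ 114 * (eta / sigma) ^+ 2) <=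
      n%:R ^+ (4 * e + 11) * (b ^+ 114 * (eta / sigma) ^+ 2).
    by apply: ler_wpM2r => //; apply: ler_weXn2l => //; exact: leq_addr.
  have h' : 0 <= n%:R ^+ (4 * e) * (b ^+ 114 * (eta / sigma) ^+ 2).
    by rewrite mulr_ge0// exprn_ge0.
  move: h h'; set u := n%:R ^+ (4 * e) * _; set v := n%:R ^+ (4 * e + 11) * _ => h h'.
  have p1 : 6 <= 100 ^+ 2 :> R by rewrite expr2; lra.
  apply: le_trans (_ : 6 * v <= _); [lra|apply: ler_wpM2r => //; lra].
(* For [z] above one the claimed bound exceeds one and there is nothing to prove. *)
have [z1|z1] := leP z 1; last first.
  apply: pcover1; apply: le_trans zE.
  have : 1 <= z ^+ 4 by rewrite exprn_ege1// ltW.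
  lra.
apply: pcover_le zE _.
have etaR : 4 * (n%:R * (n%:R * eta)) <= R0.
  have t1 : t ^+ 2 <= 1.
    apply: exprn_ile1; first exact: ltW.
    apply: le_trans z1; rewrite /z mulrA ler_peMl ?(ltW t0)//.
    by apply: mulr_ege1; exact: exprn_ege1.
  have : n%:R * (eta / sigma) <= 1.
    by apply: le_trans t1; rewrite tE ler_pM2r.
  rewrite mulrA ler_pdivrMr// mul1r => h.
  have : n%:R * (n%:R * eta) <= n%:R * sigma by rewrite ler_wpM2l.
  lra.
apply: pcover_sub (pcover_plane mu sigma0 eta0 b2 nb R0b R00 th0 thE t0 tE etaR kn k0 q0 q2 z1 d2 dn).
move=> g [XR [s win]]; split => //.
apply: (plane_bad_window (ltW eta0) dn (ltnW d2) XR (ltW th0) thE etaR q2 q0 win).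
Qed.

Lemma line_window_cover (mu : 'I_n -> 'rV[R]_1) i0 (c0 : {ffun 'I_k -> 'rV[R]_1}) (eta : R) :
  0 < eta ->
  pcover sigma [set g | (forall x o, `|pts mu g x ord0 o| <= R0) /\
      exists t, tiny_window i0 (pts mu g) c0 eta k.+1 t]%classic (V * (eta / sigma) ^+ 2).
Proof.
move=> eta0; have [b2 nb b1 R0b] := base_ge.
pose eps := 100 * (n%:R * (n%:R * (n%:R * (n%:R * eta)))).
have eps0 : 0 <= eps by rewrite !mulr_ge0// ltW.
have H := pcover_three mu sigma0 eps0.
apply: pcover_le (pcover_sub _ H).
  have -> : (n ^ 3)%:R * (eps / sigma) ^+ 2 = 100 ^+ 2 * (n%:R ^+ 11 * (eta / sigma) ^+ 2).
    by rewrite natrX /eps; ring.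
  have h2 : 0 <= (eta / sigma) ^+ 2 by rewrite sqr_ge0.
  rewrite -(mulrA (100 ^+ 2)); apply: ler_wpM2l; first exact: sqr_ge0.
  apply: ler_wpM2r => //.
  rewrite addnC exprD -mulrA ler_peMr ?exprn_ge0//.
  by apply: mulr_ege1; exact: exprn_ege1.
move=> g [XR [t win]]; apply: contrapT => no3.
apply: (@line_window R n k i0 (pts mu g) c0 eta (ltW eta0) _ t).
  move=> a b' e' ab ae be h1 h2; apply: no3; exists a, b', e'; split => //;
  by rewrite ler_norml.
by move=> s /andP[s1 s2]; apply: win; rewrite s1 addnS ltnS.
Qed.

End WindowCover.

Lemma window_cover (R : realType) (n k d q : nat) (sigma : R) (mu : 'I_n -> 'rV[R]_d)
    (i0 : 'I_k) (c0 : {ffun 'I_k -> 'rV[R]_d}) :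
  0 < sigma -> (0 < k)%N -> (k <= n)%N -> (0 < d)%N -> (d <= n)%N ->
  (0 < q)%N -> (k <= q * q)%N ->
  exists W, [/\ (1 < W)%N, (W <= n.+1)%N & forall eta, 0 < eta ->
  pcover sigma [set g | (forall x o, `|pts mu g x ord0 o| <= 1 + 4 * n%:R * sigma) /\
      exists t, tiny_window i0 (pts mu g) c0 eta W t]%classic
    (100 ^+ 2 * (n%:R ^+ (4 * (5 * (20 * 20 + 1) * q) + 11) * (4 * n%:R * (1 + sigma^-1)) ^+ 114)
     * (eta / sigma) ^+ 2)].
Proof.
move=> s0 k0 kn d0 dn q0 q2; case: d mu c0 d0 dn => [//|[|d]] mu c0 _ dn.
  by exists k.+1; split => // eta eta0; exact: line_window_cover.
exists 2; split => //; first by rewrite ltnS (leq_trans _ dn).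
by move=> eta eta0; exact: plane_window_cover.
Qed.

(** * From windows to the expectation *)

Lemma add_step_le (R : numDomainType) (a a' e : R) (s : nat) :
  a' + e <= a -> a' + s.+1%:R * e <= a + s%:R * e.
Proof. by move=> H; rewrite -natr1 mulrDl mul1r addrCA addrC lerD2r. Qed.

Section LongRun.
Context (R : realType) (n k d : nat) (i0 : 'I_k) (X : 'I_n -> 'rV[R]_d).
Variable c0 : {ffun 'I_k -> 'rV[R]_d}.

Lemma first_stop : exists m, [/\ (m <= k ^ n + 2)%N, kmeans_stops_at i0 X c0 m &
  forall m', kmeans_stops_at i0 X c0 m' -> (m <= m')%N].
Proof.
have [m0 [m0b /asboolP st]] := stops_exists i0 X c0.
have ex : exists m, (fun m => `[< kmeans_stops_at i0 X c0 m >]) m by exists m0.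
exists (ex_minn ex); case: ex_minnP => m /asboolP stm least; split => //.
  by apply: leq_trans m0b; exact: least.
by move=> m' /asboolP; exact: least.
Qed.

(** The run is cut into [S] blocks of [W] steps. By monotonicity a block with total drop at most
    eta^2 is a tiny window; without one, the potential would fall by more than its initial value. *)
Lemma window_of_long_run (W S L : nat) (Phi eta : R) :
  (W * S + 2 <= L)%N -> (forall m, kmeans_stops_at i0 X c0 m -> (L < m)%N) ->
  Psi X (asg i0 X c0 0) <= Phi -> Phi < S%:R * eta ^+ 2 ->
  exists t, tiny_window i0 X c0 eta W t.
Proof.
move=> WS ns Phi0 PhiS; apply: contrapT => no.
have mono s j : Psi X (asg i0 X c0 (s + j)) <= Psi X (asg i0 X c0 s).
  elim: j => [|j IH]; first by rewrite addn0.
  by rewrite addnS; apply: le_trans IH; exact: Psi_asg_le.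
have dec s : (s <= S)%N -> Psi X (asg i0 X c0 (W * s)) + s%:R * eta ^+ 2 <= Psi X (asg i0 X c0 0).
  elim: s => [|s IH] sS; first by rewrite muln0 mul0r addr0.
  apply: le_trans (IH (ltnW sS)).
  have [le|/ltW gt] := leP (Psi X (asg i0 X c0 (W * s)) - Psi X (asg i0 X c0 (W * s.+1))) (eta ^+ 2).
    exfalso; apply: no; exists (W * s)%N => u /andP[u1 u2]; split.
      apply: le_trans le; apply: lerB.
        by rewrite -(subnKC u1); exact: mono.
      have uW : (u.+1 <= W * s.+1)%N by rewrite mulnS addnC.
      by rewrite -(subnKC uW); exact: mono.
    (* A strict decrease from [u] is known as long as iteration u + 3 is not a stop, whence the
       margin 2 in the hypothesis on [L]. *)
    apply: no_stop_decr => /ns; apply/negP; rewrite -leqNgt; apply: leq_trans WS.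
    have : (W * s.+1 <= W * S)%N by rewrite leq_mul2l sS orbT.
    by move: u2; rewrite mulnS; clear; lia.
  by apply: add_step_le; rewrite addrC -lerBrDr.
have := dec S (leqnn _); have := Psi_ge0 X (asg i0 X c0 (W * S)).
lra.
Qed.

Lemma Psi_le_bound (f : 'I_n -> 'I_k) (R0 : R) : (forall x o, `|X x ord0 o| <= R0) ->
  Psi X f <= n%:R * (d%:R * R0 ^+ 2).
Proof.
move=> XR; apply: le_trans (Psi_le X f (fun=> 0)) _.
rewrite (_ : n%:R * _ = \sum_(x < n) (d%:R * R0 ^+ 2)); last by rewrite sumr_const card_ord mulr_natl.
by apply: ler_sum => x _; apply: sqdist_le => o; rewrite mxE subr0.
Qed.

End LongRun.

(** The binomial theorem in the second variable; binomial coefficients beyond [e2] vanish, which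
    fills up the square array. *)
Lemma poly_form (R : realType) (C : R) (e1 e2 : nat) :
  exists (D : nat) (a : 'I_D -> 'I_D -> R), forall x y,
  \sum_(i < D) \sum_(j < D) a i j * x ^+ i * y ^+ j = C * x ^+ e1 * (1 + y) ^+ e2.
Proof.
pose D := (e1 + e2).+1.
exists D, (fun i j => if i == e1 :> nat then C * 'C(e2, j)%:R else 0) => x y.
have e1D : (e1 < D)%N by rewrite ltnS leq_addr.
rewrite (bigD1 (Ordinal e1D))//= [X in _ + X]big1 ?addr0; last first.
  move=> i ie; apply: big1 => j _; rewrite ifF ?mul0r//.
  by apply: contraNF ie => /eqP h; apply/eqP/val_inj.
rewrite eqxx exprDn.
transitivity (\sum_(j < D) C * x ^+ e1 * ('C(e2, j)%:R * y ^+ j)).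
  by apply: eq_bigr => j _; ring.
rewrite -mulr_sumr; congr (_ * _).
have e2D : (e2.+1 <= D)%N by rewrite ltnS leq_addl.
rewrite (big_ord_widen D (fun j => 1 ^+ (e2 - j) * y ^+ j *+ 'C(e2, j)) e2D).
rewrite [RHS]big_mkcond; apply: eq_bigr => j _; rewrite expr1n mul1r ltnS.
case: leqP => [_|lt]; first by rewrite mulr_natl.
by rewrite bin_small// mul0r.
Qed.

(** exp (- 4 n^2) beats the worst possible running time 2^(n^2 + 2). This is the reason for cutting
    the Gaussians off at 4 n sigma. *)
Lemma tail_le (R : realType) (n : nat) :
  (2 ^ (n ^ 2 + 2))%:R * expR (- ((4 * n%:R) ^+ 2 / 4)) <= 4 :> R.
Proof.
have -> : - ((4 * n%:R) ^+ 2 / 4) = (4 * n ^ 2)%N%:R * (- 1) :> R.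
  by rewrite natrM natrX; field.
rewrite expRM_natl; set a := expR (- 1).
have a0 : 0 <= a by exact: expR_ge0.
have ha : a <= 2^-1.
  by rewrite /a expRN lef_pV2 ?posrE ?expR_gt0//; have := expR_ge1Dx (1 : R); lra.
have a4 : 2 * a ^+ 4 <= 1.
  have : a ^+ 4 <= a by rewrite -[leRHS]expr1 ler_wiXn2l//; lra.
  lra.
rewrite expnD natrM natrX exprM mulrAC -exprMn -[leRHS]mul1r.
apply: ler_pM => //; first by rewrite exprn_ge0// mulr_ge0// exprn_ge0.
by rewrite exprn_ile1// mulr_ge0// exprn_ge0.
Qed.

(** 33 = 1 + 24 + 8: the constant term, the equal contributions of at most 3 n^2 scales, and the
    Gaussian tails. *)
Lemma cover_numbers (R : realType) (n d W M : nat) (Y T : R) :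
  (0 < n)%N -> (d <= n)%N -> (W <= n.+1)%N -> (M <= n ^ 2 + 2)%N -> 1 <= Y -> 0 <= T -> T <= 4 ->
  1 + (M%:R * (Y * (4 * W%:R * n%:R * d%:R)) + (n * d)%:R * (2 * T)) <= 33 * (n%:R ^+ 5 * Y).
Proof.
move=> n0 dn Wn Mn Y1 T0 T4.
have n1 : 1 <= n%:R :> R by rewrite ler1n.
have Y0 : 0 <= Y by lra.
have nX a : 1 <= n%:R ^+ a :> R by exact: exprn_ege1.
have h1 : M%:R <= 3 * n%:R ^+ 2 :> R.
  apply: (@le_trans _ _ (n ^ 2 + 2)%:R); first by rewrite ler_nat.
  by rewrite natrD natrX; have := nX 2%N; lra.
have h2 : W%:R <= 2 * n%:R :> R.
  by apply: (@le_trans _ _ n.+1%:R); rewrite ?ler_nat// -natr1; lra.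
have h3 : d%:R <= n%:R :> R by rewrite ler_nat.
have h4 : M%:R * (Y * (4 * W%:R * n%:R * d%:R)) <= 24 * (n%:R ^+ 5 * Y).
  have -> : 24 * (n%:R ^+ 5 * Y) = 3 * n%:R ^+ 2 * (Y * (4 * (2 * n%:R) * n%:R * n%:R)) by ring.
  apply: ler_pM; [nonneg|nonneg|done|].
  apply: ler_wpM2l => //.
  apply: ler_pM; [nonneg|nonneg| |done].
  by rewrite ler_wpM2r// ler_wpM2l.
have h5 : (n * d)%:R * (2 * T) <= 8 * (n%:R ^+ 5 * Y).
  have -> : 8 * (n%:R ^+ 5 * Y) = n%:R * n%:R * (8 * (n%:R ^+ 3 * Y)) by ring.
  rewrite natrM; apply: ler_pM; [nonneg|nonneg|by rewrite ler_wpM2l|].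
  have : 1 <= n%:R ^+ 3 * Y by apply: mulr_ege1.
  lra.
have : 1 <= n%:R ^+ 5 * Y by apply: mulr_ege1.
lra.
Qed.

Section Expectation.
Context (R : realType) (n k d W : nat) (sigma V b : R) (mu : 'I_n -> 'rV[R]_d).
Variables (i0 : 'I_k) (c0 : {ffun 'I_k -> 'rV[R]_d}).
Local Notation R0 := (1 + 4 * n%:R * sigma).
Local Notation tail := (#|{: 'I_n * 'I_d}|%:R * (2 * expR (- ((4 * n%:R) ^+ 2 / 4))) : R).
Hypothesis sigma0 : 0 < sigma.
Hypothesis n0 : (0 < n)%N.
Hypothesis kn : (k <= n)%N.
Hypothesis d0 : (0 < d)%N.
Hypothesis dn : (d <= n)%N.
Hypothesis mu01 : forall i j, 0 <= mu i ord0 j <= 1.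
Hypothesis b1 : 1 <= b.
Hypothesis R0b : R0 <= b * sigma.
Hypothesis V1 : 1 <= V.
Hypothesis W1 : (1 < W)%N.
Hypothesis Wn : (W <= n.+1)%N.
Hypothesis cov : forall eta : R, 0 < eta ->
  pcover sigma [set g | (forall x o, `|pts mu g x ord0 o| <= R0) /\
    exists t, tiny_window i0 (pts mu g) c0 eta W t]%classic (V * (eta / sigma) ^+ 2).

Lemma run_cover l (m : ('I_n * 'I_d -> R) -> nat) :
  (forall g m', kmeans_stops_at i0 (pts mu g) c0 m' -> (m g <= m')%N) ->
  pcover sigma [set g | (2 ^ l < m g)%N]%classic
    (V * b ^+ 2 * (4 * W%:R * n%:R * d%:R) / 2 ^+ l + tail).
Proof.
move=> mP.
have n1 : 1 <= n%:R :> R by rewrite ler1n.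
have d1 : 1 <= d%:R :> R by rewrite ler1n.
have W1' : 1 <= W%:R :> R by rewrite ler1n ltnW.
have tail0 : 0 <= tail by rewrite !mulr_ge0 ?expR_ge0.
have bb1 : 1 <= b ^+ 2 by rewrite exprn_ege1.
have L0 : 0 < 2 ^+ l :> R by rewrite exprn_gt0.
(* For short runs the bound exceeds one. Otherwise the [S] blocks of length [W] fill more than a
   quarter of the 2^l steps, which explains the factor 4 in the choice of [eta]. *)
have [small|big] := ltnP (2 ^ l) (4 * W).
  apply: pcover1; rewrite -[leLHS]addr0; apply: lerD => //.
  rewrite ler_pdivlMr// mul1r; apply: (@le_trans _ _ (4 * W%:R)).
    by rewrite -natrX -natrM ler_nat ltnW.
  have -> : V * b ^+ 2 * (4 * W%:R * n%:R * d%:R) = (V * b ^+ 2 * (n%:R * d%:R)) * (4 * W%:R) by ring.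
  rewrite ler_peMl ?mulr_ge0//; apply: mulr_ege1; apply: mulr_ege1 => //.
pose S := ((2 ^ l - 2) %/ W)%N.
have WS : (W * S + 2 <= 2 ^ l)%N.
  have := leq_trunc_div (2 ^ l - 2) W; rewrite -/S mulnC; move: big W1; clear; lia.
have LS : (2 ^ l < S * (4 * W))%N.
  have := ltn_ceil (2 ^ l - 2) (ltnW W1); rewrite -/S; move: big W1; clear; nia.
have R00 : 0 < R0 by rewrite addr_gt0// !mulr_gt0//; lra.
pose Phi := n%:R * (d%:R * R0 ^+ 2).
have Phi0 : 0 < Phi by rewrite !mulr_gt0 ?exprn_gt0//; lra.
pose eta := Num.sqrt (4 * W%:R * Phi / 2 ^+ l).
have x0 : 0 < 4 * W%:R * Phi / 2 ^+ l.
  by rewrite divr_gt0// mulr_gt0// mulr_gt0//; lra.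
have etaE : eta ^+ 2 = 4 * W%:R * Phi / 2 ^+ l by rewrite sqr_sqrtr// ltW.
have eta0 : 0 < eta by rewrite sqrtr_gt0.
have PhiS : Phi < S%:R * eta ^+ 2.
  rewrite etaE mulrA ltr_pdivlMr// mulrC.
  have -> : S%:R * (4 * W%:R * Phi) = (S * (4 * W))%:R * Phi by rewrite !natrM; ring.
  by rewrite ltr_pM2r// -natrX ltr_nat.
have a0 : 0 <= 4 * n%:R :> R by rewrite mulr_ge0.
have H := pcoverU (@cov eta eta0) (pcover_tail ('I_n * 'I_d)%type sigma0 a0).
apply: pcover_sub (pcover_le _ H); last first.
  rewrite lerD2r -!(mulrA V); apply: ler_wpM2l; first exact: le_trans ler01 V1.
  rewrite expr_div_n etaE mulrAC ler_pM2r ?invr_gt0//.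
  rewrite ler_pdivrMr ?exprn_gt0//.
  have -> : 4 * W%:R * Phi = (4 * W%:R * n%:R * d%:R) * R0 ^+ 2 by rewrite /Phi; ring.
  have -> : b ^+ 2 * (4 * W%:R * n%:R * d%:R) * sigma ^+ 2 = (4 * W%:R * n%:R * d%:R) * (b * sigma) ^+ 2 by ring.
  rewrite ler_wpM2l ?mulr_ge0//; apply: lerXn2r => //; rewrite nnegrE; first exact: ltW.
  by apply: le_trans R0b; exact: ltW.
move=> g lm /=.
have [tl|ntl] := pselect (exists i, 4 * n%:R * sigma < `|g i|); first by right.
left; have XR x o : `|pts mu g x ord0 o| <= R0.
  rewrite ptsE; apply: le_trans (ler_normD _ _) _; apply: lerD.
    by have /andP[h1 h2] := mu01 x o; rewrite ger0_norm.
  by rewrite leNgt; apply/negP => h; apply: ntl; exists (x, o).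
split => //; apply: (window_of_long_run WS) PhiS.
  by move=> m' /mP; exact: leq_trans.
exact: Psi_le_bound.
Qed.

Lemma kmeans_expectation :
  (gauss_expect sigma (fun g => kmeans_iterations i0 (pts mu g) c0) <=
   (33 * (n%:R ^+ 5 * (V * b ^+ 2)))%:E)%E.
Proof.
have /choice[m Hm] : forall g, exists m, [/\ (m <= k ^ n + 2)%N, kmeans_stops_at i0 (pts mu g) c0 m &
  forall m', kmeans_stops_at i0 (pts mu g) c0 m' -> (m <= m')%N].
  by move=> g; exact: first_stop.
have VV1 : 1 <= V * b ^+ 2 by apply: mulr_ege1; rewrite ?exprn_ege1.
(* Number of scales: k <= n <= 2^n, hence k^n + 2 <= 2^(n^2 + 2). *)
pose M := (n ^ 2 + 2)%N.
have mM g : (m g <= 2 ^ M)%N.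
  have [h _ _] := Hm g; apply: leq_trans h _.
  have h1 : (k ^ n <= 2 ^ (n ^ 2))%N.
    apply: (@leq_trans ((2 ^ n) ^ n)%N); last by rewrite -expnM.
    by rewrite leq_exp2r//; apply: leq_trans kn _; exact: ltnW (ltn_expl _ _).
  have h2 : (0 < 2 ^ (n ^ 2))%N by rewrite expn_gt0.
  by rewrite /M expnD; move: h1 h2; set u := (2 ^ (n ^ 2))%N; set v := (k ^ n)%N; clear; lia.
apply: le_trans (gauss_expect_dyadic (f := fun g => kmeans_iterations i0 (pts mu g) c0) (m := m)
  (M := M) (p := fun l => V * b ^+ 2 * (4 * W%:R * n%:R * d%:R) / 2 ^+ l + tail) _ _ mM _) _.
- by move=> g; exact: kmeans_iterations_ge0.
- by move=> g; apply: kmeans_iterations_le; have [] := Hm g.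
- by move=> l _; apply: run_cover => // g; have [] := Hm g.
rewrite lee_fin.
have T0 : 0 <= (2 ^ M)%:R * expR (- ((4 * n%:R) ^+ 2 / 4)) :> R by rewrite mulr_ge0 ?expR_ge0.
have := cover_numbers n0 dn Wn (leqnn M) VV1 T0 (tail_le R n).
apply: le_trans; rewrite lerD2l; set Q := V * _ * _.
(* The main terms are equal at all scales, while the tails, weighted by 2^l, add up to at most
   [2 ^+ M] of them. *)
have geo a : \sum_(l < a) 2 ^+ l <= 2 ^+ a :> R.
  elim: a => [|a IH]; first by rewrite big_ord0 ler01.
  by rewrite big_ord_recr/= exprS mulr_natl mulr2n lerD2r.
have -> : \sum_(l < M) 2 ^+ l * (Q / 2 ^+ l + tail) = M%:R * Q + (\sum_(l < M) 2 ^+ l) * tail.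
  rewrite mulr_suml (_ : M%:R * Q = \sum_(l < M) Q); last by rewrite sumr_const card_ord mulr_natl.
  rewrite -big_split/=; apply: eq_bigr => l _.
  by rewrite mulrDr mulrCA divff ?mulr1// gt_eqF// exprn_gt0.
rewrite lerD2l card_prod !card_ord.
have -> : (n * d)%:R * (2 * ((2 ^ M)%:R * expR (- ((4 * n%:R) ^+ 2 / 4)))) =
   2 ^+ M * ((n * d)%:R * (2 * expR (- ((4 * n%:R) ^+ 2 / 4)))) :> R by rewrite natrX; ring.
by apply: ler_wpM2r (geo M); rewrite !mulr_ge0 ?expR_ge0.
Qed.

End Expectation.

Lemma final_form (R : comPzRingType) (c u f N s : R) (m : nat) :
  c * (N ^+ 5 * (u * (N ^+ (m + 11) * (f * N * s) ^+ 114) * (f * N * s) ^+ 2)) =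
  c * u * f ^+ 116 * N ^+ (m + 132) * s ^+ 116.
Proof.
have -> : (m + 132 = 5 + (m + 11) + 116)%N by rewrite -!addnA addnCA.
rewrite !(exprD N) !(exprMn _ (f * N)) !(exprMn _ f).
rewrite (exprD f 114 2) (exprD s 114 2) (exprD N 114 2).
by move: (N ^+ 5) (N ^+ m) (N ^+ 11) (f ^+ 114) (N ^+ 114) (s ^+ 114) => *; ring.
Qed.

Theorem theorem1 (R : realType) :
  exists (D : nat) (a : 'I_D -> 'I_D -> R),
  forall (n k d : nat) (hn : (0 < n)%N) (hk : (0 < k)%N) (hd : (0 < d)%N),
  (k <= n)%N -> (d <= n)%N ->
  forall (sigma : R), 0 < sigma ->
  forall (mu : 'I_n -> 'rV[R]_d),
  (forall i j, 0 <= mu i ord0 j <= 1) ->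
  forall (c0 : {ffun 'I_k -> 'rV[R]_d}),
  (gauss_expect sigma
     (fun g : 'I_n * 'I_d -> R =>
        kmeans_iterations (Ordinal hk)
          (fun i => (mu i + \row_(j < d) g (i, j))%R) c0)
   <= (\sum_(i < D) \sum_(j < D)
         a i j * (n%:R `^ (Num.sqrt k%:R)) ^+ i * sigma^-1 ^+ j)%:E)%E.
Proof.
pose E := (4 * (5 * (20 * 20 + 1)) + 132)%N.
have [D [a Ha]] := @poly_form R (33 * 100 ^+ 2 * 4 ^+ 116) (2 * E) 116.
exists D, a => n k d hn hk hd kn dn sigma sigma0 mu mu01 c0; rewrite Ha.
(* With this rounding k <= q^2 and q <= 2 sqrt k, so n^q is at most the square of n^(sqrt k); hence
   the exponent [2 * E] in the polynomial. *)
pose rk : R := Num.sqrt k%:R; pose q := (Num.truncn rk).+1.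
have rk1 : 1 <= rk by rewrite -[leLHS]sqrtr1 ler_wsqrtr// ler1n.
have /truncn_itv/andP[q1 q2] : 0 <= rk by exact: sqrtr_ge0.
have kq : (k <= q * q)%N.
  rewrite -(ler_nat R) natrM -expr2 -[leLHS]sqr_sqrtr// lerXn2r ?nnegrE ?sqrtr_ge0//.
  exact: ltW.
have n1 : 1 <= n%:R :> R by rewrite ler1n.
have nq : n%:R ^+ q <= (n%:R `^ rk) ^+ 2.
  rewrite -!powR_mulrn ?powR_ge0// -powRrM; apply: ler_powR => //.
  by rewrite /q -natr1; lra.
have [W [W1 Wn cov]] := window_cover mu (Ordinal hk) c0 sigma0 hk kn hd dn (ltn0Sn _ : (0 < q)%N) kq.
have [_ _ b1 R0b] := base_ge sigma0 hk kn.
have V1 := mulr_ege1 (exprn_ege1 2 (ler1n R 100)) (base_factor_ge1 q sigma0 hk kn).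
have H := kmeans_expectation sigma0 hn kn hd dn mu01 b1 R0b V1 W1 Wn cov.
apply: le_trans H _; rewrite lee_fin final_form.
apply: ler_wpM2r; first by rewrite exprn_ge0// addr_ge0// invr_ge0 ltW.
apply: ler_wpM2l; first by rewrite !mulr_ge0 ?exprn_ge0.
rewrite [leRHS]exprM.
apply: (@le_trans _ _ ((n%:R ^+ q) ^+ E)); last by rewrite lerXn2r ?nnegrE ?exprn_ge0 ?powR_ge0.
rewrite -exprM; apply: ler_weXn2l => //.
rewrite /E (mulnDr q); apply: leq_add; last by rewrite leq_pmull.
by rewrite (mulnA 4) mulnC.
Qed.
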